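(* Let $d=1$, and let $B$ be a standard one-dimensional Brownian motion and $\mu$ an independent Poisson random measure with Lévy measure $\nu(dx)=\frac{1}{x^2}\mathbf 1_{\{x>0\}}\,dx$. Set $S=\inf\{t\ge 0: B_t=1\}$, $u_s=\mathbf 1_{[S,+\infty)}(s)$, $N_t=\mu([0,t]\times[1,\infty))$ and $\tilde N_t=N_t-t$, $t\ge 0$. Then both processes $$X_t=B_{S\wedge t}+\tilde N_t-\tilde N_{S\wedge t},\qquad X'_t=-B_{S\wedge t}+\tilde N_t-\tilde N_{S\wedge t},\qquad t\ge 0,$$ are solutions of the structure equation driven by $u$, that is, $[X]_t=t+\int_0^tu_s\,dX_s$ and $[X']_t=t+\int_0^tu_s\,dX'_s$ for $t\ge0$, but $X$ and $X'$ do not have the same law. In particular, the solution of the structure equation driven by a given bounded predictable process $u$ in a Wiener–Poisson space is in general not unique, not even in law.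
   Context: $B$ and $\mu$ are defined on a common probability space $(\Omega,\mathcal F,P)$, where $\mu$ is a time-homogeneous Poisson random measure on $[0,\infty)\times\mathbb R^*$, $\mathbb R^*=\mathbb R\setminus\{0\}$, with intensity $dt\,\nu(dx)$. $\mathbf F$ is the $P$-augmented filtration generated by $B$ and $\mu$. A solution of the structure equation driven by an $\mathbf F$-predictable process $u$ is a square integrable $\mathbf F$-martingale $X$ with $X_0=0$ and $[X]_t=t+\int_0^tu_s\,dX_s$, $t\ge0$, where $[X]$ is the quadratic variation. The law of a process means its law as a random càdlàg path. *)

(* Defs.v *)
From HB Require Import structures.
From mathcomp Require Import all_boot all_order all_algebra.
From mathcomp Require Import all_classical all_reals all_analysis.
From mathcomp Require Import measurable_realfun.

Set Implicit Arguments.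
Unset Strict Implicit.
Unset Printing Implicit Defensive.

Import Order.TTheory GRing.Theory Num.Theory.
Import numFieldNormedType.Exports.

Local Open Scope classical_set_scope.
Local Open Scope ring_scope.

(* Real-valued processes are functions [X : R -> T -> R], time first; only the
   times [0 <= t] are ever used.  The sub-sigma-algebras of [T] (in particular
   the members of a filtration) are sets of sets. *)

Section sigma_algebras.
Context {d : measure_display} {T : measurableType d} {R : realType}.
Implicit Types (P : probability T R) (G H : set (set T)).

Definition independent_sigma P G H : Prop :=
  forall A C, G A -> H C -> P (A `&` C) = (P A * P C)%E.

Definition measurable_wrt d' (V : measurableType d') G (f : T -> V) : Prop :=
  forall A, measurable A -> G (f @^-1` A).

End sigma_algebras.

Section cadlag_paths.
Context {R : realType}.

Definition cadlag (f : R -> R) : Prop :=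
  (forall t : R, 0 <= t -> f x @[x --> t^'+] --> f t) /\
  (forall t : R, 0 < t -> cvg (f x @[x --> t^'-])).

(* The sigma-algebra on the space of cadlag paths generated by the coordinate
   projections, i.e. the Borel sigma-algebra of the Skorokhod topology. *)
Definition skorokhod_sigma : set (set (R -> R)) :=
  <<s cadlag, [set C | exists t (A : set R),
       [/\ 0 <= t, measurable A & C = [set f | cadlag f /\ A (f t)]]] >>.

End cadlag_paths.

Section brownian_poisson.
Context {d : measure_display} {T : measurableType d} {R : realType}.
Variable P : probability T R.
Implicit Types (B : R -> T -> R) (mu : T -> {measure set (R * R) -> \bar R}).

Definition brownian_gen B (t : R) : set (set T) :=
  [set E | exists s (A : set R),
     [/\ 0 <= s <= t, measurable A & E = B s @^-1` A]].

Record brownian_motion B : Prop := BrownianMotion {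
  brownian_measurable : forall t : R, 0 <= t -> measurable_fun setT (B t) ;
  brownian_start : {ae P, forall w, B 0 w = 0} ;
  brownian_continuous :
    {ae P, forall w, {within `[0, +oo[, continuous (B ^~ w)}} ;
  brownian_normal : forall (s t : R) (A : set R), 0 <= s < t -> measurable A ->
    P ((fun w => B t w - B s w) @^-1` A) = normal_prob 0 (Num.sqrt (t - s)) A ;
  brownian_indep : forall s t : R, 0 <= s < t ->
    independent_sigma P <<s brownian_gen B s >>
      [set E | exists2 A : set R, measurable A &
                 E = (fun w => B t w - B s w) @^-1` A] }.

(* The measurable subsets of [0, t] x R^* and of [0, +oo[ x R^*. *)
Definition strip_upto (t : R) : set (set (R * R)) :=
  [set A : set (R * R) | measurable A /\ A `<=` `[0, t] `*` [set x : R | x != 0]].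

Definition strip : set (set (R * R)) :=
  [set A : set (R * R) | measurable A /\ A `<=` `[0, +oo[ `*` [set x : R | x != 0]].

(* The product dt nu(dx), written as an iterated integral so that [nu] need not
   be packaged as a sigma-finite measure. *)
Definition intensity (nu : set R -> \bar R) (A : set (R * R)) : \bar R :=
  (\int[lebesgue_measure]_(t in `[0%R, +oo[) nu (xsection A t))%E.

(* Poisson random measure on [0, +oo[ x R^*; what [mu w] does outside of
   [0, +oo[ x R^* is immaterial. *)
Record poisson_random_measure mu (nu : set R -> \bar R) : Prop :=
  PoissonRandomMeasure {
  prm_measurable : forall A, strip A ->
    measurable_fun setT (mu ^~ A : T -> \bar R) ;
  prm_poisson : forall A k, strip A -> (intensity nu A < +oo)%E ->
    P [set w | mu w A = (k%:R)%:E] =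
    poisson_prob (fine (intensity nu A)) k [set k] ;
  prm_infinite : forall A, strip A -> intensity nu A = +oo%E ->
    {ae P, forall w, mu w A = +oo%E} ;
  prm_indep : forall n (A : 'I_n -> set (R * R)) (C : 'I_n -> set (\bar R)),
    (forall i, strip (A i)) -> trivIset setT A ->
    (forall i, measurable (C i)) ->
    P (\bigcap_(i in [set: 'I_n]) [set w | C i (mu w (A i))]) =
    (\prod_(i < n) P [set w | C i (mu w (A i))])%E }.

Definition prm_gen mu (D : set (set (R * R))) : set (set T) :=
  [set E | exists (A : set (R * R)) (C : set (\bar R)),
     [/\ D A, measurable C & E = [set w | C (mu w A)]]].

Definition wiener_poisson B mu (nu : set R -> \bar R) : Prop :=
  [/\ brownian_motion B, poisson_random_measure mu nu &
      independent_sigma P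
        <<s \bigcup_(t in `[0, +oo[) brownian_gen B t >> <<s prm_gen mu strip >>].

(* Augmentation presupposes a complete [P], for which [P.-negligible] is the
   set of the P-null members of the ambient sigma-algebra. *)
Definition wp_filtration B mu (t : R) : set (set T) :=
  <<s brownian_gen B t `|` prm_gen mu (strip_upto t) `|` P.-negligible >>.

End brownian_poisson.

Section stochastic_calculus.
Context {d : measure_display} {T : measurableType d} {R : realType}.
Variables (P : probability T R) (F : R -> set (set T)).
Implicit Types (X Q I u : R -> T -> R).

Definition adapted X : Prop :=
  forall t : R, 0 <= t -> measurable_wrt (F t) (X t).

Definition cadlag_process X : Prop := {ae P, forall w, cadlag (X ^~ w)}.

Record square_integrable_martingale X : Prop := SquareIntegrableMartingale {
  sqmart_adapted : adapted X ;
  sqmart_cadlag : cadlag_process X ;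
  sqmart_integrable : forall t : R, 0 <= t -> P.-integrable setT (EFin \o X t) ;
  sqmart_square : forall t : R, 0 <= t ->
    P.-integrable setT (fun w => (X t w ^+ 2)%:E) ;
  sqmart_mart : forall (s t : R) A, 0 <= s <= t -> F s A ->
    (\int[P]_(w in A) (X t w)%:E = \int[P]_(w in A) (X s w)%:E)%E }.

(* [Q] is the quadratic variation of [X]: for every t, the sums of squared
   increments of [X] along subdivisions 0 = p 0 <= ... <= p n = t converge
   in probability to [Q t] as the mesh goes to 0. *)
Record quadratic_variation X Q : Prop := QuadraticVariation {
  qv_adapted : adapted Q ;
  qv_cadlag : cadlag_process Q ;
  qv_nondecreasing : {ae P, forall w,
    forall s t : R, 0 <= s <= t -> Q s w <= Q t w} ;
  qv_limit : forall t e eta : R, 0 <= t -> 0 < e -> 0 < eta ->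
    exists2 delta : R, 0 < delta & forall n (p : nat -> R),
      p 0%N = 0 -> p n = t ->
      (forall i, (i < n)%N -> p i <= p i.+1 < p i + delta) ->
      (P [set w | (e <=
            `|\sum_(i < n) (X (p i.+1) w - X (p i) w) ^+ 2 - Q t w|)%R]
       < eta%:E)%E }.

Definition predictable_rect : set (set (R * T)) :=
  [set C | (exists2 A, F 0 A & C = [set 0] `*` A) \/
           (exists s t A, [/\ 0 <= s <= t, F s A & C = `]s, t] `*` A])].

(* [R * T] with the predictable sigma-algebra of [0, +oo[ x T. *)
Notation predictable_type := (g_sigma_algebraType predictable_rect).

Definition predictable u : Prop :=
  measurable_fun (`[0, +oo[ `*` setT : set predictable_type)
    (fun z : predictable_type => u z.1 z.2).

Definition bounded_process u : Prop :=
  exists M : R, forall t w, 0 <= t -> `|u t w| <= M.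

(* [m] is the Doleans measure of the square integrable martingale [X], so that
   the integral of H^2 against [m] is E[\int H_s^2 d[X]_s] for H predictable. *)
Definition doleans_measure X (m : {measure set predictable_type -> \bar R}) :
  Prop :=
  (forall A, F 0 A -> m ([set 0] `*` A) = 0%E) /\
  (forall (s t : R) A, 0 <= s <= t -> F s A ->
     m (`]s, t] `*` A) = (\int[P]_(w in A) ((X t w - X s w) ^+ 2)%:E)%E).

(* The simple predictable process \sum_(i < sp_n) h_i 1_(]t_i, t_(i+1)]), with
   h_i bounded and F_(t_i)-measurable. *)
Record simple_process := SimpleProcess {
  sp_n : nat ;
  sp_t : nat -> R ;
  sp_h : nat -> T -> R ;
  sp_t0 : 0 <= sp_t 0%N ;
  sp_t_le : forall i, (i < sp_n)%N -> sp_t i <= sp_t i.+1 ;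
  sp_h_meas : forall i, (i < sp_n)%N -> measurable_wrt (F (sp_t i)) (sp_h i) ;
  sp_h_bounded : forall i, (i < sp_n)%N ->
    exists M : R, forall w, `|sp_h i w| <= M }.

Definition simple_val (H : simple_process) (t : R) (w : T) : R :=
  \sum_(i < sp_n H) sp_h H i w * ((sp_t H i < t <= sp_t H i.+1)%R)%:R.

Definition simple_integral (H : simple_process) X (t : R) (w : T) : R :=
  \sum_(i < sp_n H) sp_h H i w *
    (X (Num.min (sp_t H i.+1) t) w - X (Num.min (sp_t H i) t) w).

(* [I] is the stochastic integral \int_0^. u_s dX_s of the predictable process
   [u] against the square integrable martingale [X] (L^2-extension of the
   elementary integral by the Ito isometry). *)
Definition stochastic_integral u X I : Prop :=
  [/\ adapted I, cadlag_process I &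
    exists (m : {measure set predictable_type -> \bar R})
           (H : nat -> simple_process),
    [/\ doleans_measure X m,
        forall t : R, 0 <= t ->
          (\int[m]_(z in `[0%R, t] `*` setT)
             ((simple_val (H n) z.1 z.2 - u z.1 z.2) ^+ 2)%:E)%E
            @[n --> \oo] --> 0%E &
        forall t : R, 0 <= t ->
          (\int[P]_w ((simple_integral (H n) X t w - I t w) ^+ 2)%:E)%E
            @[n --> \oo] --> 0%E]].

(* [X] solves [X]_t = t + \int_0^t u_s dX_s, t >= 0. *)
Definition structure_solution u X : Prop :=
  [/\ square_integrable_martingale X,
      {ae P, forall w, X 0 w = 0} &
      exists Q I, [/\ quadratic_variation X Q, stochastic_integral u X I &
        {ae P, forall w, forall t : R, 0 <= t -> Q t w = t + I t w}]].

Definition same_law X Y : Prop :=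
  forall C, skorokhod_sigma C ->
    P [set w | C (X ^~ w)] = P [set w | C (Y ^~ w)].

Definition pathwise_unique u : Prop :=
  forall X Y, structure_solution u X -> structure_solution u Y ->
    {ae P, forall w, forall t : R, 0 <= t -> X t w = Y t w}.

Definition unique_in_law u : Prop :=
  forall X Y, structure_solution u X -> structure_solution u Y -> same_law X Y.

End stochastic_calculus.

Section example_data.
Context {d : measure_display} {T : measurableType d} {R : realType}.

(* nu(dx) = x^-2 1_(x > 0) dx. *)
Definition inverse_square_levy (A : set R) : \bar R :=
  (\int[lebesgue_measure]_(x in A) (x ^- 2 * ((0 < x)%R)%:R)%:E)%E.

(* inf {t >= 0 | B t w = a}, equal to +oo when there is no such t. *)
Definition hitting_time (B : R -> T -> R) (a : R) (w : T) : \bar R :=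
  ereal_inf (EFin @` [set t | 0 <= t /\ B t w = a]).

(* S /\ t, a real number as soon as S >= 0. *)
Definition min_time (S : T -> \bar R) (t : R) (w : T) : R :=
  fine (Order.min (S w) t%:E).

End example_data.

(* Main.v *)
(* On [[0, S]] the processes follow [W = B] or [W = - B], after [S] they follow
   the compensated Poisson process [Z = Nt]. Both [W] and [Z] are martingales
   with angle bracket [t], hence so is the process [X] switched at [S]: its
   Doleans measure is [dt x P]. The increment of [X] over a short interval is
   the increment of [W] or of [Z], chosen by the position of [S] relative to the
   left end point, plus a correction living on the only interval that contains
   [S], of variance at most the mesh. The squares of the former increments add up
   to time for [W] and to the jumps of [Z] for [Z], so that the quadratic
   variation is [t + (Z_t - Z_(S /\ t))] and the stochastic integral of
   [1_[S, oo[] is [Z_t - Z_(S /\ t)].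

   The laws differ because [- B >= - 1] before [S] and [Z_t - Z_s >= s - t], so
   that [X'_1 >= - 2], while [X_1 < - 2] as soon as [S > 1] and [B_1 < - 2]. The
   latter event has positive probability: in each of many short intervals of
   length [h ^ 2] Brownian motion decreases by [h / 2] with probability at least
   [1 / 256] (second and fourth moments), and starting below [0] it reaches [1]
   with probability at most [2 h ^ 2] (Chebyshev for the switched martingale). *)

Require Import Defs.
From HB Require Import structures.
From mathcomp Require Import all_boot all_order all_algebra.
From mathcomp Require Import all_classical all_reals all_analysis.
From mathcomp Require Import measurable_realfun.
From mathcomp Require Import ring lra.

Import Order.TTheory GRing.Theory Num.Theory.
Import numFieldNormedType.Exports.

Local Open Scope classical_set_scope.
Local Open Scope ring_scope.

Set Implicit Arguments.
Unset Strict Implicit.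

(** * Square integrable random variables *)

Section expectation.
Context {d : measure_display} {T : measurableType d} {R : realType}.
Variable P : probability T R.
Implicit Types (f g h : T -> R) (A : set T).

(** No optional stopping or Ito calculus is invoked: everything comes from deterministic partitions.
    The obstacle is that [M] at the random time [S /\ b] is not an increment over a deterministic
    interval. Freezing the choice between [W] and [Z] at the left end point keeps each summand
    conditionally centred, and the error is confined to [overshoot], a limit of elementary
    martingale sums whose variance is at most the step times the probability that [S] falls in it.
    Summed over a partition these bounds give at most the mesh. This one estimate yields the
    martingale property, the conditional variance, the quadratic variation and the convergence of
    the simple integrals. The Poisson part fits because [nu] gives mass 1 to [1, oo[, so that the
    angle bracket is [t] as for Brownian motion. A second obstacle is that path regularity holds
    only almost surely. The abstract part is therefore applied to modifications with all paths
    regular; they stay adapted because the filtration contains the null sets, and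
    indistinguishability carries the result back to the original processes. *)

Definition Ex f : R := Rintegral P setT f.
Definition L1 f : Prop := P.-integrable setT (EFin \o f).
Definition L2 f : Prop := measurable_fun setT f /\ L1 (fun w => f w ^+ 2).

Lemma L1_measurable f : L1 f -> measurable_fun setT f.
Proof. by move=> /integrableP[/measurable_EFinP]. Qed.

Lemma L1_le g f : measurable_fun setT f -> (forall w, `|f w| <= g w) ->
  L1 g -> L1 f.
Proof.
move=> mf fg; apply: le_integrable => //; first exact/measurable_EFinP.
by move=> w _ /=; rewrite lee_fin (le_trans (fg w))// ler_norm.
Qed.

Lemma L1D f g : L1 f -> L1 g -> L1 (fun w => f w + g w).
Proof. by move=> lf lg; exact: (integrableD measurableT lf lg). Qed.

Lemma L1B f g : L1 f -> L1 g -> L1 (fun w => f w - g w).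
Proof. by move=> lf lg; exact: (integrableB measurableT lf lg). Qed.

Lemma L1Z (c : R) f : L1 f -> L1 (fun w => c * f w).
Proof. by move=> lf; exact: (integrableZl measurableT c lf). Qed.

Lemma L1_cst (c : R) : L1 (fun=> c).
Proof. exact: finite_measure_integrable_cst. Qed.

Lemma L1_norm f : L1 f -> L1 (fun w => `|f w|).
Proof. by move=> lf; exact: (integrable_norm lf). Qed.

Lemma L1_sum n (x : nat -> T -> R) : (forall i, (i < n)%N -> L1 (x i)) ->
  L1 (fun w => \sum_(i < n) x i w).
Proof.
elim: n => [|n IH] xi.
  by under [X in L1 X]eq_fun do rewrite big_ord0; exact: L1_cst.
under [X in L1 X]eq_fun do rewrite big_ord_recr/=.
by apply: L1D; [apply: IH => i /ltnW; exact: xi|exact: xi].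
Qed.

Lemma ExE f : L1 f -> (\int[P]_w (f w)%:E = (Ex f)%:E)%E.
Proof. by move=> lf; rewrite fineK//; exact: integrable_fin_num lf. Qed.

Lemma eq_Ex f g : f =1 g -> Ex f = Ex g.
Proof. by move=> /funext ->. Qed.

Lemma ExD f g : L1 f -> L1 g -> Ex (fun w => f w + g w) = Ex f + Ex g.
Proof. exact: RintegralD. Qed.

Lemma ExB f g : L1 f -> L1 g -> Ex (fun w => f w - g w) = Ex f - Ex g.
Proof. exact: RintegralB. Qed.

Lemma ExZ (c : R) f : L1 f -> Ex (fun w => c * f w) = c * Ex f.
Proof. exact: RintegralZl. Qed.

Lemma Ex_cst (c : R) : Ex (fun=> c) = c.
Proof. by rewrite /Ex Rintegral_cst// [X in fine X](probability_setT P) mulr1. Qed.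

Lemma Ex_le f g : L1 f -> L1 g -> (forall w, f w <= g w) -> Ex f <= Ex g.
Proof. by move=> ? ? ?; apply: le_Rintegral. Qed.

Lemma Ex_ge0 f : (forall w, 0 <= f w) -> 0 <= Ex f.
Proof. by move=> f0; apply: Rintegral_ge0. Qed.

Lemma Ex_sum n (x : nat -> T -> R) : (forall i, (i < n)%N -> L1 (x i)) ->
  Ex (fun w => \sum_(i < n) x i w) = \sum_(i < n) Ex (x i).
Proof.
elim: n => [|n IH] xi.
  by rewrite big_ord0; under eq_Ex do rewrite big_ord0; exact: Ex_cst.
under eq_Ex do rewrite big_ord_recr/=.
have xi' i : (i < n)%N -> L1 (x i) by move=> /ltnW; exact: xi.
by rewrite big_ord_recr ExD ?IH//; [exact: L1_sum|exact: xi].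
Qed.

Lemma L1_indic A : measurable A -> L1 (\1_A).
Proof.
by move=> mA; apply: integrable_indic => //; rewrite -ge0_fin_numE// fin_num_measure.
Qed.

Lemma Ex_indic A : measurable A -> Ex (\1_A) = fine (P A).
Proof. by move=> mA; rewrite /Ex /Rintegral integral_indic// setIT. Qed.

Lemma L1_ae_eq f g : {ae P, forall w, f w = g w} -> measurable_fun setT g ->
  L1 f -> L1 g.
Proof.
move=> fg mg /integrableP[mf fi]; apply/integrableP; split; first exact/measurable_EFinP.
rewrite (@ae_eq_integral _ _ _ P setT (abse \o (EFin \o f)))//.
- by apply: measurableT_comp => //; exact/measurable_EFinP.
- exact: measurableT_comp.
- by apply: filterS fg => w /= ->.
Qed.

Lemma Ex_ae_eq f g : {ae P, forall w, f w = g w} -> measurable_fun setT f ->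
  measurable_fun setT g -> Ex f = Ex g.
Proof.
move=> fg mf mg; rewrite /Ex /Rintegral; congr fine.
apply: ae_eq_integral => //; do ?exact/measurable_EFinP.
by apply: filterS fg => w /= ->.
Qed.

Lemma L2_measurable f : L2 f -> measurable_fun setT f. Proof. by case. Qed.

Lemma L2_sqr f : L2 f -> L1 (fun w => f w ^+ 2). Proof. by case. Qed.

Lemma L2M f g : L2 f -> L2 g -> L1 (fun w => f w * g w).
Proof.
move=> [mf f2] [mg g2].
apply: (@L1_le (fun w => f w ^+ 2 + g w ^+ 2)); last exact: L1D.
  exact: measurable_funM.
by move=> w; rewrite ler_norml; nra.
Qed.

Lemma L2D f g : L2 f -> L2 g -> L2 (fun w => f w + g w).
Proof.
move=> lf lg; have [[mf f2] [mg g2]] := (lf, lg); split; first exact: measurable_funD.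
have -> : (fun w => (f w + g w) ^+ 2) =
    (fun w => (f w ^+ 2 + g w ^+ 2) + 2 * (f w * g w)).
  by apply/funext => w; ring.
by apply: L1D; [exact: L1D|apply: L1Z; exact: L2M].
Qed.

Lemma L2Z (c : R) f : L2 f -> L2 (fun w => c * f w).
Proof.
move=> [mf f2]; split; first exact: measurable_funM.
by under [X in L1 X]eq_fun do rewrite exprMn; exact: L1Z.
Qed.

Lemma L2B f g : L2 f -> L2 g -> L2 (fun w => f w - g w).
Proof.
move=> lf lg; rewrite (_ : (fun w => _) = (fun w => f w + (-1) * g w)).
  by apply: L2D => //; exact: L2Z.
by apply/funext => w; ring.
Qed.

Lemma L2_cst (c : R) : L2 (fun=> c).
Proof. by split => //; exact: L1_cst. Qed.

Lemma L2_sum n (x : nat -> T -> R) : (forall i, (i < n)%N -> L2 (x i)) ->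
  L2 (fun w => \sum_(i < n) x i w).
Proof.
elim: n => [|n IH] xi.
  by under [X in L2 X]eq_fun do rewrite big_ord0; exact: L2_cst.
under [X in L2 X]eq_fun do rewrite big_ord_recr/=.
by apply: L2D; [apply: IH => i /ltnW; exact: xi|exact: xi].
Qed.

Lemma L2_L1 f : L2 f -> L1 f.
Proof.
by move=> /L2M/(_ (L2_cst 1)); under [X in L1 X -> _]eq_fun do rewrite mulr1.
Qed.

Lemma L2_le g f : measurable_fun setT f -> (forall w, `|f w| <= `|g w|) ->
  L2 g -> L2 f.
Proof.
move=> mf fg [mg g2]; split=> //; apply: L1_le g2; first exact: measurable_funX.
by move=> w; rewrite normrX -[leRHS]real_normK ?num_real// ler_pXn2r ?nnegrE.
Qed.

Lemma L2_bool (A : set T) f : measurable A -> L2 f -> L2 (fun w => \1_A w * f w).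
Proof.
move=> mA [mf f2]; apply: (@L2_le f) => //.
  exact: measurable_funM.
by move=> w; rewrite indicE; case: (_ \in _); rewrite ?mul1r// mul0r normr0.
Qed.

Lemma L2_bool1 (A : set T) : measurable A -> L2 (\1_A).
Proof.
move=> mA; have := L2_bool mA (L2_cst 1).
by under [X in L2 X -> _]eq_fun do rewrite mulr1.
Qed.

Lemma L1_bool (A : set T) f : measurable A -> L1 f -> L1 (fun w => \1_A w * f w).
Proof.
move=> mA lf; apply: (@L1_le (fun w => `|f w|)).
- by apply: measurable_funM => //; exact: L1_measurable.
- by move=> w; rewrite indicE; case: (_ \in _); rewrite ?mul1r// mul0r normr0.
- exact: L1_norm.
Qed.

(** Pythagoras in L2: in the induction the cross term between the partial sum and the last summand
    is a sum of the assumed zeros. *)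
Lemma Ex_sqr_sum n (x : nat -> T -> R) : (forall i, (i < n)%N -> L2 (x i)) ->
  (forall i j, (i < j < n)%N -> Ex (fun w => x i w * x j w) = 0) ->
  Ex (fun w => (\sum_(i < n) x i w) ^+ 2) = \sum_(i < n) Ex (fun w => x i w ^+ 2).
Proof.
elim: n => [|n IH] xL xO.
  rewrite big_ord0; under eq_Ex do rewrite big_ord0 expr0n/=.
  exact: Ex_cst.
have xL' i : (i < n)%N -> L2 (x i) by move=> /ltnW; exact: xL.
have sL : L2 (fun w => \sum_(i < n) x i w) by exact: L2_sum.
have nL : L2 (x n) by exact: xL.
rewrite big_ord_recr/= -IH//; last first.
  by move=> i j /andP[ij jn]; apply: xO; rewrite ij ltnW.
have -> : Ex (fun w => (\sum_(i < n.+1) x i w) ^+ 2) =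
    Ex (fun w => ((\sum_(i < n) x i w) ^+ 2 + x n w ^+ 2)
                 + 2 * ((\sum_(i < n) x i w) * x n w)).
  by apply: eq_Ex => w; rewrite big_ord_recr/=; ring.
rewrite ExD; last 2 first.
- by apply: L1D; exact: L2_sqr.
- by apply: L1Z; exact: L2M.
rewrite ExD; [|exact: L2_sqr..].
rewrite ExZ; last exact: L2M.
rewrite (_ : Ex (fun w => _ * x n w) = 0) ?mulr0 ?addr0//.
rewrite (_ : Ex _ = Ex (fun w => \sum_(i < n) (x i w * x n w))); last first.
  by apply: eq_Ex => w; rewrite big_distrl.
rewrite (@Ex_sum n (fun i w => x i w * x n w)); last first.
  by move=> i ni; apply: L2M => //; exact: xL'.
by rewrite big1// => i _; apply: xO; rewrite ltn_ord/=.
Qed.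

(** Fatou turns a uniform second moment bound into a bound for the pointwise limit, which is how
    [overshoot] is reached. *)
Lemma L2_fatou (f_ : nat -> T -> R) f (c : R) : (forall n, L2 (f_ n)) ->
  (forall n, Ex (fun w => f_ n w ^+ 2) <= c) ->
  (forall w, f_ n w @[n --> \oo] --> f w) ->
  L2 f /\ Ex (fun w => f w ^+ 2) <= c.
Proof.
move=> fL fc ff.
have mf : measurable_fun setT f.
  by apply: (@measurable_fun_cvg _ _ R setT f_) => // n; exact: L2_measurable.
have fat : (\int[P]_w (f w ^+ 2)%:E <= c%:E)%E.
  have := @fatou _ _ _ P setT measurableT (fun n w => (f_ n w ^+ 2)%:E).
  have m2 n : measurable_fun setT (fun w => (f_ n w ^+ 2)%:E).
    by apply/measurable_EFinP; apply: measurable_funX; exact: L2_measurable.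
  have pos n w : setT w -> (0 <= (f_ n w ^+ 2)%:E)%E.
    by move=> _; rewrite lee_fin sqr_ge0.
  move=> /(_ m2) /(_ pos).
  have -> : (\int[P]_w limn_einf (fun n => (f_ n w ^+ 2)%:E) =
             \int[P]_w (f w ^+ 2)%:E)%E.
    apply: eq_integral => w _.
    have cv : (f_ n w ^+ 2)%:E @[n --> \oo] --> (f w ^+ 2)%:E.
      by apply: cvg_EFin; [exact: nearW|exact: (cvgM (ff w) (ff w))].
    by have [-> _] := cvg_limn_einf_sup cv.
  move=> /le_trans; apply.
  rewrite limn_einf_lim; apply: lime_le; first exact: is_cvg_einfs.
  near=> n; apply: (@le_trans _ _ (\int[P]_w (f_ n w ^+ 2)%:E)%E).
    by apply: ereal_inf_lbound => /=; exists n => //=.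
  by rewrite ExE ?lee_fin//; exact: L2_sqr.
have L : L1 (fun w => f w ^+ 2).
  apply/integrableP; split.
    by apply/measurable_EFinP; exact: measurable_funX.
  rewrite (_ : (\int[P]_w _)%E = (\int[P]_w (f w ^+ 2)%:E)%E).
    exact: (le_lt_trans fat (ltry _)).
  by apply: eq_integral => w _ /=; rewrite ger0_norm ?sqr_ge0.
by split=> //; rewrite -lee_fin -ExE.
Unshelve. all: by end_near. Qed.

Lemma markov_prob f (e : R) : 0 < e -> L1 f ->
  e * fine (P [set w | e <= `|f w|]) <= Ex (fun w => `|f w|).
Proof.
move=> e0 lf; have mf := L1_measurable lf.
have mA : measurable [set w | e <= `|f w|].
  rewrite -[X in measurable X]setTI.
  by apply: measurable_fun_le => //; exact: measurableT_comp.
rewrite -Ex_indic// -ExZ; last exact: L1_indic.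
apply: Ex_le; [by apply: L1Z; exact: L1_indic|exact: L1_norm|].
move=> w; rewrite indicE; case: (boolP (w \in _)); rewrite ?mulr1 ?mulr0//.
by rewrite inE.
Qed.

End expectation.

(** * Filtrations and stopping times *)

Section measurable_wrt_theory.
Context {d : measure_display} {T : measurableType d} {R : realType}.
Variable G : set (set T).
Hypothesis sG : sigma_algebra setT G.
Implicit Types f g : T -> R.

Lemma measurable_wrtP d' (V : measurableType d') (f : T -> V) :
  measurable_wrt G f <->
  measurable_fun setT (f : g_sigma_algebraType G -> V).
Proof.
split=> mf; first by move=> _ A mA; rewrite setTI; apply: sub_sigma_algebra; exact: mf.
move=> A mA; have := mf measurableT A mA.
by rewrite setTI /measurable/= (sigma_algebra_id sG).
Qed.

Lemma measurable_wrtD f g : measurable_wrt G f -> measurable_wrt G g ->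
  measurable_wrt G (fun w => f w + g w).
Proof.
move=> /measurable_wrtP mf /measurable_wrtP mg; apply/measurable_wrtP.
exact: measurable_funD.
Qed.

Lemma measurable_wrtB f g : measurable_wrt G f -> measurable_wrt G g ->
  measurable_wrt G (fun w => f w - g w).
Proof.
move=> /measurable_wrtP mf /measurable_wrtP mg; apply/measurable_wrtP.
exact: measurable_funB.
Qed.

Lemma measurable_wrtM f g : measurable_wrt G f -> measurable_wrt G g ->
  measurable_wrt G (fun w => f w * g w).
Proof.
move=> /measurable_wrtP mf /measurable_wrtP mg; apply/measurable_wrtP.
exact: measurable_funM.
Qed.

Lemma measurable_wrt_cst (c : R) : measurable_wrt G (fun=> c).
Proof. by apply/measurable_wrtP; exact: measurable_cst. Qed.

Lemma measurable_wrt_indic A : G A -> measurable_wrt G (\1_A : T -> R).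
Proof.
move=> GA; apply/measurable_wrtP.
by apply: (@measurable_indic _ (g_sigma_algebraType G)); exact: sub_sigma_algebra.
Qed.

Lemma measurable_wrt_sum n (x : nat -> T -> R) :
  (forall i, (i < n)%N -> measurable_wrt G (x i)) ->
  measurable_wrt G (fun w => \sum_(i < n) x i w).
Proof.
elim: n => [|n IH] xi.
  by under [X in measurable_wrt _ X]eq_fun do rewrite big_ord0; exact: measurable_wrt_cst.
under [X in measurable_wrt _ X]eq_fun do rewrite big_ord_recr/=.
by apply: measurable_wrtD; [apply: IH => i /ltnW; exact: xi|exact: xi].
Qed.

Lemma measurable_wrt_cvg (f_ : nat -> T -> R) f :
  (forall n, measurable_wrt G (f_ n)) ->
  (forall w, f_ n w @[n --> \oo] --> f w) -> measurable_wrt G f.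
Proof.
move=> mf ff; apply/measurable_wrtP.
apply: (@measurable_fun_cvg _ (g_sigma_algebraType G) R setT f_) => //.
by move=> n; exact/measurable_wrtP.
Qed.

Lemma sigma_algebraT : G setT.
Proof. by case: sG => G0 GC _; rewrite -(setD0 setT); exact: GC. Qed.

Lemma sigma_algebraC A : G A -> G (~` A).
Proof. by case: sG => G0 GC _ GA; rewrite -setTD; exact: GC. Qed.

Lemma sigma_algebra_bigcup (A : nat -> set T) : (forall n, G (A n)) -> G (\bigcup_n A n).
Proof. by case: sG => _ _; exact. Qed.

Lemma sigma_algebraU A C : G A -> G C -> G (A `|` C).
Proof.
move=> GA GC; rewrite -bigcup2E; apply: sigma_algebra_bigcup => -[|[|n]]//=.
by case: sG.
Qed.

Lemma sigma_algebraI A C : G A -> G C -> G (A `&` C).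
Proof.
move=> GA GC; rewrite -(setCK (A `&` C)) setCI; apply: sigma_algebraC.
by apply: sigma_algebraU; exact: sigma_algebraC.
Qed.

Lemma measurable_wrt_measurable_fun d' (V : measurableType d') (f : T -> V) :
  G `<=` measurable ->
  measurable_wrt G f -> measurable_fun setT f.
Proof. by move=> Gm mf _ A mA; rewrite setTI; apply: Gm; exact: mf. Qed.

(** The two preimages differ inside the exceptional set, and each of its subsets is negligible,
    hence in [G]. *)
Lemma measurable_wrt_ae_eq (P : probability T R) d' (V : measurableType d') (f g : T -> V) :
  P.-negligible `<=` G -> {ae P, forall w, f w = g w} ->
  measurable_wrt G f -> measurable_wrt G g.
Proof.
move=> Gn fg mf A mA; set N := ~` [set w | f w = g w].
have GN C : C `<=` N -> G C by move=> CN; apply: Gn; exact: negligibleS CN fg.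
rewrite (_ : g @^-1` A = (f @^-1` A `&` ~` N) `|` (g @^-1` A `&` N)); last first.
  apply/seteqP; split=> [w Aw|w [[Aw /contrapT fgw]|[]//]] /=; last by rewrite /= -fgw.
  by have [fgw|fgw] := pselect (f w = g w); [left; split=> /=; rewrite ?fgw// setCK|right].
apply: sigma_algebraU; last exact: GN.
by apply: sigma_algebraI; [exact: mf|apply: sigma_algebraC; exact: GN].
Qed.

End measurable_wrt_theory.

Section stopping.
Context {d : measure_display} {T : measurableType d} {R : realType}.
Variables (P : probability T R) (F : R -> set (set T)).

Record complete_filtration : Prop := CompleteFiltration {
  cf_sigma : forall t, sigma_algebra setT (F t) ;
  cf_mono : forall s t, s <= t -> F s `<=` F t ;
  cf_measurable : forall t, F t `<=` measurable ;
  cf_negligible : forall t, P.-negligible `<=` F t }.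

(* A square integrable martingale with angle bracket [t], started at 0. *)
Record normal_martingale (M : R -> T -> R) : Prop := NormalMartingale {
  nm_adapted : adapted F M ;
  nm_L2 : forall t, 0 <= t -> L2 P (M t) ;
  nm_0 : forall w, M 0 w = 0 ;
  nm_mean : forall s t (G : T -> R), 0 <= s <= t -> measurable_wrt (F s) G ->
    L2 P G -> Ex P (fun w => G w * (M t w - M s w)) = 0 ;
  nm_var : forall s t A, 0 <= s <= t -> F s A ->
    Ex P (fun w => \1_A w * (M t w - M s w) ^+ 2) = (t - s) * fine (P A) ;
  nm_cadlag : forall w, cadlag (M ^~ w) }.

Hypothesis cF : complete_filtration.
Variable S : T -> \bar R.
Hypothesis S0 : forall w, (0 <= S w)%E.
Hypothesis stopS : forall t, 0 <= t -> F t [set w | (S w <= t%:E)%E].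

Definition before (a : R) : set T := [set w | (a%:E < S w)%E].
Definition hit (a b : R) : set T := before a `&` [set w | (S w <= b%:E)%E].
Definition stop_cdf (t : R) : R := fine (P [set w | (S w <= t%:E)%E]).

(* The increment of [M] over the part of [[a, b]] that follows [S], when [S]
   falls in that interval. *)
Definition overshoot (M : R -> T -> R) (a b : R) (w : T) : R :=
  \1_(before a) w * (M b w - M (min_time S b w) w).

Lemma before_F a b : 0 <= a -> a <= b -> F b (before a).
Proof.
move=> a0 ab; apply: (cf_mono cF ab).
rewrite (_ : before a = ~` [set w | (S w <= a%:E)%E]).
  by apply: sigma_algebraC; [exact: cf_sigma|exact: stopS].
by apply/seteqP; split=> w /=; rewrite /before/= ltNge => /negP.
Qed.

Lemma hit_F a b : 0 <= a -> a <= b -> F b (hit a b).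
Proof.
move=> a0 ab; apply: sigma_algebraI; first exact: cf_sigma.
  exact: before_F.
by apply: stopS; exact: le_trans ab.
Qed.

Lemma stop_event_measurable t : 0 <= t -> measurable [set w | (S w <= t%:E)%E].
Proof. by move=> t0; apply: (cf_measurable cF (t := t)); exact: stopS. Qed.

Lemma stop_cdf_ge0 t : 0 <= stop_cdf t.
Proof. by rewrite /stop_cdf fine_ge0. Qed.

Lemma stop_cdf_le1 t : 0 <= t -> stop_cdf t <= 1.
Proof.
move=> t0; rewrite -lee_fin fineK ?probability_le1//; first exact: stop_event_measurable.
by rewrite fin_num_measure//; exact: stop_event_measurable.
Qed.

Lemma prob_hit a b : 0 <= a -> a <= b -> fine (P (hit a b)) = stop_cdf b - stop_cdf a.
Proof.
move=> a0 ab; have b0 := le_trans a0 ab.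
have fa : P [set w | (S w <= a%:E)%E] \is a fin_num by rewrite fin_num_measure//; exact: stop_event_measurable.
have fb : P [set w | (S w <= b%:E)%E] \is a fin_num by rewrite fin_num_measure//; exact: stop_event_measurable.
rewrite /stop_cdf -fineB//; congr fine.
rewrite (_ : hit a b = [set w | (S w <= b%:E)%E] `\` [set w | (S w <= a%:E)%E]).
  rewrite measureD//; [|exact: stop_event_measurable|exact: stop_event_measurable|by rewrite ltey_eq fb].
  congr (_ - P _)%E; apply/seteqP; split=> [w []//|w /= Sa]; split=> //.
  by rewrite (le_trans Sa)// lee_fin.
apply/seteqP; split=> w /=; rewrite /hit /before/=.
  by move=> [aS Sb]; split=> //; apply/negP; rewrite -ltNge.
by move=> [Sb /negP]; rewrite -ltNge.
Qed.

Lemma stop_cdf_mono a b : 0 <= a -> a <= b -> stop_cdf a <= stop_cdf b.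
Proof. by move=> a0 ab; rewrite -subr_ge0 -prob_hit// fine_ge0. Qed.

Lemma min_timeE t w : min_time S t w = if (S w <= t%:E)%E then fine (S w) else t.
Proof. by rewrite /min_time minEle; case: ifP. Qed.

Lemma stop_fin t w : (S w <= t%:E)%E -> S w = (fine (S w))%:E.
Proof. by move=> St; rewrite fineK// fin_numElt (lt_le_trans _ (S0 w))//= (le_lt_trans St)// ltry. Qed.

End stopping.

(** * Telescoping sums, right continuity and uniform subdivisions *)

Section core.
Context {R : realType}.

(** The weight switches the increments on from index [j0]; in [overshoot_cvg] this is the first
    subdivision point not before [S]. *)
Lemma telescope_from (f : nat -> R) (j0 k : nat) : (j0 <= k)%N ->
  \sum_(j < k) (j0 <= j)%N%:R * (f j.+1 - f j) = f k - f j0.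
Proof.
elim: k => [|k IH]; first by rewrite leqn0 => /eqP ->; rewrite big_ord0 subrr.
rewrite leq_eqVlt => /orP[/eqP ->|]; last first.
  by rewrite ltnS => jk; rewrite big_ord_recr/= IH// jk mul1r addrC addrA subrK.
by rewrite subrr big1// => i _; rewrite leqNgt ltn_ord mul0r.
Qed.

Lemma right_continuousP (f : R -> R) t : f x @[x --> t^'+] --> f t ->
  forall e, 0 < e -> exists2 dl, 0 < dl & forall x, t <= x < t + dl -> `|f x - f t| < e.
Proof.
move=> /cvgrPdist_lt ft e e0; have := ft e e0; rewrite /at_right near_withinE.
move=> [dl /= dl0 fdl]; exists dl => // x /andP[tx xt].
have [->|xnt] := eqVneq x t; first by rewrite subrr normr0.
rewrite distrC; apply: fdl; last by rewrite lt_neqAle eq_sym xnt.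
by rewrite /= ltr_distlC; apply/andP; split; lra.
Qed.

(** Cutting into [k.+1] pieces keeps the step meaningful for every [k]; the end points have indices
    [0] and [k.+1]. *)
Definition subdiv (a b : R) (k j : nat) : R := a + (b - a) * j%:R / k.+1%:R.

Lemma subdiv0 a b k : subdiv a b k 0 = a.
Proof. by rewrite /subdiv mulr0 mul0r addr0. Qed.

Lemma subdivn a b k : subdiv a b k k.+1 = b.
Proof. by rewrite /subdiv mulfK ?pnatr_eq0// addrC subrK. Qed.

Lemma subdivS a b k j : subdiv a b k j.+1 - subdiv a b k j = (b - a) / k.+1%:R.
Proof. by rewrite /subdiv; set c := _^-1; rewrite -natr1; ring. Qed.

Lemma subdiv_le a b k i j : a <= b -> (i <= j)%N -> subdiv a b k i <= subdiv a b k j.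
Proof.
move=> ab ij; rewrite /subdiv lerD2l ler_pM2r ?invr_gt0 ?ltr0Sn//.
by rewrite ler_wpM2l ?subr_ge0// ler_nat.
Qed.

Lemma subdiv_ge a b k i : a <= b -> a <= subdiv a b k i.
Proof. by move=> ab; rewrite -[leLHS](subdiv0 a b k); exact: subdiv_le. Qed.

Lemma subdiv_leb a b k i : a <= b -> (i <= k.+1)%N -> subdiv a b k i <= b.
Proof. by move=> ab ik; rewrite -[leRHS](subdivn a b k); exact: subdiv_le. Qed.

End core.

(** * Switching martingales at a stopping time *)

Section overshoot.
Context {d : measure_display} {T : measurableType d} {R : realType}.
Variables (P : probability T R) (F : R -> set (set T)).
Hypothesis cF : complete_filtration P F.
Variable S : T -> \bar R.
Hypothesis S0 : forall w, (0 <= S w)%E.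
Hypothesis stopS : forall t, 0 <= t -> F t [set w | (S w <= t%:E)%E].
Variable M : R -> T -> R.
Hypothesis nM : normal_martingale P F M.

(** Asking that [S] has occurred by the left end point makes the weight known at the start of the
    increment: [S] is in effect rounded up to a subdivision point. *)
Definition overshoot_term (a b : R) (k j : nat) (w : T) : R :=
  \1_(hit S a (subdiv a b k j)) w * (M (subdiv a b k j.+1) w - M (subdiv a b k j) w).

Definition overshoot_approx (a b : R) (k : nat) (w : T) : R :=
  \sum_(j < k.+1) overshoot_term a b k j w.

(** If [S] falls in []a, b]], the sum telescopes to [M b - M q] with [q] the rounding up of [S], and
    [q] tends to [S] from the right, so right continuity suffices. Otherwise both sides vanish. *)
Lemma overshoot_cvg a b w : 0 <= a -> a <= b ->
  overshoot_approx a b k w @[k --> \oo] --> overshoot S M a b w.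
Proof.
move=> a0 ab; rewrite /overshoot indicE.
have [wa|/negP wa] := boolP (w \in before S a); last first.
  rewrite mul0r (_ : (fun k => _) = fun=> 0); first exact: cvg_cst.
  apply/funext => k; rewrite /overshoot_approx big1// => j _; rewrite /overshoot_term.
  by rewrite indicE; case: (boolP (w \in _)) => [|_]; rewrite ?mul0r// inE => -[wa' _]; exfalso; apply: wa; rewrite inE.
have {}wa : (a%:E < S w)%E by move: wa; rewrite inE.
rewrite mul1r min_timeE; case: (leP (S w) b%:E) => Sb; last first.
  rewrite subrr (_ : (fun k => _) = fun=> 0); first exact: cvg_cst.
  apply/funext => k; rewrite /overshoot_approx big1// => j _; rewrite /overshoot_term.
  rewrite indicE; case: (boolP (w \in _)) => [|_]; rewrite ?mul0r// inE => -[_ /=].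
  by move=> /(lt_le_trans Sb); rewrite lte_fin ltNge subdiv_leb// ltnW.
have Sw := stop_fin S0 Sb; set s := fine (S w) in Sw *.
have {}Sb : s <= b by rewrite -lee_fin -Sw.
have as_ : a < s by rewrite -lte_fin -Sw.
have s0 : 0 <= s by exact: le_trans (ltW as_).
have ab' : a < b by exact: lt_le_trans Sb.
have hitE k j : \1_(hit S a (subdiv a b k j)) w = (s <= subdiv a b k j)%R%:R :> R.
  rewrite indicE; congr ((nat_of_bool _)%:R); apply/idP/idP; rewrite inE /hit /before/= Sw.
    by rewrite lee_fin => -[].
  by rewrite lte_fin lee_fin as_.
(* [M b - M q] at the first subdivision point [q] after [s] *)
have approxE k : exists2 q, s <= q < s + (b - a) / k.+1%:R &
    overshoot_approx a b k w = M b w - M q w.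
  have ex : exists j, s <= subdiv a b k j by exists k.+1; rewrite subdivn.
  case: (ex_minnP ex) => j0 sj0 jmin.
  have j0k : (j0 <= k.+1)%N by apply: jmin; rewrite subdivn.
  exists (subdiv a b k j0).
    rewrite sj0/=; case: j0 sj0 jmin j0k => [|j1] sj0 jmin j0k.
      by move: sj0; rewrite subdiv0 leNgt as_.
    have : ~~ (s <= subdiv a b k j1) by apply/negP => /jmin; rewrite ltnn.
    by rewrite -ltNge -(subdivS a b k j1); lra.
  transitivity (M (subdiv a b k k.+1) w - M (subdiv a b k j0) w); last by rewrite subdivn.
  have <- := @telescope_from _ (fun j => M (subdiv a b k j) w) _ _ j0k.
  apply: eq_bigr => j _; rewrite /overshoot_term hitE; congr ((nat_of_bool _)%:R * _).
  by apply/idP/idP => [/jmin//|jj0]; rewrite (le_trans sj0)// subdiv_le.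
apply/cvgrPdist_lt => e e0.
have [dl dl0 Mdl] := right_continuousP (proj1 (nm_cadlag nM w) s s0) e0.
near=> k; have [q /andP[sq qs] ->] := approxE k.
rewrite [X in `|X|](_ : _ = M q w - M s w); last by ring.
apply: Mdl; rewrite sq/= (lt_trans qs)// ltrD2l.
rewrite ltr_pdivrMr// mulrC -ltr_pdivrMr//.
by apply: lt_trans (_ : k%:R < _); [near: k; exact: nbhs_infty_gtr|rewrite ltr_nat].
Unshelve. all: by end_near. Qed.

Let approx_term_L2 a b k j : 0 <= a -> a <= b -> (j < k.+1)%N ->
  L2 P (overshoot_term a b k j).
Proof.
move=> a0 ab jk; have aj i : a <= subdiv a b k i by exact: subdiv_ge.
rewrite /overshoot_term; apply: L2_bool; last first.
  by apply: L2B; apply: (nm_L2 nM); exact: le_trans (aj _).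
apply: (cf_measurable cF (t := subdiv a b k j)); exact: (hit_F cF).
Qed.

Let approx_term_F a b k j t : 0 <= a -> a <= b -> subdiv a b k j.+1 <= t ->
  measurable_wrt (F t) (overshoot_term a b k j).
Proof.
move=> a0 ab jt; have aj i : a <= subdiv a b k i by exact: subdiv_ge.
have a0j i : 0 <= subdiv a b k i by exact: le_trans (aj i).
have sF := cf_sigma cF t.
have jj : subdiv a b k j <= t by apply: le_trans jt; exact: subdiv_le.
apply: measurable_wrtM => //.
  apply: measurable_wrt_indic => //; apply: (cf_mono cF jj).
  exact: (hit_F cF).
apply: measurable_wrtB => //.
  by move=> A mA; apply: (cf_mono cF jt); exact: (nm_adapted nM).
by move=> A mA; apply: (cf_mono cF jj); exact: (nm_adapted nM).
Qed.

Lemma overshoot_approx_F a b k : 0 <= a -> a <= b ->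
  measurable_wrt (F b) (overshoot_approx a b k).
Proof.
move=> a0 ab; apply: (@measurable_wrt_sum _ _ _ _ (cf_sigma cF b) k.+1
  (overshoot_term a b k)).
by move=> j jk; apply: approx_term_F => //; exact: subdiv_leb.
Qed.

Lemma overshoot_approx_L2 a b k : 0 <= a -> a <= b ->
  L2 P (overshoot_approx a b k).
Proof.
move=> a0 ab; apply: (@L2_sum _ _ _ _ k.+1
  (overshoot_term a b k)).
by move=> j jk; exact: approx_term_L2.
Qed.

(** The terms are orthogonal martingale differences, each of variance the step times a probability
    bounded by that of [a < S <= b]. Keeping this probability, rather than 1, is what makes the
    bounds summable over a partition. *)
Lemma overshoot_approx_var a b k : 0 <= a -> a <= b ->
  Ex P (fun w => overshoot_approx a b k w ^+ 2) <=
  (b - a) * (stop_cdf P S b - stop_cdf P S a).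
Proof.
move=> a0 ab; have aj i : a <= subdiv a b k i by exact: subdiv_ge.
have a0j i : 0 <= subdiv a b k i by exact: le_trans (aj i).
rewrite /overshoot_approx (@Ex_sqr_sum _ _ _ _ k.+1 (overshoot_term a b k)); last 2 first.
- by move=> j jk; exact: approx_term_L2.
- move=> i j /andP[ij jk].
  have hF : F (subdiv a b k j) (hit S a (subdiv a b k j)) by exact: (hit_F cF).
  (* The weight of the later term is moved into [G], so that only a bare increment after
     [subdiv a b k j] remains. *)
  pose G w := overshoot_term a b k i w * \1_(hit S a (subdiv a b k j)) w.
  rewrite -(@nm_mean _ _ _ _ _ _ nM (subdiv a b k j) (subdiv a b k j.+1) G).
  + by apply: eq_Ex => w; rewrite /G /overshoot_term mulrA.
  + by rewrite a0j/= subdiv_le.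
  + apply: measurable_wrtM; [exact: (cf_sigma cF)| |].
      by apply: approx_term_F => //; exact: subdiv_le.
    by apply: measurable_wrt_indic => //; exact: (cf_sigma cF).
  + rewrite /G; under [X in L2 _ X]eq_fun do rewrite mulrC.
    apply: L2_bool; first exact: (cf_measurable cF hF).
    by apply: approx_term_L2 => //; exact: ltn_trans ij jk.
rewrite [leRHS](_ : _ = \sum_(j < k.+1)
    ((b - a) / k.+1%:R * (stop_cdf P S b - stop_cdf P S a))); last first.
  rewrite sumr_const card_ord -[RHS]mulr_natl mulrA mulrCA mulfV ?pnatr_eq0//.
  by rewrite mulr1.
apply: ler_sum => j _.
have hF : F (subdiv a b k j) (hit S a (subdiv a b k j)) by exact: (hit_F cF).
have -> : Ex P (fun w => overshoot_term a b k j w ^+ 2) =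
  (subdiv a b k j.+1 - subdiv a b k j) * fine (P (hit S a (subdiv a b k j))).
  rewrite -(nm_var nM)//; last by rewrite a0j subdiv_le.
  apply: eq_Ex => w; rewrite /overshoot_term exprMn; congr (_ * _).
  by rewrite indicE; case: (_ \in _); rewrite ?expr1n ?expr0n.
rewrite subdivS (prob_hit cF)// ler_wpM2l//.
  by rewrite divr_ge0// subr_ge0.
by rewrite lerD2r (stop_cdf_mono cF)// subdiv_leb// ltnW.
Qed.

Lemma overshoot_L2_var a b : 0 <= a -> a <= b ->
  L2 P (overshoot S M a b) /\
  Ex P (fun w => overshoot S M a b w ^+ 2) <=
    (b - a) * (stop_cdf P S b - stop_cdf P S a).
Proof.
move=> a0 ab; apply: (@L2_fatou _ _ _ _ (overshoot_approx a b)).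
- by move=> k; exact: overshoot_approx_L2.
- by move=> k; exact: overshoot_approx_var.
- by move=> w; exact: overshoot_cvg.
Qed.

Lemma overshoot_F a b : 0 <= a -> a <= b -> measurable_wrt (F b) (overshoot S M a b).
Proof.
move=> a0 ab; apply: (@measurable_wrt_cvg _ _ _ _ (cf_sigma cF b) (overshoot_approx a b)).
- by move=> k; exact: overshoot_approx_F.
- by move=> w; exact: overshoot_cvg.
Qed.

End overshoot.

(** * Inequalities for passing to the limit *)

Section real_facts.
Context {R : realType}.

Lemma telescope_ord (f : nat -> R) n : \sum_(i < n) (f i.+1 - f i) = f n - f 0%N.
Proof.
rewrite -(@telescope_from R f 0 n)//.
by apply: eq_bigr => i _; rewrite leq0n mul1r.
Qed.

Lemma le_inv_nat (x y K : R) : 0 <= K -> (forall k : nat, x <= y + K / k.+1%:R) -> x <= y.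
Proof.
move=> K0 xK; apply/ler_addgt0Pr => e e0.
pose k := Num.truncn (K / e).
apply: (le_trans (xK k)); rewrite lerD2l ler_pdivrMr// mulrC -ler_pdivrMr//.
by rewrite ltW// truncnS_gt.
Qed.

(** Young's inequality, with the small weight [c] on the main term and the large one on the
    error. *)
Lemma sqr_sub_le (c x y : R) : 0 < c -> (x + y) ^+ 2 <= (1 + c) * x ^+ 2 + (1 + c^-1) * y ^+ 2.
Proof.
move=> c0; rewrite -subr_ge0.
have -> : (1 + c) * x ^+ 2 + (1 + c^-1) * y ^+ 2 - (x + y) ^+ 2 = c * (x - c^-1 * y) ^+ 2.
  by field; rewrite gt_eqF.
by rewrite mulr_ge0 ?sqr_ge0// ltW.
Qed.

(** The limits are taken in order: [k] to infinity for fixed [c], then [c = 1 / k.+1] to zero. This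
    removes an L2 error of order [1 / k] from a second moment. *)
Lemma le_relative (v y K : R) : 0 <= K -> 0 <= y ->
  (forall c k, 0 < c -> v <= (1 + c) * y + (1 + c^-1) * (K / k.+1%:R)) -> v <= y.
Proof.
move=> K0 y0 vy.
have vc c : 0 < c -> v <= (1 + c) * y.
  move=> c0; apply: (@le_inv_nat _ _ ((1 + c^-1) * K)).
    by rewrite mulr_ge0// addr_ge0// invr_ge0 ltW.
  by move=> k; rewrite -mulrA; exact: vy.
apply: (@le_inv_nat _ _ y) => // k.
by have := vc (k.+1%:R)^-1; rewrite invr_gt0 ltr0Sn mulrDl mul1r mulrC; exact.
Qed.

End real_facts.

(** * Increments of the switched process along a partition *)

Section solution.
Context {d : measure_display} {T : measurableType d} {R : realType}.
Variables (P : probability T R) (F : R -> set (set T)).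
Hypothesis cF : complete_filtration P F.
Variable S : T -> \bar R.
Hypothesis S0 : forall w, (0 <= S w)%E.
Hypothesis stopS : forall t, 0 <= t -> F t [set w | (S w <= t%:E)%E].
Variables W Z : R -> T -> R.
Hypotheses (nW : normal_martingale P F W) (nZ : normal_martingale P F Z).

Definition switched (t : R) (w : T) : R :=
  W (min_time S t w) w + Z t w - Z (min_time S t w) w.

Definition post (t : R) (w : T) : R := Z t w - Z (min_time S t w) w.

(* Increments over [[a, b]] of the two martingales, frozen at time [a]. *)
Definition before_inc (a b : R) (w : T) : R := \1_(before S a) w * (W b w - W a w).
Definition after_inc (a b : R) (w : T) : R := \1_(~` before S a) w * (Z b w - Z a w).
Definition predictable_inc (a b : R) (w : T) : R := before_inc a b w + after_inc a b w.
Definition overshoot_diff (a b : R) (w : T) : R :=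
  overshoot S Z a b w - overshoot S W a b w.

Let indic_setC (A : set T) w : \1_(~` A) w = 1 - \1_A w :> R.
Proof. by rewrite !indicE in_setC; case: (_ \in _); rewrite /= ?subrr ?subr0. Qed.

Lemma post_increment a b w : 0 <= a -> a <= b ->
  post b w - post a w = after_inc a b w + overshoot S Z a b w.
Proof.
move=> a0 ab; rewrite /post /after_inc /overshoot indic_setC indicE !min_timeE.
have [|] := boolP (w \in before S a); rewrite ?inE ?notin_setE /before/=.
  by move=> aS; rewrite [(S w <= a%:E)%E]leNgt aS/=; ring.
move=> /negP; rewrite -leNgt => Sa; rewrite Sa (le_trans Sa) ?lee_fin//; ring.
Qed.

Lemma switched_increment a b w : 0 <= a -> a <= b ->
  switched b w - switched a w = predictable_inc a b w + overshoot_diff a b w.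
Proof.
move=> a0 ab; have := post_increment w a0 ab.
rewrite /switched /post /overshoot_diff /predictable_inc.
set x := after_inc a b w; set y := overshoot S Z a b w => pI.
suff : W (min_time S b w) w - W (min_time S a w) w =
  before_inc a b w - overshoot S W a b w by lra.
rewrite /before_inc /overshoot indicE !min_timeE.
have [|] := boolP (w \in before S a); rewrite ?inE ?notin_setE /before/=.
  by move=> aS; rewrite [(S w <= a%:E)%E]leNgt aS/=; ring.
move=> /negP; rewrite -leNgt => Sa; rewrite Sa (le_trans Sa) ?lee_fin//; ring.
Qed.

Lemma before_measurable a : 0 <= a -> measurable (before S a).
Proof. by move=> a0; apply: (cf_measurable cF (t := a)); exact: (before_F cF). Qed.

Lemma nm_diff_L2 M a b : normal_martingale P F M -> 0 <= a -> a <= b ->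
  L2 P (fun w => M b w - M a w).
Proof. by move=> nM a0 ab; apply: L2B; apply: (nm_L2 nM) => //; exact: le_trans ab. Qed.

Lemma before_inc_L2 a b : 0 <= a -> a <= b -> L2 P (before_inc a b).
Proof.
move=> a0 ab; apply: L2_bool; first exact: before_measurable.
exact: nm_diff_L2.
Qed.

Lemma after_inc_L2 a b : 0 <= a -> a <= b -> L2 P (after_inc a b).
Proof.
move=> a0 ab; apply: L2_bool; first by apply: measurableC; exact: before_measurable.
exact: nm_diff_L2.
Qed.

Lemma predictable_inc_L2 a b : 0 <= a -> a <= b -> L2 P (predictable_inc a b).
Proof. by move=> a0 ab; apply: L2D; [exact: before_inc_L2|exact: after_inc_L2]. Qed.

Lemma weighted_diff_F M (A : set T) a b : normal_martingale P F M ->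
  0 <= a -> a <= b -> F a A ->
  measurable_wrt (F b) (fun w => \1_A w * (M b w - M a w)).
Proof.
move=> nM a0 ab FA; have sF := cf_sigma cF b.
apply: measurable_wrtM => //.
  by apply: measurable_wrt_indic => //; exact: (cf_mono cF ab).
apply: measurable_wrtB => //; first by apply: (nm_adapted nM); exact: le_trans ab.
by move=> C mC; apply: (cf_mono cF ab); exact: (nm_adapted nM).
Qed.

Lemma predictable_inc_F a b : 0 <= a -> a <= b -> measurable_wrt (F b) (predictable_inc a b).
Proof.
move=> a0 ab; have Fb : F a (before S a) by exact: (before_F cF).
apply: measurable_wrtD; first exact: (cf_sigma cF).
  exact: weighted_diff_F.
by apply: weighted_diff_F => //; apply: sigma_algebraC => //; exact: (cf_sigma cF).
Qed.

Lemma weighted_diff_mean M (A : set T) a b (G : T -> R) : normal_martingale P F M ->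
  0 <= a -> a <= b -> F a A -> measurable_wrt (F a) G -> L2 P G ->
  Ex P (fun w => G w * (\1_A w * (M b w - M a w))) = 0.
Proof.
move=> nM a0 ab FA mG G2.
rewrite -(@nm_mean _ _ _ _ _ _ nM a b (fun w => \1_A w * G w)) ?a0//.
- by apply: eq_Ex => w; ring.
- apply: measurable_wrtM => //; first exact: (cf_sigma cF).
  by apply: measurable_wrt_indic => //; exact: (cf_sigma cF).
- by apply: L2_bool => //; exact: (cf_measurable cF FA).
Qed.

Lemma predictable_inc_mean a b (G : T -> R) : 0 <= a -> a <= b ->
  measurable_wrt (F a) G -> L2 P G -> Ex P (fun w => G w * predictable_inc a b w) = 0.
Proof.
move=> a0 ab mG G2; have Fb : F a (before S a) by exact: (before_F cF).
rewrite (_ : Ex P _ = Ex P (fun w => G w * before_inc a b w + G w * after_inc a b w)).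
  rewrite ExD; last 2 first.
  - by apply: L2M => //; exact: before_inc_L2.
  - by apply: L2M => //; exact: after_inc_L2.
  rewrite weighted_diff_mean// weighted_diff_mean ?addr0//.
  by apply: sigma_algebraC => //; exact: (cf_sigma cF).
by apply: eq_Ex => w; rewrite mulrDr.
Qed.

Lemma predictable_inc_sqr a b w :
  predictable_inc a b w ^+ 2 = \1_(before S a) w * (W b w - W a w) ^+ 2
    + \1_(~` before S a) w * (Z b w - Z a w) ^+ 2.
Proof.
rewrite /predictable_inc /before_inc /after_inc indic_setC indicE.
by case: (w \in _) => /=; ring.
Qed.

(** The two indicators exclude each other, and [W] and [Z] have the same conditional variance, so
    the choice between them leaves no trace. *)
Lemma predictable_inc_var a b A : 0 <= a -> a <= b -> F a A ->
  Ex P (fun w => \1_A w * predictable_inc a b w ^+ 2) = (b - a) * fine (P A).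
Proof.
move=> a0 ab FA; have Fb : F a (before S a) by exact: (before_F cF).
have sF := cf_sigma cF a.
have FAb : F a (A `&` before S a) by exact: sigma_algebraI.
have FAc : F a (A `&` ~` before S a) by apply: sigma_algebraI => //; exact: sigma_algebraC.
have mA := cf_measurable cF FA; have mAb := cf_measurable cF FAb.
have mAc := cf_measurable cF FAc.
rewrite (_ : Ex P _ = Ex P (fun w => \1_(A `&` before S a) w * (W b w - W a w) ^+ 2
    + \1_(A `&` ~` before S a) w * (Z b w - Z a w) ^+ 2)); last first.
  apply: eq_Ex => w; rewrite predictable_inc_sqr !indicI/= mulrDr.
  by congr (_ + _); rewrite mulrA.
rewrite ExD; last 2 first.
- by apply: L1_bool => //; apply: L2_sqr; exact: nm_diff_L2.
- by apply: L1_bool => //; apply: L2_sqr; exact: nm_diff_L2.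
rewrite (nm_var nW) ?a0// (nm_var nZ) ?a0// -mulrDr -fineD ?fin_num_measure//.
congr (_ * fine _); rewrite -measureU//; last first.
  by rewrite setIACA setICr setI0.
by rewrite -setIUr setUCr setIT.
Qed.

Lemma overshoot_diff_L2 a b : 0 <= a -> a <= b -> L2 P (overshoot_diff a b).
Proof.
move=> a0 ab; have [LZ _] := overshoot_L2_var cF S0 stopS nZ a0 ab.
by have [LW _] := overshoot_L2_var cF S0 stopS nW a0 ab; exact: L2B.
Qed.

Lemma overshoot_diff_var a b : 0 <= a -> a <= b ->
  Ex P (fun w => overshoot_diff a b w ^+ 2) <=
  4 * (b - a) * (stop_cdf P S b - stop_cdf P S a).
Proof.
move=> a0 ab; have [LZ vZ] := overshoot_L2_var cF S0 stopS nZ a0 ab.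
have [LW vW] := overshoot_L2_var cF S0 stopS nW a0 ab.
(* The factor 4 comes from [(x - y) ^+ 2 <= 2 * x ^+ 2 + 2 * y ^+ 2] and one variance bound for each
   martingale. *)
apply: (@le_trans _ _ (Ex P (fun w => 2 * overshoot S Z a b w ^+ 2
                                      + 2 * overshoot S W a b w ^+ 2))).
  apply: Ex_le; first by apply: L2_sqr; exact: overshoot_diff_L2.
    by apply: L1D; apply: L1Z; exact: L2_sqr.
  move=> w; rewrite -subr_ge0 /overshoot_diff; set x := overshoot _ _ _ _ _.
  set y := overshoot _ _ _ _ _; rewrite (_ : _ - _ = (x + y) ^+ 2) ?sqr_ge0//; ring.
rewrite ExD; [|by apply: L1Z; exact: L2_sqr..].
by rewrite !ExZ; [lra|exact: L2_sqr..].
Qed.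

Section partition.
Variables (n : nat) (p : nat -> R) (dl : R).
Hypothesis p0 : 0 <= p 0%N.
Hypothesis pS : forall i, (i < n)%N -> p i <= p i.+1 <= p i + dl.

Lemma part_le i j : (i <= j)%N -> (j <= n)%N -> p i <= p j.
Proof.
elim: j => [|j IH]; first by rewrite leqn0 => /eqP ->.
rewrite leq_eqVlt => /orP[/eqP ->//|]; rewrite ltnS => ij jn.
by rewrite (le_trans (IH ij (ltnW jn)))//; have /andP[] := pS jn.
Qed.

Lemma part_ge0 i : (i <= n)%N -> 0 <= p i.
Proof. by move=> ni; apply: (le_trans p0); exact: part_le. Qed.

Lemma part_step i : (i < n)%N -> p i <= p i.+1.
Proof. by move=> /pS /andP[]. Qed.

(** Bounding each step by [dl] leaves the increments of the distribution function of [S], which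
    telescope to at most 1. *)
Lemma sum_hit_le : 0 <= dl ->
  \sum_(i < n) (p i.+1 - p i) * (stop_cdf P S (p i.+1) - stop_cdf P S (p i)) <= dl.
Proof.
move=> dl0.
apply: (@le_trans _ _ (dl * (stop_cdf P S (p n) - stop_cdf P S (p 0%N)))).
  rewrite -(@telescope_ord R (fun i => stop_cdf P S (p i))) mulr_sumr.
  apply: ler_sum => i _; have ni := ltn_ord i; apply: ler_wpM2r.
    by rewrite subr_ge0 (stop_cdf_mono cF)//; [exact: part_ge0 (ltnW ni)|exact: part_step].
  by have /andP[_] := pS ni; lra.
rewrite -[leRHS]mulr1 ler_wpM2l// lerBlDr.
rewrite (le_trans (stop_cdf_le1 cF stopS _)) ?part_ge0//.
by rewrite lerDl; exact: stop_cdf_ge0.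
Qed.

Lemma sum_overshoot_diff_var : 0 <= dl ->
  \sum_(i < n) Ex P (fun w => overshoot_diff (p i) (p i.+1) w ^+ 2) <= 4 * dl.
Proof.
move=> dl0.
apply: (@le_trans _ _ (\sum_(i < n) (4 * ((p i.+1 - p i) *
    (stop_cdf P S (p i.+1) - stop_cdf P S (p i)))))).
  apply: ler_sum => i _; rewrite mulrA; have ni := ltn_ord i.
  by apply: overshoot_diff_var; [exact: part_ge0 (ltnW ni)|exact: part_step].
by rewrite -mulr_sumr ler_wpM2l// sum_hit_le.
Qed.

(** A nonzero overshoot on the earlier interval forces [S <= p i.+1 <= p j], which excludes
    [p j < S]. *)
Lemma overshoot_disjoint M M' i j w : (i < j < n)%N ->
  overshoot S M (p i) (p i.+1) w * overshoot S M' (p j) (p j.+1) w = 0.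
Proof.
move=> /andP[ij jn]; rewrite /overshoot !indicE min_timeE.
have [|_] := boolP (w \in before S (p i)); last by rewrite !mul0r.
have [|_] := boolP (w \in before S (p j)); last by rewrite mul0r mulr0.
rewrite !inE /before/= => Sj Si; case: ifPn => [Si1|_]; last by rewrite subrr mulr0 mul0r.
have : (S w <= (p j)%:E)%E by rewrite (le_trans Si1)// lee_fin part_le// ltnW.
by rewrite leNgt Sj.
Qed.

(** Orthogonality is pathwise here: the cross products vanish identically, since [S] falls in at
    most one interval. *)
Lemma overshoot_diff_sum : 0 <= dl ->
  L2 P (fun w => \sum_(i < n) overshoot_diff (p i) (p i.+1) w) /\
  Ex P (fun w => (\sum_(i < n) overshoot_diff (p i) (p i.+1) w) ^+ 2) <= 4 * dl.
Proof.
move=> dl0.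
have oL i : (i < n)%N -> L2 P (overshoot_diff (p i) (p i.+1)).
  by move=> ni; apply: overshoot_diff_L2; [exact: part_ge0 (ltnW ni)|exact: part_step].
split; first exact: (@L2_sum _ _ _ _ n (fun i => overshoot_diff (p i) (p i.+1))).
rewrite (@Ex_sqr_sum _ _ _ _ n (fun i => overshoot_diff (p i) (p i.+1)))//.
  exact: sum_overshoot_diff_var.
move=> i j ijn; rewrite -[RHS](Ex_cst P); apply: eq_Ex => w.
by rewrite /overshoot_diff mulrBl !mulrBr !overshoot_disjoint// !subrr.
Qed.

Lemma overshootZ_sum : 0 <= dl ->
  L2 P (fun w => \sum_(i < n) overshoot S Z (p i) (p i.+1) w) /\
  Ex P (fun w => (\sum_(i < n) overshoot S Z (p i) (p i.+1) w) ^+ 2) <= dl.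
Proof.
move=> dl0.
have oL i : (i < n)%N -> L2 P (overshoot S Z (p i) (p i.+1)) /\
    Ex P (fun w => overshoot S Z (p i) (p i.+1) w ^+ 2) <=
    (p i.+1 - p i) * (stop_cdf P S (p i.+1) - stop_cdf P S (p i)).
  move=> ni; apply: (overshoot_L2_var cF S0 stopS nZ); last exact: part_step.
  exact: part_ge0 (ltnW ni).
split.
  by apply: (@L2_sum _ _ _ _ n (fun i => overshoot S Z (p i) (p i.+1))) => i /oL[].
rewrite (@Ex_sqr_sum _ _ _ _ n (fun i => overshoot S Z (p i) (p i.+1))).
- by apply: le_trans (sum_hit_le dl0); apply: ler_sum => i _; have [] := oL i (ltn_ord i).
- by move=> i /oL[].
- move=> i j ijn; rewrite -[RHS](Ex_cst P); apply: eq_Ex => w.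
  by rewrite overshoot_disjoint.
Qed.

Let pinc i := predictable_inc (p i) (p i.+1).

Let pinc_L2 i : (i < n)%N -> L2 P (pinc i).
Proof. by move=> ni; apply: predictable_inc_L2; [exact: part_ge0 (ltnW ni)|exact: part_step]. Qed.

Lemma predictable_sum_L2 : L2 P (fun w => \sum_(i < n) pinc i w).
Proof. exact: L2_sum. Qed.

Lemma predictable_sum_mean A : F (p 0%N) A ->
  Ex P (fun w => \1_A w * \sum_(i < n) pinc i w) = 0.
Proof.
move=> FA; have mA := cf_measurable cF FA.
rewrite (_ : Ex P _ = Ex P (fun w => \sum_(i < n) (\1_A w * pinc i w))).
  rewrite (@Ex_sum _ _ _ _ n (fun i w => \1_A w * pinc i w)).
    rewrite big1// => i _; have ni := ltn_ord i.
    apply: predictable_inc_mean; [exact: part_ge0 (ltnW ni)|exact: part_step| |].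
      apply: measurable_wrt_indic; first exact: (cf_sigma cF).
      by apply: (cf_mono cF _ FA); exact: part_le (ltnW ni).
    exact: L2_bool1.
  by move=> i ni; apply: L2M; [exact: L2_bool1|exact: pinc_L2].
by apply: eq_Ex => w; rewrite mulr_sumr.
Qed.

(** These are martingale differences whose conditional variance is the step. [\1_A] is idempotent
    and known at [p 0], so it can enter the sum and return as [fine (P A)]. *)
Lemma predictable_sum_var A : F (p 0%N) A ->
  Ex P (fun w => \1_A w * (\sum_(i < n) pinc i w) ^+ 2) = (p n - p 0%N) * fine (P A).
Proof.
move=> FA; have mA := cf_measurable cF FA.
have FAi i : (i <= n)%N -> F (p i) A by move=> ni; apply: (cf_mono cF _ FA); exact: part_le.
rewrite (_ : Ex P _ = Ex P (fun w => (\sum_(i < n) (\1_A w * pinc i w)) ^+ 2)); last first.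
  apply: eq_Ex => w; rewrite -mulr_sumr exprMn; congr (_ * _).
  by rewrite indicE; case: (_ \in _); rewrite ?expr1n ?expr0n.
rewrite (@Ex_sqr_sum _ _ _ _ n (fun i w => \1_A w * pinc i w)).
- rewrite -(@telescope_ord R p) mulr_suml; apply: eq_bigr => i _; have ni := ltn_ord i.
  rewrite -predictable_inc_var//; [|exact: part_ge0 (ltnW ni)|exact: part_step|exact: FAi (ltnW ni)].
  apply: eq_Ex => w; rewrite exprMn; congr (_ * _).
  by rewrite indicE; case: (_ \in _); rewrite ?expr1n ?expr0n.
- by move=> i ni; apply: L2_bool => //; exact: pinc_L2.
- move=> i j /andP[ij jn]; have ni := ltn_trans ij jn.
  rewrite -(@predictable_inc_mean (p j) (p j.+1) (fun w => \1_A w * (\1_A w * pinc i w))).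
  + by apply: eq_Ex => w; rewrite /pinc; ring.
  + exact: part_ge0 (ltnW jn).
  + exact: part_step.
  + have sF := cf_sigma cF (p j).
    have mwA : measurable_wrt (F (p j)) (\1_A : T -> R).
      by apply: measurable_wrt_indic => //; exact: FAi (ltnW jn).
    do 2 (apply: measurable_wrtM => //).
    move=> C mC; apply: (cf_mono cF (part_le ij (ltnW jn))).
    by apply: predictable_inc_F => //; [exact: part_ge0 (ltnW ni)|exact: part_step].
  + by do 2 (apply: L2_bool => //); exact: pinc_L2.
Qed.

End partition.
End solution.

(** * Operations on cadlag paths *)

Section cadlag_facts.
Context {R : realType}.
Implicit Types f g : R -> R.

Lemma cadlagD f g : cadlag f -> cadlag g -> cadlag (fun t => f t + g t).
Proof.
move=> [fr fl] [gr gl]; split=> t t0; first by apply: cvgD; [exact: fr|exact: gr].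
by apply: is_cvgD; [exact: fl|exact: gl].
Qed.

Lemma cadlagB f g : cadlag f -> cadlag g -> cadlag (fun t => f t - g t).
Proof.
move=> [fr fl] [gr gl]; split=> t t0; first by apply: cvgB; [exact: fr|exact: gr].
by apply: is_cvgB; [exact: fl|exact: gl].
Qed.

Lemma cadlag_id : cadlag (id : R -> R).
Proof.
split=> t _; first exact: cvg_at_right_filter cvg_id.
by apply/cvg_ex; exists t; exact: cvg_at_left_filter cvg_id.
Qed.

(** On a one-sided neighbourhood of [t] the stopped path is [f] or a constant. At [t = s] it is
    constant on the right and [f] on the left, hence the two different case splits. *)
Lemma cadlag_min f s : 0 <= s -> cadlag f -> cadlag (fun t => f (Num.min s t)).
Proof.
move=> s0 [fr fl]; split=> t t0.
  have [ts|st] := ltP t s.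
    apply: cvg_trans (fr _ t0); apply: near_eq_cvg.
    near=> x; rewrite min_r// ltW//; near: x; exact: nbhs_right_lt.
  apply: cvg_near_cst.
  near=> x; rewrite min_l// (le_trans st)// ltW//; near: x; exact: nbhs_right_gt.
have [ts|lst] := leP t s.
  have /cvg_ex[l fl'] := fl _ t0; apply: (cvgP l).
  apply: cvg_trans fl'; apply: near_eq_cvg.
  near=> x; rewrite min_r// (le_trans _ ts)// ltW//; near: x; exact: nbhs_left_lt.
apply: (cvgP (f s)); apply: cvg_near_cst.
near=> x; rewrite min_l// ltW//; near: x; exact: nbhs_left_gt.
Unshelve. all: by end_near. Qed.

End cadlag_facts.

(** * Martingale property and conditional variance of the switched process *)

Section switched_martingale.
Context {d : measure_display} {T : measurableType d} {R : realType}.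
Variables (P : probability T R) (F : R -> set (set T)).
Hypothesis cF : complete_filtration P F.
Variable S : T -> \bar R.
Hypothesis S0 : forall w, (0 <= S w)%E.
Hypothesis stopS : forall t, 0 <= t -> F t [set w | (S w <= t%:E)%E].
Variables W Z : R -> T -> R.
Hypotheses (nW : normal_martingale P F W) (nZ : normal_martingale P F Z).

Local Notation X := (switched S W Z).
Local Notation I := (post S Z).

Lemma min_time0 w : min_time S 0 w = 0.
Proof.
rewrite min_timeE; case: ifPn => // Sw; suff -> : S w = 0%E by [].
by apply/eqP; rewrite eq_le Sw S0.
Qed.

Lemma switched_0 w : X 0 w = 0.
Proof. by rewrite /switched min_time0 (nm_0 nW) add0r subrr. Qed.

Lemma post_0 w : I 0 w = 0.
Proof. by rewrite /post min_time0 subrr. Qed.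

Lemma switchedE t : 0 <= t -> X t = fun w => predictable_inc S W Z 0 t w + overshoot_diff S W Z 0 t w.
Proof.
move=> t0; apply/funext => w.
by rewrite -switched_increment// switched_0 subr0.
Qed.

Lemma postE t : 0 <= t -> I t = fun w => after_inc S Z 0 t w + overshoot S Z 0 t w.
Proof.
move=> t0; apply/funext => w.
by rewrite -post_increment// post_0 subr0.
Qed.

Lemma switched_L2 t : 0 <= t -> L2 P (X t).
Proof.
move=> t0; rewrite switchedE//; apply: L2D; first exact: (predictable_inc_L2 cF).
exact: (overshoot_diff_L2 cF).
Qed.

Lemma post_L2 t : 0 <= t -> L2 P (I t).
Proof.
move=> t0; rewrite postE//; apply: L2D; first exact: (after_inc_L2 cF).
by have [] := overshoot_L2_var cF S0 stopS nZ (lexx 0) t0.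
Qed.

Lemma switched_adapted : adapted F X.
Proof.
move=> t t0; have sF := cf_sigma cF t.
rewrite switchedE//; apply: measurable_wrtD => //; first exact: (predictable_inc_F cF).
by apply: measurable_wrtB => //; exact: (overshoot_F cF).
Qed.

Lemma post_adapted : adapted F I.
Proof.
move=> t t0; have sF := cf_sigma cF t.
rewrite postE//; apply: measurable_wrtD => //; last exact: (overshoot_F cF).
apply: (weighted_diff_F cF) => //; apply: sigma_algebraC; first exact: (cf_sigma cF).
exact: (before_F cF).
Qed.

Let subdivL (s t : R) k : s <= t -> forall i, (i < k.+1)%N ->
  subdiv s t k i <= subdiv s t k i.+1 <= subdiv s t k i + (t - s) / k.+1%:R.
Proof.
by move=> st i ik; rewrite subdiv_le//= -(subdivS s t k i) addrC subrK.
Qed.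

(* [X t - X s] is, up to an error of size [O(1/k)] in [L2], a sum of increments
   that are conditionally centered with conditional variance the time step. *)
Lemma switched_approx s t k A : 0 <= s -> s <= t -> F s A ->
  exists Y E : T -> R, [/\ L2 P Y, L2 P E,
    forall w, X t w - X s w = Y w + E w,
    Ex P (fun w => \1_A w * Y w) = 0 &
    Ex P (fun w => \1_A w * Y w ^+ 2) = (t - s) * fine (P A) /\
    Ex P (fun w => E w ^+ 2) <= 4 * (t - s) / k.+1%:R].
Proof.
move=> s0 st FA; set p := subdiv s t k.
have pS := @subdivL s t k st; have dl0 : 0 <= (t - s) / k.+1%:R by rewrite divr_ge0// subr_ge0.
have p00 : 0 <= p 0%N by rewrite /p subdiv0.
have FA0 : F (p 0%N) A by rewrite /p subdiv0.
have [EL Ev] := overshoot_diff_sum cF S0 stopS nW nZ p00 pS dl0.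
exists (fun w => \sum_(i < k.+1) predictable_inc S W Z (p i) (p i.+1) w),
  (fun w => \sum_(i < k.+1) overshoot_diff S W Z (p i) (p i.+1) w); split => //.
- exact: (predictable_sum_L2 cF _ _ _ p00 pS).
- move=> w; rewrite -big_split/=.
  transitivity (X (p k.+1) w - X (p 0%N) w); first by rewrite /p subdivn subdiv0.
  rewrite -(@telescope_ord R (fun i => X (p i) w)); apply: eq_bigr => i _.
  by apply: switched_increment; [exact: (part_ge0 p00 pS (ltnW (ltn_ord i)))|exact: (part_step pS)].
- exact: (predictable_sum_mean cF stopS nW nZ p00 pS FA0).
- rewrite (predictable_sum_var cF stopS nW nZ p00 pS FA0) /p subdivn subdiv0; split=> //.
  by rewrite -mulrA.
Qed.

(** The mean comes from the error term alone, whose second moment is of order [1 / k]; as the mean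
    does not depend on [k], it is zero. *)
Lemma switched_mean s t A : 0 <= s -> s <= t -> F s A ->
  Ex P (fun w => \1_A w * (X t w - X s w)) = 0.
Proof.
move=> s0 st FA; have mA := cf_measurable cF FA; set m := Ex P _.
suff : m ^+ 2 <= 0.
  by move=> m2; apply/eqP; rewrite -sqrf_eq0 eq_le m2 sqr_ge0.
apply: (@le_inv_nat _ _ 0 (4 * (t - s))); first by rewrite mulr_ge0// subr_ge0.
move=> k; rewrite add0r.
have [Y [E [YL EL XE mY [_ vE]]]] := switched_approx k s0 st FA.
apply: le_trans vE.
have mE : m = Ex P (fun w => \1_A w * E w).
  rewrite /m (_ : Ex P _ = Ex P (fun w => \1_A w * Y w + \1_A w * E w)).
    by rewrite ExD ?mY ?add0r//; apply: L2_L1; exact: L2_bool.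
  by apply: eq_Ex => w; rewrite XE mulrDr.
have AEL : L2 P (fun w => \1_A w * E w) by exact: L2_bool.
(* The variance of [\1_A * E] is nonnegative. *)
have : 0 <= Ex P (fun w => (\1_A w * E w - m) ^+ 2) by apply: Ex_ge0 => w; exact: sqr_ge0.
have -> : Ex P (fun w => (\1_A w * E w - m) ^+ 2) = Ex P (fun w => (\1_A w * E w) ^+ 2) - m ^+ 2.
  rewrite (_ : Ex P _ = Ex P (fun w => ((\1_A w * E w) ^+ 2 - 2 * m * (\1_A w * E w)) + m ^+ 2)).
    rewrite ExD ?Ex_cst; [|apply: L1B; [exact: L2_sqr|apply: L1Z; exact: L2_L1]|exact: L1_cst].
    rewrite ExB; [|exact: L2_sqr|apply: L1Z; exact: L2_L1].
    by rewrite ExZ -?mE; [ring|exact: L2_L1].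
  by apply: eq_Ex => w; ring.
rewrite subr_ge0 => /le_trans; apply; apply: Ex_le; [exact: L2_sqr|exact: L2_sqr|].
by move=> w; rewrite indicE; case: (_ \in _); rewrite ?mul1r// mul0r expr0n sqr_ge0.
Qed.

(** [compare] is used for [X = Y + E] and for [Y = X - E]; [le_relative] removes the error and
    leaves the two opposite inequalities. *)
Lemma switched_var s t A : 0 <= s -> s <= t -> F s A ->
  Ex P (fun w => \1_A w * (X t w - X s w) ^+ 2) = (t - s) * fine (P A).
Proof.
move=> s0 st FA; have mA := cf_measurable cF FA.
have K0 : 0 <= 4 * (t - s) by rewrite mulr_ge0// subr_ge0.
have XL : L2 P (fun w => X t w - X s w).
  by apply: L2B; apply: switched_L2 => //; exact: le_trans st.
have ind0 w : 0 <= \1_A w :> R by rewrite indicE.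
have ind1 w y : 0 <= y -> \1_A w * y <= y :> R.
  by move=> y0; rewrite indicE; case: (_ \in _); rewrite ?mul1r// mul0r.
have compare (U V E : T -> R) c : L2 P U -> L2 P V -> L2 P E -> 0 < c ->
    (forall w, U w = V w + E w) ->
    Ex P (fun w => \1_A w * U w ^+ 2) <=
    (1 + c) * Ex P (fun w => \1_A w * V w ^+ 2) + (1 + c^-1) * Ex P (fun w => E w ^+ 2).
  move=> LU LV LE c0 UVE; have [[U1 V1] E1] := (L2_sqr LU, L2_sqr LV, L2_sqr LE).
  rewrite -!ExZ//; last by apply: L1_bool.
  rewrite -ExD; [|by apply: L1Z; apply: L1_bool|exact: L1Z].
  apply: Ex_le; [exact: L1_bool|apply: L1D; [by apply: L1Z; apply: L1_bool|exact: L1Z]|].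
  move=> w; rewrite UVE; have := ler_wpM2l (ind0 w) (sqr_sub_le (V w) (E w) c0).
  move=> /le_trans; apply; rewrite mulrDr mulrCA lerD2l mulrCA.
  by rewrite ler_wpM2l ?ind1 ?sqr_ge0// addr_ge0// invr_ge0 ltW.
apply/eqP; rewrite eq_le; apply/andP; split; apply: (@le_relative _ _ _ (4 * (t - s))) => //.
- by rewrite mulr_ge0 ?subr_ge0 ?fine_ge0.
- move=> c k c0; have [Y [E [YL EL XE _ [vY vE]]]] := switched_approx k s0 st FA.
  rewrite -vY; apply: le_trans (compare _ _ _ c XL YL EL c0 XE) _.
  by rewrite lerD2l ler_wpM2l// addr_ge0// invr_ge0 ltW.
- by apply: Ex_ge0 => w; rewrite mulr_ge0// sqr_ge0.
- move=> c k c0; have [Y [E [YL EL XE _ [vY vE]]]] := switched_approx k s0 st FA.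
  have NEL : L2 P (fun w => - E w).
    by rewrite (_ : (fun w => - E w) = fun w => (-1) * E w);
      [exact: L2Z|apply/funext => w; rewrite mulN1r].
  rewrite -vY; apply: le_trans (compare _ _ _ c YL XL NEL c0 _) _.
    by move=> w; rewrite XE addrK.
  rewrite lerD2l ler_wpM2l ?addr_ge0// ?invr_ge0 ?(ltW c0)//.
  by rewrite (eq_Ex _ (fun w => sqrrN (E w))).
Qed.

Lemma cadlag_stopped M w : cadlag (M ^~ w) -> cadlag (fun t => M (min_time S t w) w).
Proof.
move=> cM; have [Soo|Sfin] := eqVneq (S w) +oo%E.
  by rewrite (_ : (fun t => _) = M ^~ w)//; apply/funext => t; rewrite min_timeE Soo.
have Sw : S w = (fine (S w))%:E by rewrite fineK// fin_numE Sfin andbT -ltNye (lt_le_trans _ (S0 w)).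
rewrite (_ : (fun t => _) = (fun t => M (Num.min (fine (S w)) t) w)).
  by apply: (@cadlag_min _ (M ^~ w)) => //; exact: fine_ge0.
by apply/funext => t; rewrite min_timeE Sw lee_fin minEle.
Qed.

Lemma post_cadlag w : cadlag (I ^~ w).
Proof. by apply: cadlagB; [|apply: cadlag_stopped]; exact: (nm_cadlag nZ). Qed.

Lemma switched_cadlag w : cadlag (X ^~ w).
Proof.
apply: cadlagB; last by apply: cadlag_stopped; exact: (nm_cadlag nZ).
by apply: cadlagD; [apply: cadlag_stopped; exact: (nm_cadlag nW)|exact: (nm_cadlag nZ)].
Qed.

Lemma integral_Ex_setI (A : set T) (f : T -> R) : measurable A -> L1 P f ->
  (\int[P]_(w in A) (f w)%:E = (Ex P (fun w => \1_A w * f w))%:E)%E.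
Proof.
move=> mA Lf; rewrite -ExE; last exact: L1_bool.
rewrite integral_mkcond; apply: eq_integral => w _.
by rewrite patchE indicE; case: (_ \in _); rewrite ?mul1r ?mul0r.
Qed.

Lemma switched_martingale : square_integrable_martingale P F X.
Proof.
split.
- exact: switched_adapted.
- by apply: aeW => w; exact: switched_cadlag.
- by move=> t t0; apply: L2_L1; exact: switched_L2.
- by move=> t t0; exact: L2_sqr (switched_L2 t0).
- move=> s t A /andP[s0 st] FA; have mA := cf_measurable cF FA.
  have t0 := le_trans s0 st.
  have [Lt Ls] := (L2_L1 (switched_L2 t0), L2_L1 (switched_L2 s0)).
  rewrite !integral_Ex_setI//; congr (_%:E); apply/eqP; rewrite -subr_eq0 -ExB; [|exact: L1_bool..].
  apply/eqP; rewrite -[RHS](switched_mean s0 st FA); apply: eq_Ex => w.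
  by rewrite [RHS]mulrBr.
Qed.

End switched_martingale.

(** * Quadratic variation of the switched process *)

Section quadratic_variation.
Context {d : measure_display} {T : measurableType d} {R : realType}.
Variables (P : probability T R) (F : R -> set (set T)).
Hypothesis cF : complete_filtration P F.
Variable S : T -> \bar R.
Hypothesis S0 : forall w, (0 <= S w)%E.
Hypothesis stopS : forall t, 0 <= t -> F t [set w | (S w <= t%:E)%E].
Variables W Z : R -> T -> R.
Hypotheses (nW : normal_martingale P F W) (nZ : normal_martingale P F Z).

(* The squared increments of [W] concentrate like those of Brownian motion. *)
Variable C : R.
Hypothesis C0 : 0 <= C.
Hypothesis W_sqr_L2 : forall s t, 0 <= s -> s <= t ->
  L2 P (fun w => (W t w - W s w) ^+ 2).
Hypothesis W_sqr_var : forall s t, 0 <= s -> s <= t ->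
  Ex P (fun w => ((W t w - W s w) ^+ 2 - (t - s)) ^+ 2) <= C * (t - s) ^+ 2.
Hypothesis W_sqr_mean : forall s t (G : T -> R), 0 <= s -> s <= t ->
  measurable_wrt (F s) G -> L2 P G ->
  Ex P (fun w => G w * ((W t w - W s w) ^+ 2 - (t - s))) = 0.

(* [Z t + t] increases by unit jumps, hardly ever twice in a short interval. *)
Hypothesis Z_nd : forall w s t, 0 <= s -> s <= t -> 0 <= Z t w - Z s w + (t - s).
Hypothesis Z_sqr : forall s t, 0 <= s -> s <= t ->
  Ex P (fun w => `|(Z t w - Z s w) ^+ 2 - (Z t w - Z s w) - (t - s)|) <=
  4 * (t - s) ^+ 2.

Local Notation X := (switched S W Z).
Local Notation I := (post S Z).

Definition bracket (t : R) (w : T) : R := t + I t w.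

Lemma bracket_adapted : adapted F bracket.
Proof.
move=> t t0; apply: measurable_wrtD; first exact: (cf_sigma cF).
  by apply: measurable_wrt_cst; exact: (cf_sigma cF).
exact: (post_adapted cF S0 stopS nZ).
Qed.

Lemma bracket_cadlag w : cadlag (bracket ^~ w).
Proof. by apply: cadlagD; [exact: cadlag_id|exact: (post_cadlag S0 nZ)]. Qed.

Lemma bracket_nondecreasing w s t : 0 <= s <= t -> bracket s w <= bracket t w.
Proof.
move=> /andP[s0 st]; rewrite /bracket /post !min_timeE.
case: (leP (S w) s%:E) => [Ss|sS].
  rewrite (le_trans Ss) ?lee_fin//.
  by have := Z_nd w s0 st; lra.
case: (leP (S w) t%:E) => [St|tS]; last by lra.
have Sw := stop_fin S0 St; move: sS St; rewrite Sw lte_fin lee_fin => sS St.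
have := Z_nd w (le_trans s0 (ltW sS)) St; lra.
Qed.

(** Both defects compare a squared increment with its share of the bracket. This one is summed in L2
    by orthogonality, while [Zterm] is summed in L1, where each term is of the order of the squared
    step. *)
Definition Wterm (a b : R) (w : T) : R :=
  \1_(before S a) w * ((W b w - W a w) ^+ 2 - (b - a)).
Definition Zterm (a b : R) (w : T) : R :=
  \1_(~` before S a) w * ((Z b w - Z a w) ^+ 2 - (Z b w - Z a w) - (b - a)).

(** The cross term involves [before_inc] only, because the overshoots vanish when [S <= a]. The
    trailing overshoot is contributed by the bracket, through [post_increment]. *)
Lemma sqr_increment a b w : 0 <= a -> a <= b ->
  (X b w - X a w) ^+ 2 - (bracket b w - bracket a w) =
  Wterm a b w + Zterm a b w + 2 * (before_inc S W a b w * overshoot_diff S W Z a b w)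
  + overshoot_diff S W Z a b w ^+ 2 - overshoot S Z a b w.
Proof.
move=> a0 ab; rewrite switched_increment//.
rewrite (_ : bracket b w - bracket a w = (b - a) + (I b w - I a w)); last first.
  by rewrite /bracket; ring.
rewrite post_increment// /Wterm /Zterm /overshoot_diff /predictable_inc /before_inc.
rewrite /after_inc /overshoot !indicE in_setC.
by case: (w \in _) => /=; ring.
Qed.

Let bm a : 0 <= a -> measurable (before S a).
Proof. exact: (before_measurable cF stopS). Qed.

Lemma Wterm_L2 a b : 0 <= a -> a <= b -> L2 P (Wterm a b).
Proof.
move=> a0 ab; apply: L2_bool; first exact: bm.
by apply: L2B; [exact: W_sqr_L2|exact: L2_cst].
Qed.

Lemma Zdefect_L1 a b : 0 <= a -> a <= b ->
  L1 P (fun w => (Z b w - Z a w) ^+ 2 - (Z b w - Z a w) - (b - a)).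
Proof.
move=> a0 ab; have ZL : L2 P (fun w => Z b w - Z a w) by exact: nm_diff_L2 nZ _ _.
by apply: L1B; [apply: L1B; [exact: L2_sqr|exact: L2_L1]|exact: L1_cst].
Qed.

Lemma Zterm_L1 a b : 0 <= a -> a <= b -> L1 P (Zterm a b).
Proof.
move=> a0 ab; apply: L1_bool; first by apply: measurableC; exact: bm.
exact: Zdefect_L1.
Qed.

Lemma Zterm_mean a b : 0 <= a -> a <= b -> Ex P (fun w => `|Zterm a b w|) <= 4 * (b - a) ^+ 2.
Proof.
move=> a0 ab; apply: le_trans (Z_sqr a0 ab); apply: Ex_le.
- by apply: L1_norm; exact: Zterm_L1.
- by apply: L1_norm; exact: Zdefect_L1.
- by move=> w; rewrite /Zterm indicE; case: (_ \in _); rewrite ?mul1r// mul0r normr0.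
Qed.

Section partition_bound.
Variables (n : nat) (p : nat -> R) (c t : R).
Hypothesis p0 : p 0%N = 0.
Hypothesis pn : p n = t.
Hypothesis c0 : 0 < c.
Hypothesis pS : forall i, (i < n)%N -> p i <= p i.+1 <= p i + c ^+ 2.

Let p00 : 0 <= p 0%N. Proof. by rewrite p0. Qed.
Let pi0 i : (i < n)%N -> 0 <= p i. Proof. by move=> ni; exact: (part_ge0 p00 pS (ltnW ni)). Qed.
Let pst i : (i < n)%N -> p i <= p i.+1. Proof. by move=> ni; exact: (part_step pS). Qed.
Let step_le i : (i < n)%N -> p i.+1 - p i <= c ^+ 2.
Proof. by move=> ni; have /andP[_] := pS ni; lra. Qed.
Let sum_step : \sum_(i < n) (p i.+1 - p i) = t.
Proof. by rewrite (@telescope_ord R p) pn p0 subr0. Qed.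
Let c20 : 0 <= c ^+ 2. Proof. exact: sqr_ge0. Qed.

Let sum_sqr_step : \sum_(i < n) (p i.+1 - p i) ^+ 2 <= c ^+ 2 * t.
Proof.
rewrite -sum_step mulr_sumr; apply: ler_sum => i _; have ni := ltn_ord i.
by rewrite expr2 ler_wpM2r ?step_le// subr_ge0 pst.
Qed.

Let Wsum w := \sum_(i < n) Wterm (p i) (p i.+1) w.

Let Wsum_L2 : L2 P Wsum.
Proof.
apply: (@L2_sum _ _ _ _ n (fun i => Wterm (p i) (p i.+1))) => i ni.
by apply: Wterm_L2; [exact: pi0|exact: pst].
Qed.

Let Wsum_var : Ex P (fun w => Wsum w ^+ 2) <= C * (c ^+ 2 * t).
Proof.
rewrite (@Ex_sqr_sum _ _ _ _ n (fun i => Wterm (p i) (p i.+1))).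
- apply: (@le_trans _ _ (\sum_(i < n) (C * (p i.+1 - p i) ^+ 2))); last first.
    by rewrite -mulr_sumr ler_wpM2l.
  apply: ler_sum => i _; have ni := ltn_ord i.
  apply: le_trans (W_sqr_var (pi0 ni) (pst ni)); apply: Ex_le.
  + by apply: L2_sqr; apply: Wterm_L2; [exact: pi0|exact: pst].
  + by apply: L2_sqr; apply: L2B; [apply: W_sqr_L2; [exact: pi0|exact: pst]|exact: L2_cst].
  + move=> w; rewrite /Wterm indicE; case: (_ \in _); rewrite ?mul1r//.
    by rewrite mul0r expr0n sqr_ge0.
- by move=> i ni; apply: Wterm_L2; [exact: pi0|exact: pst].
- move=> i j /andP[ij jn]; have ni := ltn_trans ij jn.
  have ij' : p i.+1 <= p j by exact: (part_le pS ij (ltnW jn)).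
  (* The earlier term and the later indicator are both known at [p j], so only the centred square of
     the later increment is left. *)
  rewrite -(@W_sqr_mean (p j) (p j.+1)
    (fun w => \1_(before S (p j)) w * Wterm (p i) (p i.+1) w)).
  + by apply: eq_Ex => w; rewrite /Wterm; ring.
  + exact: pi0.
  + exact: pst.
  + have sF := cf_sigma cF (p j).
    apply: measurable_wrtM => //.
      by apply: measurable_wrt_indic => //; apply: (before_F cF) => //; exact: pi0.
    apply: measurable_wrtM => //.
      apply: measurable_wrt_indic => //; apply: (before_F cF) => //; first exact: pi0.
      exact: le_trans (pst ni) ij'.
    apply: measurable_wrtB => //; last exact: measurable_wrt_cst.
    rewrite (_ : (fun w => _) = fun w => (W (p i.+1) w - W (p i) w) * (W (p i.+1) w - W (p i) w)).
      have mW : measurable_wrt (F (p j)) (fun w => W (p i.+1) w - W (p i) w).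
        apply: measurable_wrtB => // D mD.
          apply: (cf_mono cF ij'); apply: (nm_adapted nW) => //.
          exact: le_trans (pi0 ni) (pst ni).
        by apply: (cf_mono cF (le_trans (pst ni) ij')); apply: (nm_adapted nW) => //; exact: pi0.
      exact: measurable_wrtM.
    by apply/funext => w; rewrite expr2.
  + apply: L2_bool; first by apply: bm; exact: pi0.
    by apply: Wterm_L2; [exact: pi0|exact: pst].
Qed.

Let Zsum w := \sum_(i < n) `|Zterm (p i) (p i.+1) w|.

Let Zsum_L1 : L1 P Zsum.
Proof.
apply: (@L1_sum _ _ _ _ n (fun i w => `|Zterm (p i) (p i.+1) w|)) => i ni.
by apply: L1_norm; apply: Zterm_L1; [exact: pi0|exact: pst].
Qed.

Let Zsum_mean : Ex P Zsum <= 4 * (c ^+ 2 * t).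
Proof.
rewrite (@Ex_sum _ _ _ _ n (fun i w => `|Zterm (p i) (p i.+1) w|)); last first.
  by move=> i ni; apply: L1_norm; apply: Zterm_L1; [exact: pi0|exact: pst].
apply: (@le_trans _ _ (\sum_(i < n) (4 * (p i.+1 - p i) ^+ 2))); last first.
  by rewrite -mulr_sumr ler_wpM2l.
apply: ler_sum => i _; have ni := ltn_ord i.
by apply: Zterm_mean; [exact: pi0|exact: pst].
Qed.

Let Bsum w := \sum_(i < n) before_inc S W (p i) (p i.+1) w ^+ 2.

Let before_inc_sqr_L1 i : (i < n)%N -> L1 P (fun w => before_inc S W (p i) (p i.+1) w ^+ 2).
Proof. by move=> ni; apply: L2_sqr; apply: (before_inc_L2 cF stopS nW); [exact: pi0|exact: pst]. Qed.

Let Bsum_L1 : L1 P Bsum.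
Proof. exact: (@L1_sum _ _ _ _ n (fun i w => before_inc S W (p i) (p i.+1) w ^+ 2)). Qed.

Let Bsum_mean : Ex P Bsum <= t.
Proof.
rewrite (@Ex_sum _ _ _ _ n (fun i w => before_inc S W (p i) (p i.+1) w ^+ 2))// -sum_step.
apply: ler_sum => i _; have ni := ltn_ord i.
have FT : F (p i) setT by apply: sigma_algebraT; exact: (cf_sigma cF).
apply: (@le_trans _ _ (Ex P (fun w => \1_setT w * (W (p i.+1) w - W (p i) w) ^+ 2))).
  apply: Ex_le; first exact: before_inc_sqr_L1.
    apply: L1_bool => //; apply: L2_sqr; apply: nm_diff_L2 nW _ _; [exact: pi0|exact: pst].
  move=> w; rewrite /before_inc !indicE in_setT mul1r.
  by case: (_ \in _); rewrite ?mul1r// mul0r expr0n sqr_ge0.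
by rewrite (nm_var nW)// ?pi0 ?pst// probability_setT/= mulr1.
Qed.

Let Osum w := \sum_(i < n) overshoot_diff S W Z (p i) (p i.+1) w ^+ 2.

Let od_sqr_L1 i : (i < n)%N -> L1 P (fun w => overshoot_diff S W Z (p i) (p i.+1) w ^+ 2).
Proof.
by move=> ni; apply: L2_sqr; apply: (overshoot_diff_L2 cF S0 stopS nW nZ); [exact: pi0|exact: pst].
Qed.

Let Osum_L1 : L1 P Osum.
Proof. exact: (@L1_sum _ _ _ _ n (fun i w => overshoot_diff S W Z (p i) (p i.+1) w ^+ 2)). Qed.

Let Osum_mean : Ex P Osum <= 4 * c ^+ 2.
Proof.
rewrite (@Ex_sum _ _ _ _ n (fun i w => overshoot_diff S W Z (p i) (p i.+1) w ^+ 2))//.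
exact: (sum_overshoot_diff_var cF S0 stopS nW nZ p00 pS).
Qed.

Let Vsum w := \sum_(i < n) overshoot S Z (p i) (p i.+1) w.

Let Vsum_LV : L2 P Vsum /\ Ex P (fun w => Vsum w ^+ 2) <= c ^+ 2.
Proof. exact: (overshootZ_sum cF S0 stopS nZ p00 pS). Qed.

(** Young's inequality again: since the mesh is [c ^+ 2], a second moment of order [c ^+ 2] becomes
    a first moment of order [c]. *)
Let norm_le_sqr (x : R) : `|x| <= c + c^-1 * x ^+ 2.
Proof.
rewrite -(ler_pM2l c0) mulrDr mulrA mulfV ?gt_eqF// mul1r -real_normK ?num_real//.
by have := normr_ge0 x; nra.
Qed.

Definition qv_error w := \sum_(i < n) (X (p i.+1) w - X (p i) w) ^+ 2 - bracket t w.

Lemma qv_error_L1 : L1 P qv_error.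
Proof.
apply: L1B.
  apply: (@L1_sum _ _ _ _ n (fun i w => (X (p i.+1) w - X (p i) w) ^+ 2)) => i ni.
  have := switched_L2 cF S0 stopS nW nZ; have := pi0 ni; have := pst ni => h1 h2 sL.
  by apply: L2_sqr; apply: L2B; apply: sL => //; exact: le_trans h2 h1.
have t0 : 0 <= t by rewrite -pn; exact: (part_ge0 p00 pS (leqnn _)).
by apply: L1D; [exact: L1_cst|apply: L2_L1; exact: (post_L2 cF S0 stopS nZ)].
Qed.

(** The constant 7 adds up [c] for [Wsum], [2 * c] for [Vsum] (from [norm_le_sqr] and from its
    variance) and [4 * c] for the squared overshoots. [C * t] stems from the variance of [Wsum], [t]
    from the mean of [Bsum], and the terms in [c ^+ 2] from [Zsum] and [Osum]. *)
Lemma qv_error_mean :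
  Ex P (fun w => `|qv_error w|) <= c * (7 + (C + 1) * t) + 4 * c ^+ 2 * (t + 1).
Proof.
have [VL Vv] := Vsum_LV.
pose G w := ((c + c^-1 * Wsum w ^+ 2) + Zsum w) +
  ((c * Bsum w + (1 + c^-1) * Osum w) + (c + c^-1 * Vsum w ^+ 2)).
have LG1 : L1 P (fun w => (c + c^-1 * Wsum w ^+ 2)).
  by apply: L1D; [exact: L1_cst|apply: L1Z; exact: L2_sqr].
have LG2 : L1 P (fun w => (c + c^-1 * Vsum w ^+ 2)).
  by apply: L1D; [exact: L1_cst|apply: L1Z; exact: L2_sqr].
have LG3 : L1 P (fun w => c * Bsum w + (1 + c^-1) * Osum w) by apply: L1D; exact: L1Z.
have LG : L1 P G by do ![exact: L1D|apply: L1D].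
have err w : `|qv_error w| <= G w.
  have -> : qv_error w = Wsum w + \sum_(i < n) Zterm (p i) (p i.+1) w +
    \sum_(i < n) (2 * (before_inc S W (p i) (p i.+1) w * overshoot_diff S W Z (p i) (p i.+1) w))
    + Osum w - Vsum w.
    rewrite /qv_error (_ : bracket t w = \sum_(i < n) (bracket (p i.+1) w - bracket (p i) w)).
      rewrite -sumrB (eq_bigr (fun i : 'I_n => Wterm (p i) (p i.+1) w + Zterm (p i) (p i.+1) w
        + 2 * (before_inc S W (p i) (p i.+1) w * overshoot_diff S W Z (p i) (p i.+1) w)
        + overshoot_diff S W Z (p i) (p i.+1) w ^+ 2 - overshoot S Z (p i) (p i.+1) w)).
        by rewrite sumrB !big_split.
      by move=> i _; apply: sqr_increment; [exact: pi0|exact: pst].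
    rewrite (@telescope_ord R (fun i => bracket (p i) w)) pn p0 /bracket.
    by rewrite (post_0 S0 Z) addr0 subr0.
  set Zs := \sum_(i < n) Zterm _ _ _; set Cs := \sum_(i < n) (2 * _).
  have hW := norm_le_sqr (Wsum w); have hV := norm_le_sqr (Vsum w).
  have hZ : `|Zs| <= Zsum w by exact: ler_norm_sum.
  have hO : `|Osum w| <= Osum w by rewrite ger0_norm// sumr_ge0// => i _; exact: sqr_ge0.
  have hC : `|Cs| <= c * Bsum w + c^-1 * Osum w.
    apply: (le_trans (ler_norm_sum _ _ _)); rewrite /Bsum /Osum !mulr_sumr -big_split/=.
    apply: ler_sum => i _; set x := before_inc _ _ _ _ _; set y := overshoot_diff _ _ _ _ _ _.
    have h1 : 0 <= c * (x - c^-1 * y) ^+ 2 by rewrite mulr_ge0 ?sqr_ge0// ltW.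
    have h2 : 0 <= c * (x + c^-1 * y) ^+ 2 by rewrite mulr_ge0 ?sqr_ge0// ltW.
    have e1 : c * (x - c^-1 * y) ^+ 2 = c * x ^+ 2 + c^-1 * y ^+ 2 - 2 * (x * y).
      by field; rewrite gt_eqF.
    have e2 : c * (x + c^-1 * y) ^+ 2 = c * x ^+ 2 + c^-1 * y ^+ 2 + 2 * (x * y).
      by field; rewrite gt_eqF.
    by rewrite ler_norml; apply/andP; split; lra.
  apply: (le_trans (ler_normB _ _)); apply: (@le_trans _ _ (`|Wsum w| + `|Zs| + `|Cs| + `|Osum w| + `|Vsum w|)).
    rewrite lerD2r; apply: (le_trans (ler_normD _ _)); rewrite lerD2r.
    by apply: (le_trans (ler_normD _ _)); rewrite lerD2r ler_normD.
  by rewrite /G mulrDl mul1r; lra.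
apply: (le_trans (Ex_le _ LG err)); first by apply: L1_norm; exact: qv_error_L1.
rewrite /G; do ![rewrite ExD//; try (by apply: L1D)].
- rewrite !ExZ ?Ex_cst//; [|exact: L2_sqr..].
  have ci : c^-1 * c ^+ 2 = c by rewrite expr2 mulrA mulVf ?gt_eqF// mul1r.
  have cV : 0 < c^-1 by rewrite invr_gt0.
  have h1 : c^-1 * Ex P (fun w => Wsum w ^+ 2) <= C * t * c.
    apply: (@le_trans _ _ (c^-1 * (C * (c ^+ 2 * t)))); first by rewrite ler_wpM2l ?(ltW cV).
    have -> : c^-1 * (C * (c ^+ 2 * t)) = C * t * (c^-1 * c ^+ 2) by ring.
    by rewrite ci.
  have h2 : c^-1 * Ex P (fun w => Vsum w ^+ 2) <= c by rewrite -{2}ci ler_wpM2l ?(ltW cV).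
  have h3 : c * Ex P Bsum <= c * t by rewrite ler_wpM2l ?(ltW c0).
  have h4 : (1 + c^-1) * Ex P Osum <= 4 * c ^+ 2 + 4 * c.
    apply: (@le_trans _ _ ((1 + c^-1) * (4 * c ^+ 2))); first by rewrite ler_wpM2l// addr_ge0// ltW.
    by rewrite mulrDl mul1r lerD2l mulrCA ci.
  have h5 := Zsum_mean.
  by lra.
all: try exact: L1_cst; try (by apply: L1Z => //; exact: L2_sqr); try exact: L1Z.
Qed.

End partition_bound.

Lemma switched_quadratic_variation : quadratic_variation P F X bracket.
Proof.
split.
- exact: bracket_adapted.
- by apply: aeW => w; exact: bracket_cadlag.
- by apply: aeW => w s t; exact: bracket_nondecreasing.
- move=> t e eta t0 e0 eta0.
  (* With [c <= 1], hence [c ^+ 2 <= c], the mean error is at most [c * K]. The other bound on [c]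
     makes this at most [e * eta / 2], and Markov's inequality gives a probability below [eta]. *)
  pose K := 7 + (C + 1) * t + 4 * (t + 1).
  have K0 : 0 < K by have := mulr_ge0 C0 t0; rewrite /K mulrDl mul1r; lra.
  pose c := Num.min 1 (e * eta / (2 * K)).
  have c0 : 0 < c by rewrite lt_min ltr01/= divr_gt0// mulr_gt0.
  have c1 : c <= 1 by rewrite ge_min lexx.
  exists (c ^+ 2); first by rewrite exprn_gt0.
  move=> n p p0 pn ps.
  have pS i : (i < n)%N -> p i <= p i.+1 <= p i + c ^+ 2.
    by move=> /ps /andP[-> /ltW].
  have L := qv_error_L1 p0 pn pS.
  have E := qv_error_mean p0 pn c0 pS.
  have M := markov_prob e0 L.
  have mA : measurable [set w | e <= `|qv_error n p t w|].
    rewrite -[X in measurable X]setTI; apply: measurable_fun_le => //.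
    by apply: measurableT_comp => //; exact: L1_measurable L.
  rewrite -[X in (X < _)%E]fineK ?fin_num_measure// lte_fin -(ltr_pM2l e0).
  apply: (le_lt_trans M); apply: (le_lt_trans E).
  apply: (@le_lt_trans _ _ (c * K)).
    rewrite -subr_ge0 (_ : _ - _ = 4 * ((c - c ^+ 2) * (t + 1))); last by rewrite /K; ring.
    apply: mulr_ge0 => //; apply: mulr_ge0; last exact: addr_ge0.
    by rewrite subr_ge0 expr2 ger_pMl.
  apply: (@le_lt_trans _ _ (e * eta / 2)).
    rewrite -ler_pdivlMr//; rewrite ge_min; apply/orP; right.
    by rewrite invfM mulrA.
  have eeta : 0 < e * eta by rewrite mulr_gt0.
  by lra.
Qed.

End quadratic_variation.

(** * The measure dt x P on the predictable sigma-algebra *)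

Section product_doleans.
Context {d : measure_display} {T : measurableType d} {R : realType}.
Variables (P : probability T R) (F : R -> set (set T)).
Local Notation leb := (@lebesgue_measure R).
Local Notation predT := (g_sigma_algebraType (predictable_rect F)).

Lemma predictable_sub_product (cF : complete_filtration P F) (A : set predT) :
  measurable A -> measurable (A : set (R * T)).
Proof.
apply: (@smallest_sub _ _ _ (@measurable _ (R * T)%type)); first exact: sigma_algebra_measurable.
move=> _ [[A0 FA ->]|[s [t [A0 [_ FA ->]]]]].
  by apply: measurableX => //; exact: (cf_measurable cF FA).
by apply: measurableX => //; exact: (cf_measurable cF FA).
Qed.

(** Carrying [cF] as an argument lets the measure structure, whose proofs rest on it, be attached to
    this constant. *)
Definition time_product (cF : complete_filtration P F) (A : set predT) : \bar R :=
  (leb \x P)%E (A : set (R * T)).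

Section measure.
Variable cF : complete_filtration P F.

Let tp0 : time_product cF set0 = 0%E.
Proof. exact: measure0. Qed.

Let tp_ge0 A : (0 <= time_product cF A)%E.
Proof. exact: measure_ge0. Qed.

Let tp_additive : semi_sigma_additive (time_product cF).
Proof.
move=> G mG tG mUG; apply: measure_semi_sigma_additive => //.
  by move=> i; exact: (predictable_sub_product cF).
exact: (predictable_sub_product cF).
Qed.

HB.instance Definition _ := isMeasure.Build _ _ _ (time_product cF) tp0 tp_ge0 tp_additive.
End measure.

Lemma time_product_rect (cF : complete_filtration P F) s t A : s <= t -> measurable A ->
  time_product cF (`]s, t] `*` A) = ((t - s) * fine (P A))%:E.
Proof.
move=> st mA; transitivity (leb `]s, t]%classic * P A)%E; first exact: product_measure1E.
rewrite lebesgue_measure_itv/= lte_fin EFinM fineK ?fin_num_measure//; congr (_ * _)%E.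
by move: st; rewrite le_eqVlt => /orP[/eqP->|->//]; rewrite ltxx subrr.
Qed.

Lemma time_product0 (cF : complete_filtration P F) A : measurable A ->
  time_product cF ([set 0] `*` A) = 0%E.
Proof.
move=> mA; transitivity (leb [set 0%R] * P A)%E; first exact: product_measure1E.
by rewrite lebesgue_measure_set1 mul0e.
Qed.

Lemma predictable_domain_upto (cF : complete_filtration P F) (t : R) : 0 <= t ->
  measurable (`[0, t] `*` setT : set predT).
Proof.
move=> t0; rewrite (_ : _ `*` _ = ([set 0] `*` setT) `|` (`]0, t] `*` setT) :> set predT).
  have FT : F 0 setT by apply: sigma_algebraT; exact: (cf_sigma cF).
  apply: measurableU; apply: sub_sigma_algebra; first by left; exists setT.
  by right; exists 0, t, setT; rewrite lexx.
apply/seteqP; split=> -[s w]/=; rewrite !in_itv/=.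
  move=> [/andP[s0 st] _]; have [->|sn0] := eqVneq s 0; [by left|right].
  by split=> //; rewrite st lt_neqAle eq_sym sn0 s0.
by move=> [[-> _]|[/andP[s0 st] _]]; split=> //; rewrite ?lexx ?t0// st ltW.
Qed.

Lemma predictable_domain (cF : complete_filtration P F) :
  measurable (`[0, +oo[ `*` setT : set predT).
Proof.
rewrite (_ : _ `*` _ = \bigcup_n (`[0, n%:R] `*` setT) :> set predT).
  by apply: bigcup_measurable => n _; exact: (predictable_domain_upto cF).
apply/seteqP; split=> -[s w]/=.
  rewrite in_itv/= andbT => -[s0 _]; exists (Num.truncn s).+1 => //=; split => //=.
  by rewrite in_itv/= s0/= ltW// truncnS_gt.
by move=> [n _ [/=]]; rewrite !in_itv/= => /andP[-> _].
Qed.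

End product_doleans.

(** * The stochastic integral of the indicator of [S, oo[ *)

Section integral.
Context {d : measure_display} {T : measurableType d} {R : realType}.
Variables (P : probability T R) (F : R -> set (set T)).
Hypothesis cF : complete_filtration P F.
Variable S : T -> \bar R.
Hypothesis S0 : forall w, (0 <= S w)%E.
Hypothesis stopS : forall t, 0 <= t -> F t [set w | (S w <= t%:E)%E].
Variables W Z : R -> T -> R.
Hypotheses (nW : normal_martingale P F W) (nZ : normal_martingale P F Z).

Local Notation X := (switched S W Z).
Local Notation I := (post S Z).
Local Notation predT := (g_sigma_algebraType (predictable_rect F)).

Definition after_stop (s : R) (w : T) : R := ((S w <= s%:E)%E)%:R.

Hypothesis pu : predictable F after_stop.

Lemma switched_doleans : doleans_measure P X (time_product cF).
Proof.
split=> [A FA|s t A /andP[s0 st] FA]; have mA := cf_measurable cF FA.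
  exact: time_product0.
rewrite [LHS](time_product_rect cF st mA) integral_Ex_setI//.
  by rewrite (switched_var cF S0 stopS nW nZ).
apply: L2_sqr; apply: L2B; apply: (switched_L2 cF S0 stopS nW nZ) => //.
exact: le_trans st.
Qed.

(** The mesh is [1 / n.+1] and, with [n.+1 * n.+1] cells, the horizon is [n.+1]: one index both
    refines the grid and exhausts the time axis. *)
Definition grid (n i : nat) : R := i%:R / n.+1%:R.

Lemma grid_ge0 n i : 0 <= grid n i. Proof. by rewrite divr_ge0. Qed.

Lemma grid_le n i j : (i <= j)%N -> grid n i <= grid n j.
Proof. by move=> ij; rewrite ler_pM2r ?invr_gt0 ?ltr0Sn// ler_nat. Qed.

Lemma gridS n i : grid n i.+1 - grid n i = n.+1%:R^-1.
Proof. by rewrite /grid -mulrBl -natrB// subSnn mul1r. Qed.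

Lemma grid_last n : grid n (n.+1 * n.+1) = n.+1%:R.
Proof. by rewrite /grid natrM mulfK ?pnatr_eq0. Qed.

Let hstop (n i : nat) (w : T) : R := \1_(~` before S (grid n i)) w.

Let hF n i : F (grid n i) (~` before S (grid n i)).
Proof.
apply: sigma_algebraC; first exact: (cf_sigma cF).
by apply: (before_F cF) => //; exact: grid_ge0.
Qed.

Let h_meas n i : (i < n.+1 * n.+1)%N -> measurable_wrt (F (grid n i)) (hstop n i).
Proof. by move=> _; apply: measurable_wrt_indic; [exact: (cf_sigma cF)|exact: hF]. Qed.

Let h_bd n i : (i < n.+1 * n.+1)%N -> exists M : R, forall w, `|hstop n i w| <= M.
Proof. by move=> _; exists 1 => w; rewrite /hstop indicE ger0_norm// lern1; case: (_ \in _). Qed.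

(* [after_stop] sampled at the times [i / n.+1], up to time [n.+1]. *)
Definition sampled_stop (n : nat) : simple_process F :=
  @SimpleProcess _ T R F (n.+1 * n.+1) (grid n) (hstop n) (grid_ge0 n 0)
    (fun i _ => grid_le n (leqnSn i)) (@h_meas n) (@h_bd n).

Lemma sampled_stopE n (t : R) w : 0 < t -> t <= n.+1%:R ->
  exists i, [/\ (i < n.+1 * n.+1)%N, grid n i < t <= grid n i.+1 &
    simple_val (sampled_stop n) t w = hstop n i w].
Proof.
move=> t0 tn; have ex : exists i, t <= grid n i.+1.
  by exists (n.+1 * n.+1).-1; rewrite prednK ?muln_gt0// grid_last.
case: (ex_minnP ex) => i ti imin.
have iN : (i < n.+1 * n.+1)%N.
  rewrite -(@prednK (n.+1 * n.+1)) ?muln_gt0// ltnS; apply: imin.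
  by rewrite prednK ?muln_gt0// grid_last.
have it : grid n i < t.
  case: i ti imin iN => [|i] ti imin iN; first by rewrite /grid mul0r.
  by rewrite ltNge; apply/negP => /imin; rewrite ltnn.
exists i; split=> //; first by rewrite it.
rewrite /simple_val/= (bigD1 (Ordinal iN))//= it ti mulr1 big1 ?addr0// => j ji.
have [jt|] := boolP (grid n j < t <= grid n j.+1); last by rewrite mulr0.
have {}ji : j != i :> nat by apply: contra ji => /eqP ji; apply/eqP/val_inj.
exfalso; move: ji; rewrite neq_ltn => /orP[ji|ij]; have /andP[jt1 jt2] := jt.
  by move: it; rewrite ltNge (le_trans jt2)// grid_le.
by move: jt1; rewrite ltNge (le_trans ti)// grid_le.
Qed.

Lemma sampled_stop_measurable n :
  measurable_fun setT (fun z : predT => simple_val (sampled_stop n) z.1 z.2).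
Proof.
rewrite /simple_val/=.
rewrite (_ : (fun z => _) = (fun z : predT => \sum_(i < n.+1 * n.+1)
    \1_(`]grid n i, grid n i.+1] `*` (~` before S (grid n i)) : set predT) z)).
  apply: measurable_sum => i; apply: measurable_indic.
  apply: sub_sigma_algebra; right; exists (grid n i), (grid n i.+1), (~` before S (grid n i)).
  by rewrite grid_ge0 grid_le.
apply/funext => z; apply: eq_bigr => i _; rewrite /hstop !indicE -natrM mulnb.
congr (nat_of_bool _)%:R; apply/andP/idP.
  by rewrite !inE => -[? ?]; split.
by rewrite !inE => -[].
Qed.

(** The sampled process differs from [after_stop] only in the cell where [S] falls, and possibly at
    time 0. That region is covered by rectangles whose measures are step times hitting probability,
    and [sum_hit_le] bounds their sum by the mesh. *)
Lemma sampled_stop_cvg t : 0 <= t ->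
  (\int[time_product cF]_(z in (`[0%R, t] `*` setT : set predT))
     ((simple_val (sampled_stop n) z.1 z.2 - after_stop z.1 z.2) ^+ 2)%:E)%E
    @[n --> \oo] --> 0%E.
Proof.
move=> t0; have mD := predictable_domain_upto cF t0.
pose f n (z : predT) : R := (simple_val (sampled_stop n) z.1 z.2 - after_stop z.1 z.2) ^+ 2.
have mf n : measurable_fun (`[0, t] `*` setT : set predT) (f n).
  apply: measurable_funX; apply: measurable_funB.
    exact: measurable_funTS (sampled_stop_measurable n).
  apply: measurable_funS pu; first exact: (predictable_domain cF).
  by move=> -[s w] [/=]; rewrite !in_itv/= => /andP[-> _].
have bound n : t <= n.+1%:R ->
    (0 <= \int[time_product cF]_(z in (`[0%R, t] `*` setT : set predT)) (f n z)%:E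
      <= (n.+1%:R^-1)%:E)%E.
  move=> tn; apply/andP; split.
    by apply: integral_ge0 => z _; rewrite lee_fin sqr_ge0.
  pose C : set predT := (`[0, t] `*` setT) `&` [set z | f n z != 0].
  have mC : measurable C.
    rewrite (_ : C = (`[0, t] `*` setT) `&` f n @^-1` (~` [set 0])).
      by apply: mf => //; apply: measurableC; exact: measurable_set1.
    by apply/seteqP; split=> z [? /eqP ?]; split=> //; apply/eqP.
  have fval s w : 0 < s -> s <= t -> exists i, [/\ (i < n.+1 * n.+1)%N,
      grid n i < s <= grid n i.+1 & f n (s, w) = \1_(hit S (grid n i) s) w].
    move=> s0 st; have [i [iN is_ vE]] := sampled_stopE w s0 (le_trans st tn).
    exists i; split=> //; rewrite /f/= vE /hstop /after_stop !indicE in_setC.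
    have -> : (w \in hit S (grid n i) s) = (w \in before S (grid n i)) && (S w <= s%:E)%E.
      by rewrite in_setI; congr (_ && _); apply/idP/idP; rewrite inE.
    case: (boolP (w \in before S (grid n i))) => [_|]/=.
      by case: (_ <= _)%E => /=; ring.
    rewrite notin_setE /before/= => /negP; rewrite -leNgt => Sg.
    rewrite (le_trans Sg) ?lee_fin; first by move=> /=; ring.
    by have /andP[/ltW] := is_.
  have f01 z : (`[0, t] `*` setT : set predT) z -> f n z = \1_C z.
    move=> Dz; have f2 : f n z = 0 \/ f n z = 1.
      case: z Dz => s w [/=]; rewrite in_itv/= => /andP[s0 st] _.
      move: s0; rewrite le_eqVlt => /orP[/eqP s0|s0].
        have -> : f n (s, w) = ((S w <= s%:E)%E)%:R.
          rewrite /f/= /simple_val big1 => [|i _]; last first.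
            by rewrite -s0/= ltNge grid_ge0 mulr0.
          by rewrite sub0r sqrrN /after_stop; case: (_ <= _)%E; rewrite ?expr1n ?expr0n.
        by case: (_ <= _)%E; [right|left].
      have [i [_ _ ->]] := fval s w s0 st.
      by rewrite indicE; case: (_ \in _); [right|left].
    rewrite indicE; case: f2 => fz.
      by rewrite fz memNset//= => -[_] /=; rewrite fz eqxx.
    by rewrite fz mem_set//; split => //=; rewrite fz oner_eq0.
  rewrite (eq_integral (fun z => (\1_C z)%:E)); last first.
    by move=> z; rewrite inE => /f01 ->.
  rewrite integral_indic//.
  (* Time 0 needs its own piece: a simple process vanishes there, while [after_stop] is 1 where [S]
     is 0. The piece is null for Lebesgue measure. *)
  pose U k : set (R * T) := if k is i.+1 then `]grid n i, grid n i.+1] `*` hit S (grid n i) (grid n i.+1)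
    else [set 0] `*` setT.
  have mhit i : measurable (hit S (grid n i) (grid n i.+1)).
    apply: (cf_measurable cF (t := grid n i.+1)); apply: (hit_F cF) => //; first exact: grid_ge0.
    exact: grid_le.
  apply: (@le_trans _ _ (\sum_(k < (n.+1 * n.+1).+1) (lebesgue_measure \x P)%E (U k))%E).
    apply: (@content_subadditive _ _ _ (lebesgue_measure \x P)%E).
    - by move=> [|i] _; apply: measurableX.
    - by apply: (predictable_sub_product cF); exact: measurableI.
    - move=> -[s w] [[[/=]]]; rewrite in_itv/= => /andP[s0 st] _ fz _.
      rewrite -bigcup_mkord.
      move: s0; rewrite le_eqVlt => /orP[/eqP s0|s0]; first by exists 0%N => //=; rewrite -s0.
      have [i [iN is_ fE]] := fval s w s0 st; exists i.+1 => //=; split=> //=.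
      move: fz; rewrite fE indicE; case: (boolP (w \in _)); rewrite ?eqxx// inE => -[wb wh] _.
      split=> //=; apply: (le_trans wh); rewrite lee_fin; by have /andP[] := is_.
  rewrite big_ord_recl.
  rewrite [X in (X + _)%E](_ : _ = 0%E); last first.
    exact: (time_product0 cF measurableT).
  rewrite add0e (eq_bigr (fun i : 'I_(n.+1 * n.+1) =>
    ((grid n i.+1 - grid n i) * (stop_cdf P S (grid n i.+1) - stop_cdf P S (grid n i)))%:E)); last first.
    move=> i _; rewrite -(prob_hit cF stopS) ?grid_ge0 ?grid_le//.
    rewrite -(@time_product_rect _ _ _ _ _ cF) ?grid_le//; exact: mhit.
  rewrite sumEFin lee_fin.
  apply: (@sum_hit_le _ _ _ _ _ cF _ stopS _ (grid n)).
  - exact: grid_ge0.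
  - by move=> i _; rewrite grid_le//= -(gridS n i); lra.
  - by rewrite invr_ge0.
have t1 : \forall n \near \oo, t <= n.+1%:R.
  by near=> n; rewrite (@le_trans _ _ n%:R) ?ler_nat//; near: n; exact: nbhs_infty_ger.
apply: (@squeeze_cvge _ _ _ _ (fun=> 0%E) _ (fun n => (n.+1%:R^-1)%:E)).
- by near=> n; apply: bound; near: n.
- exact: cvg_cst.
- by apply: cvg_EFin; [exact: nearW|exact: cvg_harmonic].
Unshelve. all: by end_near. Qed.

(** Cut at [t], the grid is a partition of [0, t] followed by trivial intervals. On each interval
    the increments agree if [S] has already occurred and otherwise differ by [- overshoot S Z], so
    the error is minus the sum bounded in [overshootZ_sum]. *)
Lemma sampled_stop_integral n t : 0 <= t -> t <= n.+1%:R ->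
  Ex P (fun w => (simple_integral (sampled_stop n) X t w - I t w) ^+ 2) <= n.+1%:R^-1.
Proof.
move=> t0 tn; pose p i := Num.min (grid n i) t.
have p0 : 0 <= p 0%N by rewrite le_min grid_ge0 t0.
have p0E : p 0%N = 0 by rewrite /p /grid mul0r min_l.
have pN : p (n.+1 * n.+1)%N = t by rewrite /p grid_last min_r.
have dl0 : (0 : R) <= n.+1%:R^-1 by rewrite invr_ge0.
have pS i : (i < n.+1 * n.+1)%N -> p i <= p i.+1 <= p i + n.+1%:R^-1.
  move=> _; rewrite -(gridS n i) /p; have := grid_le n (leqnSn i).
  by case: (leP (grid n i) t); case: (leP (grid n i.+1) t) => *; apply/andP; split; lra.
have [VL Vv] := overshootZ_sum cF S0 stopS nZ p0 pS dl0.
apply: le_trans Vv; rewrite le_eqVlt; apply/orP; left; apply/eqP; apply: eq_Ex => w.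
rewrite -[RHS]sqrrN; congr (_ ^+ 2); rewrite -sumrN.
have -> : I t w = \sum_(i < n.+1 * n.+1) (I (p i.+1) w - I (p i) w).
  by rewrite (@telescope_ord R (fun i => I (p i) w)) pN p0E (post_0 S0) subr0.
rewrite /simple_integral/= -sumrB; apply: eq_bigr => i _; have iN := ltn_ord i.
have [pi0 pi1] := (part_ge0 p0 pS (ltnW iN), part_step pS iN).
rewrite -/(p i.+1) -/(p i) post_increment// switched_increment//.
rewrite /predictable_inc /before_inc /after_inc /overshoot_diff /overshoot /hstop.
have [git|tgi] := leP (grid n i) t.
  have -> : p i = grid n i by rewrite /p min_l.
  by rewrite !indicE in_setC; case: (_ \in _) => /=; ring.
have -> : p i = t by rewrite /p min_r// ltW.
have -> : p i.+1 = t.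
  by rewrite /p min_r// (le_trans (ltW tgi))// grid_le.
rewrite !min_timeE !indicE; case: (boolP (w \in before S t)).
  by rewrite inE /before/= ltNge => /negbTE ->; ring.
by move=> _ /=; ring.
Qed.

Lemma switched_stochastic_integral : stochastic_integral P F after_stop X I.
Proof.
split.
- exact: (post_adapted cF S0 stopS nZ).
- by apply: aeW => w; exact: (post_cadlag S0 nZ).
- exists (time_product cF), sampled_stop; split.
  + exact: switched_doleans.
  + exact: sampled_stop_cvg.
  + move=> t t0.
    have t1 : \forall n \near \oo, t <= n.+1%:R.
      by near=> n; rewrite (@le_trans _ _ n%:R) ?ler_nat//; near: n; exact: nbhs_infty_ger.
    have L n : L2 P (fun w => simple_integral (sampled_stop n) X t w - I t w).
      apply: L2B; last exact: (post_L2 cF S0 stopS nZ).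
      apply: (@L2_sum _ _ _ _ _ (fun i w => hstop n i w *
        (X (Num.min (grid n i.+1) t) w - X (Num.min (grid n i) t) w))) => i _.
      apply: L2_bool; first exact: (cf_measurable cF (hF n i)).
      by apply: L2B; apply: (switched_L2 cF S0 stopS nW nZ); rewrite le_min grid_ge0.
    apply: (@squeeze_cvge _ _ _ _ (fun=> 0%E) _ (fun n => (n.+1%:R^-1)%:E)).
    * near=> n; apply/andP; split; first by apply: integral_ge0 => w _; rewrite lee_fin sqr_ge0.
      rewrite ExE; last exact: L2_sqr.
      by rewrite lee_fin sampled_stop_integral//; near: n.
    * exact: cvg_cst.
    * by apply: cvg_EFin; [exact: nearW|exact: cvg_harmonic].
Unshelve. all: by end_near. Qed.

End integral.

(** * Solutions of the structure equation and indistinguishability *)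

Section structure_solutions.
Context {d : measure_display} {T : measurableType d} {R : realType}.
Variables (P : probability T R) (F : R -> set (set T)).
Hypothesis cF : complete_filtration P F.

Lemma switched_solution (S : T -> \bar R) (W Z : R -> T -> R) (C : R) :
  (forall w, (0 <= S w)%E) ->
  (forall t, 0 <= t -> F t [set w | (S w <= t%:E)%E]) ->
  predictable F (after_stop S) ->
  normal_martingale P F W -> normal_martingale P F Z -> 0 <= C ->
  (forall s t, 0 <= s -> s <= t -> L2 P (fun w => (W t w - W s w) ^+ 2)) ->
  (forall s t, 0 <= s -> s <= t ->
    Ex P (fun w => ((W t w - W s w) ^+ 2 - (t - s)) ^+ 2) <= C * (t - s) ^+ 2) ->
  (forall s t (G : T -> R), 0 <= s -> s <= t ->
    measurable_wrt (F s) G -> L2 P G ->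
    Ex P (fun w => G w * ((W t w - W s w) ^+ 2 - (t - s))) = 0) ->
  (forall w s t, 0 <= s -> s <= t -> 0 <= Z t w - Z s w + (t - s)) ->
  (forall s t, 0 <= s -> s <= t ->
    Ex P (fun w => `|(Z t w - Z s w) ^+ 2 - (Z t w - Z s w) - (t - s)|) <=
    4 * (t - s) ^+ 2) ->
  structure_solution P F (after_stop S) (switched S W Z).
Proof.
move=> S0 stopS pu nW nZ C0 W2 Wv Wm Znd Zs; split.
- exact: (switched_martingale cF S0 stopS nW nZ).
- by apply: aeW => w; exact: (switched_0 S0 Z nW).
- exists (bracket S Z), (post S Z); split.
  + exact: (switched_quadratic_variation cF S0 stopS nW nZ C0 W2 Wv Wm Znd Zs).
  + exact: (switched_stochastic_integral cF S0 stopS nW nZ pu).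
  + by apply: aeW => w t _.
Qed.

Lemma negligible_measurable N : P.-negligible N -> measurable N.
Proof.
by move=> PN; apply: (cf_measurable cF (t := 0)); exact: (cf_negligible cF).
Qed.

(** By completeness every subset of the exceptional set is measurable; this is how [C], itself
    arbitrary, inherits measurability from [A]. *)
Lemma ae_eq_prob (A C : set T) : {ae P, forall w, A w <-> C w} -> measurable A ->
  measurable C /\ P C = P A.
Proof.
move=> AC mA; set N := ~` [set w | A w <-> C w].
have nN D : D `<=` N -> measurable D by move=> DN; apply: negligible_measurable; exact: negligibleS AC.
have mC : measurable C.
  rewrite (_ : C = (A `&` ~` N) `|` (C `&` N)).
    apply: measurableU; last exact: nN.
    by apply: measurableI => //; apply: measurableC; exact: nN.
  apply/seteqP; split=> w /=.
    move=> Cw; have [Nw|nNw] := pselect (N w); [by right|left; split=> //].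
    by move: nNw => /contrapT/= AwCw; exact/AwCw.
  by move=> [[Aw /contrapT/= AwCw]|[]//]; exact/AwCw.
split=> //; rewrite -(setIT C) -(setIT A) -!integral_indic//.
apply: ae_eq_integral => //; do ?[by apply/measurable_EFinP; exact: measurable_indic].
apply: filterS AC => w ACw _; rewrite !indicE; congr (nat_of_bool _)%:R%:E.
by apply/idP/idP; rewrite !inE => /ACw.
Qed.

Section indistinguishable.
Variables (u : R -> T -> R) (X Y : R -> T -> R).
Hypothesis XY : {ae P, forall w, forall t, X t w = Y t w}.

Let XYt t : {ae P, forall w, X t w = Y t w}.
Proof. by apply: filterS XY => w ->. Qed.

Lemma indistinguishable_cadlag : cadlag_process P X -> cadlag_process P Y.
Proof.
move=> cX; apply: filterS2 XY cX => w XYw.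
by rewrite (_ : X ^~ w = Y ^~ w)//; apply/funext => t; exact: XYw.
Qed.

Lemma indistinguishable_adapted : adapted F X -> adapted F Y.
Proof.
move=> aX t t0; apply: (@measurable_wrt_ae_eq _ _ R _ (cf_sigma cF t) P _ _ (X t)).
- exact: (cf_negligible cF).
- exact: XYt.
- exact: aX.
Qed.

Lemma adapted_measurable (V : R -> T -> R) t : adapted F V -> 0 <= t ->
  measurable_fun setT (V t).
Proof.
move=> aV t0; apply: (measurable_wrt_measurable_fun (G := F t)); last exact: aV.
exact: (cf_measurable cF).
Qed.

Lemma indistinguishable_martingale : square_integrable_martingale P F X ->
  square_integrable_martingale P F Y.
Proof.
move=> [aX cX iX sX mX]; have aY := indistinguishable_adapted aX.
have mY t : 0 <= t -> measurable_fun setT (Y t) by exact: adapted_measurable.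
have mX' t : 0 <= t -> measurable_fun setT (X t) by exact: adapted_measurable.
split=> //.
- exact: indistinguishable_cadlag.
- move=> t t0; apply: L1_ae_eq (iX _ t0); first exact: XYt.
  exact: mY.
- move=> t t0; apply: (@L1_ae_eq _ _ _ _ (fun w => X t w ^+ 2)) (sX _ t0).
    by apply: filterS (XYt t) => w ->.
  by apply: measurable_funX; exact: mY.
- move=> s t A /andP[s0 st] FA; have mA := cf_measurable cF FA.
  have t0 := le_trans s0 st.
  have eqI r : 0 <= r -> (\int[P]_(w in A) (Y r w)%:E = \int[P]_(w in A) (X r w)%:E)%E.
    move=> r0; apply: ae_eq_integral => //; do ?[apply/measurable_EFinP; apply: measurable_funTS; auto].
    by apply: filterS (XYt r) => w ->.
  by rewrite !eqI// (mX s t)// s0.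
Qed.

(** For each subdivision the two deviation events differ by a null set, so the same mesh serves for
    [Y]. *)
Lemma indistinguishable_quadratic_variation Q : adapted F X ->
  quadratic_variation P F X Q -> quadratic_variation P F Y Q.
Proof.
move=> aX [aQ cQ ndQ lQ]; split=> // t e eta t0 e0 eta0.
have [dl dl0 H] := lQ t e eta t0 e0 eta0; exists dl => // n p p0 pn pS.
have p_ge0 i : (i <= n)%N -> 0 <= p i.
  elim: i => [|i IH] ni; first by rewrite p0.
  by rewrite (le_trans (IH (ltnW ni)))//; have /andP[] := pS i ni.
set A := [set w | (e <= `|\sum_(i < n) (X (p i.+1) w - X (p i) w) ^+ 2 - Q t w|)%R].
have mA : measurable A.
  rewrite -[A]setTI; apply: measurable_fun_le => //; apply: measurableT_comp => //.
  apply: measurable_funB; last exact: adapted_measurable.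
  apply: measurable_sum => i; apply: measurable_funX; have ni := ltn_ord i.
  by apply: measurable_funB; apply: adapted_measurable => //; apply: p_ge0 => //; exact: ltnW.
have [|mC ->] := @ae_eq_prob A
    [set w | (e <= `|\sum_(i < n) (Y (p i.+1) w - Y (p i) w) ^+ 2 - Q t w|)%R] _ mA.
  apply: filterS XY => w XYw; rewrite /A/=.
  by under eq_bigr do rewrite !XYw.
exact: H.
Qed.

Lemma sp_ge0 (H : simple_process F) i : (i <= sp_n H)%N -> 0 <= sp_t H i.
Proof.
elim: i => [|i IH] ni; first exact: sp_t0.
by rewrite (le_trans (IH (ltnW ni)))// sp_t_le.
Qed.

Lemma simple_integral_measurable (H : simple_process F) t (V : R -> T -> R) : 0 <= t ->
  adapted F V -> measurable_fun setT (simple_integral H V t).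
Proof.
move=> t0 aV; apply: measurable_sum => i; have ni := ltn_ord i.
apply: measurable_funM.
  apply: (measurable_wrt_measurable_fun (G := F (sp_t H i))); last exact: sp_h_meas.
  exact: (cf_measurable cF).
apply: measurable_funB; apply: adapted_measurable => //.
  by rewrite le_min t0 sp_ge0.
by rewrite le_min t0 sp_ge0// ltnW.
Qed.

(** The Doleans measure and the simple processes are kept, since the integrands involving the
    process change on a null set only. *)
Lemma indistinguishable_integral I : adapted F X ->
  stochastic_integral P F u X I -> stochastic_integral P F u Y I.
Proof.
move=> aX [aI cI [m [H [[dX0 dX] Hu HI]]]]; have aY := indistinguishable_adapted aX.
split=> //; exists m, H; split=> //.
  split=> // s t A /andP[s0 st] FA; have mA := cf_measurable cF FA.
  have t0 := le_trans s0 st.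
  rewrite dX ?s0//; apply: ae_eq_integral => //;
    do ?[apply/measurable_EFinP; apply: measurable_funTS; apply: measurable_funX;
         apply: measurable_funB; exact: adapted_measurable].
  by apply: filterS XY => w XYw _; rewrite !XYw.
move=> t t0; have := HI t t0; apply: cvg_trans; apply: near_eq_cvg; apply: nearW => n.
apply: ae_eq_integral => //.
- apply/measurable_EFinP; apply: measurable_funX; apply: measurable_funB.
    exact: simple_integral_measurable.
  exact: adapted_measurable.
- apply/measurable_EFinP; apply: measurable_funX; apply: measurable_funB.
    exact: simple_integral_measurable.
  exact: adapted_measurable.
apply: filterS XY => w XYw _; rewrite /simple_integral.
by under eq_bigr do rewrite !XYw.
Qed.

Lemma indistinguishable_solution :
  structure_solution P F u X -> structure_solution P F u Y.
Proof.
move=> [mX X0 [Q [I [qX iX QI]]]]; have aX := sqmart_adapted mX; split.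
- exact: indistinguishable_martingale.
- by apply: filterS2 XY X0 => w ->.
- exists Q, I; split=> //; first exact: indistinguishable_quadratic_variation.
  exact: indistinguishable_integral.
Qed.

End indistinguishable.
End structure_solutions.

(** * Independence in the Wiener-Poisson filtration *)

Section independence.
Context {d : measure_display} {T : measurableType d} {R : realType}.
Variable P : probability T R.

(** Both sides are finite measures in [A]; agreement on a generating pi-system makes them equal. *)
Lemma independent_pi_system (Pi : set (set T)) (H : set T) :
  setI_closed Pi -> Pi setT -> Pi `<=` measurable -> measurable H ->
  (forall A, Pi A -> P (A `&` H) = (P A * P H)%E) ->
  forall A, <<s Pi >> A -> P (A `&` H) = (P A * P H)%E.
Proof.
move=> PI PT mPi mH indep.
have PH0 : 0 <= fine (P H) by exact: fine_ge0.
have PHE : P H = (fine (P H))%:E by rewrite fineK// fin_num_measure.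
have sm A : <<s Pi >> A -> measurable A.
  by apply: smallest_sub; [exact: sigma_algebra_measurable|exact: mPi].
move=> A sA; transitivity (mrestr P mH A); first by [].
transitivity (mscale (NngNum PH0) P A); last first.
  by rewrite /mscale/= -PHE muleC.
apply: (@g_sigma_algebra_measure_unique _ _ _ Pi mPi (fun=> setT)) => //.
- by apply/seteqP; split=> w // _; exists 0%N.
- move=> C PC; transitivity (P (C `&` H)); first by [].
  rewrite indep// muleC [in LHS]PHE.
  by [].
- move=> _; apply: (@le_lt_trans _ _ (P (setT `&` H))); first by [].
  by rewrite setTI ltey_eq fin_num_measure.
Qed.

(* Transfer of independence to expectations, through Fubini for the joint law. *)
Lemma Ex_independent (G : set (set T)) (X Y : T -> R) :
  G `<=` measurable -> measurable_wrt G X -> measurable_fun setT Y ->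
  (forall A C, G A -> measurable C -> P (A `&` Y @^-1` C) = (P A * P (Y @^-1` C))%E) ->
  L1 P X -> L1 P Y -> L1 P (fun w => X w * Y w) ->
  Ex P (fun w => X w * Y w) = Ex P X * Ex P Y.
Proof.
move=> Gm GX mY indep X1 Y1 XY1.
have mX : measurable_fun setT X by exact: measurable_wrt_measurable_fun GX.
pose rX : {mfun T >-> R} := HB.pack X (isMeasurableFun.Build _ _ _ _ X mX).
pose rY : {mfun T >-> R} := HB.pack Y (isMeasurableFun.Build _ _ _ _ Y mY).
have mXY : measurable_fun setT (fun w => (X w, Y w)) by exact: measurable_fun_pair.
pose rXY : {mfun T >-> (R * R)%type} := HB.pack (fun w => (X w, Y w))
  (isMeasurableFun.Build _ _ _ _ (fun w => (X w, Y w)) mXY).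
have joint : forall C : set (R * R), measurable C ->
    (distribution P rX \x distribution P rY)%E C = distribution P rXY C.
  apply: product_measure_unique => A C mA mC.
  transitivity (P (X @^-1` A `&` Y @^-1` C)); first by [].
  by rewrite indep//; exact: GX.
pose f (z : R * R) : \bar R := (z.1 * z.2)%:E.
have mf : measurable_fun setT f.
  by apply/measurable_EFinP; apply: measurable_funM.
have intf : (distribution P rX \x distribution P rY)%E.-integrable setT f.
  apply/integrableP; split=> //.
  rewrite (eq_measure_integral (distribution P rXY)); last by move=> C mC _; exact: joint.
  rewrite ge0_integral_distribution//; last exact: measurableT_comp.
  by have /integrableP[_] := XY1.
have mE : measurable_fun setT (EFin : R -> \bar R).
  by apply/(@measurable_EFinP _ _ _ _ id); exact: measurable_id.
have iX : (distribution P rX).-integrable setT (EFin : R -> \bar R).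
  apply/integrableP; split; first exact: mE.
  rewrite ge0_integral_distribution//; last by apply: measurableT_comp => //; exact: mE.
  by have /integrableP[_] := X1.
have iY : (distribution P rY).-integrable setT (EFin : R -> \bar R).
  apply/integrableP; split; first exact: mE.
  rewrite ge0_integral_distribution//; last by apply: measurableT_comp => //; exact: mE.
  by have /integrableP[_] := Y1.
have EX : (\int[distribution P rX]_x x%:E = (Ex P X)%:E)%E.
  by rewrite integral_distribution//; exact: ExE.
have EY : (\int[distribution P rY]_x x%:E = (Ex P Y)%:E)%E.
  by rewrite integral_distribution//; exact: ExE.
apply: EFin_inj; rewrite -ExE//.
transitivity (\int[distribution P rXY]_z f z)%E.
  by rewrite integral_distribution.
rewrite -(eq_measure_integral _ (fun C mC _ => joint C mC)).
rewrite -integral12_prod_meas1//.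
transitivity (\int[distribution P rX]_x (x%:E * (Ex P Y)%:E))%E.
  apply: eq_integral => x _; rewrite -EY -integralZl//.
rewrite integralZr// EX EFinM//.
Qed.

End independence.

(** * Independence of a Poisson random measure over disjoint regions *)

Section poisson_independence.
Context {d : measure_display} {T : measurableType d} {R : realType}.
Variable P : probability T R.
Variables (mu : T -> {measure set (R * R) -> \bar R}) (nu : set R -> \bar R).
Hypothesis pm : poisson_random_measure P mu nu.

Lemma big_option_mule (Ix : finType) (f : option Ix -> \bar R) :
  (\prod_(o : option Ix) f o = f None * \prod_(i : Ix) f (Some i))%E.
Proof.
rewrite (bigD1 None)//=; congr (_ * _)%E.
rewrite (reindex_omap Some id)/=; last by case.
by apply: eq_bigl => i; rewrite eqxx.
Qed.

Lemma prm_indep_fin (Ix : finType) (A : Ix -> set (R * R)) (C : Ix -> set (\bar R)) :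
  (forall i, strip (A i)) -> trivIset setT A -> (forall i, measurable (C i)) ->
  P (\bigcap_(i in [set: Ix]) [set w | C i (mu w (A i))]) =
  (\prod_(i : Ix) P [set w | C i (mu w (A i))])%E.
Proof.
move=> sA tA mC.
have := @prm_indep _ _ _ _ _ _ pm #|Ix| (A \o enum_val) (C \o enum_val).
rewrite /= => /(_ (fun i => sA _)) H.
have tA' : trivIset setT (A \o (@enum_val Ix predT)).
  apply/trivIsetP => i j _ _ ij; move/trivIsetP : tA; apply => //.
  by apply: contra ij => /eqP/enum_val_inj ->.
have {}H := H tA' (fun i => mC _).
rewrite (reindex (@enum_val Ix predT)) /=; last exact: onW_bij (enum_val_bij _).
rewrite -H; congr (P _); apply/seteqP; split=> w Aw i _; first exact: Aw.
by have := Aw (enum_rank i) I; rewrite /= enum_rankK; exact.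
Qed.

Variable D : set (R * R).
Hypothesis sD : strip D.

(** Independence of [mu] is given for disjoint sets, while the generators of the filtration are
    values of [mu] on overlapping sets. Finite partitions of [D] reduce the latter to sums over
    disjoint cells. *)
Record measurable_partition (Ix : finType) (a : Ix -> set (R * R)) : Prop := {
  mp_measurable : forall i, measurable (a i) ;
  mp_disjoint : trivIset setT a ;
  mp_cover : \bigcup_(i in [set: Ix]) a i = D }.

Definition partition_gen (Ix : finType) (a : Ix -> set (R * R)) : set (set T) :=
  [set E | exists i (C : set (\bar R)), measurable C /\ E = [set w | C (mu w (a i))]].

Lemma mp_sub (Ix : finType) (a : Ix -> set (R * R)) i : measurable_partition a -> a i `<=` D.
Proof. by move=> ma; rewrite -(mp_cover ma); exact: bigcup_sup. Qed.

Lemma mp_strip (Ix : finType) (a : Ix -> set (R * R)) i : measurable_partition a -> strip (a i).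
Proof.
move=> ma; split; first exact: (mp_measurable ma).
by move=> z az; apply: (proj2 sD); exact: (mp_sub ma az).
Qed.

Lemma mu_strip_measurable A C : strip A -> measurable C -> measurable [set w | C (mu w A)].
Proof.
by move=> sA mC; have := prm_measurable pm sA measurableT mC; rewrite setTI.
Qed.

(** The pi-system consists of the events that prescribe a set of values on every cell. Adding [B] as
    one more disjoint cell, the [None] of an option type, gives the joint factorisation. *)
Lemma partition_independent (Ix : finType) (a : Ix -> set (R * R)) (B : set (R * R))
    (C0 : set (\bar R)) :
  measurable_partition a -> strip B -> B `&` D = set0 -> measurable C0 ->
  forall E, <<s partition_gen a >> E ->
  P (E `&` [set w | C0 (mu w B)]) = (P E * P [set w | C0 (mu w B)])%E.
Proof.
move=> ma sB BD mC0.
pose Pi : set (set T) := [set E | exists2 C : Ix -> set (\bar R), (forall i, measurable (C i)) &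
  E = \bigcap_(i in [set: Ix]) [set w | C i (mu w (a i))]].
have mPi : Pi `<=` measurable.
  move=> _ [C mC ->]; apply: fin_bigcap_measurable => //.
  by move=> i _; apply: mu_strip_measurable => //; exact: mp_strip.
pose A' (o : option Ix) := if o is Some i then a i else B.
have sA' o : strip (A' o) by case: o => [i|]//=; exact: mp_strip.
have tA' : trivIset setT A'.
  apply/trivIsetP => -[i|] [j|]//= _ _ ij.
  - by move/trivIsetP: (mp_disjoint ma); apply => //; apply: contra ij => /eqP ->.
  - by apply/seteqP; split=> // z [aiz Bz]; rewrite -BD; split=> //; exact: (mp_sub ma aiz).
  - by apply/seteqP; split=> // z [Bz aiz]; rewrite -BD; split=> //; exact: (mp_sub ma aiz).
have key (C : Ix -> set (\bar R)) (K : set (\bar R)) : (forall i, measurable (C i)) -> measurable K ->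
    P (\bigcap_(i in [set: Ix]) [set w | C i (mu w (a i))] `&` [set w | K (mu w B)]) =
    (P [set w | K (mu w B)] * \prod_(i : Ix) P [set w | C i (mu w (a i))])%E.
  move=> mC mK; pose C' (o : option Ix) := if o is Some i then C i else K.
  have := @prm_indep_fin _ A' C' sA' tA'; rewrite (@big_option_mule _ _)/=.
  move=> <-; last by case.
  congr (P _); apply/seteqP; split=> w.
    by move=> [aw Kw] [i|] _ //=; exact: aw.
  by move=> aw; split=> [i _|]; [exact: (aw (Some i))|exact: (aw None)].
move=> E sE; apply: (@independent_pi_system _ _ _ P Pi) => //.
- move=> _ _ [C mC ->] [C' mC' ->]; exists (fun i => C i `&` C' i).
    by move=> i; exact: measurableI.
  by rewrite -bigcapI.
- exists (fun=> setT) => //; by apply/seteqP; split.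
- exact: mu_strip_measurable.
- move=> _ [C mC ->]; rewrite key// muleC; congr (_ * _)%E.
  (* Imposing no constraint on [B] recovers the probability of the cylinder event alone. *)
  have := key C setT mC measurableT.
  by rewrite (_ : [set w | [set: \bar R] (mu w B)] = setT) ?setIT ?probability_setT ?mul1e.
- move: E sE; apply: sub_smallest2r; first exact: smallest_sigma_algebra.
  move=> _ [i [C [mC ->]]].
  exists (fun j => if j == i then C else setT); first by move=> j; case: ifP.
  apply/seteqP; split=> w /= Cw; last by have := Cw i I; rewrite eqxx.
  by move=> j _; case: eqP => [->|].
Qed.

(** Each coarse cell is the union of the fine cells it contains, so its measure is a finite sum of
    theirs. *)
Lemma refine_sub (Ix J : finType) (a : Ix -> set (R * R)) (c : J -> set (R * R)) :
  measurable_partition a -> measurable_partition c ->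
  (forall i j, c j `<=` a i \/ c j `&` a i = set0) ->
  <<s partition_gen a >> `<=` <<s partition_gen c >>.
Proof.
move=> ma mc sub; apply: smallest_sub; first exact: smallest_sigma_algebra.
move=> _ [i [C [mC ->]]].
pose U : Type := g_sigma_algebraType (partition_gen c).
have muaE w : mu w (a i) = (\sum_(j : J) (if `[< c j `<=` a i >] then mu w (c j) else 0))%E.
  have aiE : a i = \bigcup_(j in [set j | `[< c j `<=` a i >]]) c j.
    apply/seteqP; split=> z; last by move=> [j /= /asboolP]; exact.
    move=> aiz; have : D z by exact: (mp_sub ma aiz).
    rewrite -(mp_cover mc) => -[j _ cjz]; exists j => //=; apply/asboolP.
    by case: (sub i j) => // cai; exfalso; have : (c j `&` a i) z by []; rewrite cai.
  rewrite {1}aiE measure_fin_bigcup//.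
  - rewrite -big_mkcond/=; apply/esym.
    apply: (@bigfs _ _ _ _ (index_enum J) (fun j => `[< c j `<=` a i >])).
      exact: index_enum_uniq.
    by move=> j _; rewrite mem_index_enum.
  - exact: finite_finset.
  - by apply: sub_trivIset (mp_disjoint mc).
  - by move=> j _; exact: (mp_measurable mc).
have mf : measurable_fun setT (fun w : g_sigma_algebraType (partition_gen c) => mu w (a i)).
  rewrite (_ : (fun w => _) = fun w : g_sigma_algebraType (partition_gen c) =>
     (\sum_(j : J) (if `[< c j `<=` a i >] then mu w (c j) else 0))%E); last exact/funext.
  apply: emeasurable_sum => j; case: `[< c j `<=` a i >]; last exact: measurable_cst.
  move=> _ K mK; rewrite setTI; apply: sub_sigma_algebra; by exists j, K.
have := mf measurableT C mC; rewrite setTI; exact.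
Qed.

(** Events decided by some finite partition of [D] form a pi-system, because two partitions have a
    common refinement. The partition into [A] and its complement in [D] shows that every generator
    is among them. *)
Lemma mu_independent (DD : set (set (R * R))) (B : set (R * R)) (C0 : set (\bar R)) :
  (forall A, DD A -> measurable A /\ A `<=` D) ->
  strip B -> B `&` D = set0 -> measurable C0 ->
  forall E, <<s prm_gen mu DD >> E ->
  P (E `&` [set w | C0 (mu w B)]) = (P E * P [set w | C0 (mu w B)])%E.
Proof.
move=> DDD sB BD mC0.
pose Pi : set (set T) := [set E | exists (Ix : finType) (a : Ix -> set (R * R)),
  measurable_partition a /\ <<s partition_gen a >> E].
have mgen (Ix : finType) (a : Ix -> set (R * R)) : measurable_partition a ->
    <<s partition_gen a >> `<=` @measurable _ T.
  move=> ma; apply: smallest_sub; first exact: sigma_algebra_measurable.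
  by move=> _ [i [C [mC ->]]]; apply: mu_strip_measurable => //; exact: mp_strip.
move=> E sE; apply: (@independent_pi_system _ _ _ P Pi) => //.
- move=> E1 E2 [Ix [a [ma sa]]] [J [b [mb sb]]].
  pose c (ij : Ix * J) := a ij.1 `&` b ij.2.
  have mc : measurable_partition c.
    split.
    - by move=> [i j]; apply: measurableI; [exact: (mp_measurable ma)|exact: (mp_measurable mb)].
    - apply/trivIsetP => -[i j] [i' j'] _ _ ne; apply/seteqP; split=> // z [[/= az bz] [/= az' bz']].
      have [ii|ii] := eqVneq i i'.
        have [jj|jj] := eqVneq j j'; first by move: ne; rewrite ii jj eqxx.
        by move/trivIsetP: (mp_disjoint mb) => /(_ _ _ I I jj)/seteqP[/(_ z)+ _]; apply.
      by move/trivIsetP: (mp_disjoint ma) => /(_ _ _ I I ii)/seteqP[/(_ z)+ _]; apply.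
    - apply/seteqP; split=> z; first by move=> [[i j] _ [/= az _]]; exact: (mp_sub ma az).
      move=> Dz; have := Dz; rewrite -{1}(mp_cover ma) => -[i _ aiz].
      by move: Dz; rewrite -{1}(mp_cover mb) => -[j _ bjz]; exists (i, j).
  exists (Ix * J)%type, c; split=> //.
  apply: (sigma_algebraI (smallest_sigma_algebra setT (partition_gen c))).
    apply: (refine_sub ma mc) sa => i [i' j]; have [->|ii] := eqVneq i i'.
      by left=> z [].
    right; apply/seteqP; split=> // z [[/= az _] az'].
    by move/trivIsetP: (mp_disjoint ma) => /(_ _ _ I I ii)/seteqP[/(_ z)+ _]; apply.
  apply: (refine_sub mb mc) sb => j [i j']; have [->|jj] := eqVneq j j'.
    by left=> z [].
  right; apply/seteqP; split=> // z [[/= _ az] az'].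
  by move/trivIsetP: (mp_disjoint mb) => /(_ _ _ I I jj)/seteqP[/(_ z)+ _]; apply.
- exists unit, (fun=> D); split.
    split; first by move=> _; case: sD.
      by apply/trivIsetP => -[] [].
    by apply/seteqP; split=> z; [move=> []|exists tt].
  by apply: sigma_algebraT; exact: smallest_sigma_algebra.
- by move=> A [Ix [a [ma sa]]]; exact: mgen sa.
- exact: mu_strip_measurable.
- by move=> A [Ix [a [ma sa]]]; exact: (partition_independent ma).
- move: E sE; apply: sub_smallest2r; first exact: smallest_sigma_algebra.
  move=> _ [A [C [/DDD[mA AD] mC ->]]].
  pose a (b : bool) := if b then A else D `\` A.
  exists bool, a; split.
    split.
    - by move=> []//=; apply: measurableD => //; case: sD.
    - by apply/trivIsetP => -[] []//= _ _ _; rewrite ?setDIK// setIC setDIK.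
    - apply/seteqP; split=> z; first by move=> [[] _ /=]; [exact: AD|move=> []].
      by move=> Dz; have [Az|Az] := pselect (A z); [exists true|exists false].
  by apply: sub_sigma_algebra; exists true, C.
Qed.

End poisson_independence.

(** * Increments independent of the augmented past *)

Section wp_independence.
Context {d : measure_display} {T : measurableType d} {R : realType}.
Variable P : probability T R.
Variables (B : R -> T -> R) (mu : T -> {measure set (R * R) -> \bar R}).
Variable nu : set R -> \bar R.
Hypothesis HP : measure_is_complete P.
Hypothesis wp : wiener_poisson P B mu nu.

Local Notation F := (wp_filtration P B mu).
Let bmB : brownian_motion P B. Proof. by case: wp. Qed.
Let pmu : poisson_random_measure P mu nu. Proof. by case: wp. Qed.
Let sB_all := <<s \bigcup_(t in `[(0 : R), +oo[) brownian_gen B t >>.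
Let smu_all := <<s prm_gen mu strip >>.

Let B_mu_indep A C : sB_all A -> smu_all C -> P (A `&` C) = (P A * P C)%E.
Proof. by case: wp => _ _; exact. Qed.

Lemma strip_upto_strip (t : R) : strip_upto t `<=` strip.
Proof.
move=> A [mA At]; split=> // z /At[/=]; rewrite !in_itv/= => /andP[z0 _] ?.
by split=> //=; rewrite ?in_itv/= ?z0.
Qed.

Lemma strip_upto_domain (t : R) : strip (`[0, t] `*` [set x : R | x != 0]).
Proof.
apply: (@strip_upto_strip t); split=> //; apply: measurableX => //.
rewrite (_ : [set x | x != 0] = ~` [set 0]); first exact: measurableC.
by apply/seteqP; split=> x /eqP.
Qed.

Lemma brownian_gen_measurable t : brownian_gen B t `<=` measurable.
Proof.
move=> _ [s [A [/andP[s0 _] mA ->]]].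
by have := brownian_measurable bmB s0 measurableT mA; rewrite setTI.
Qed.

Lemma prm_gen_measurable (D : set (set (R * R))) : D `<=` strip ->
  prm_gen mu D `<=` measurable.
Proof. by move=> Ds _ [A [C [/Ds DA mC ->]]]; exact: (mu_strip_measurable pmu). Qed.

Lemma wp_complete_filtration : complete_filtration P F.
Proof.
split.
- by move=> t; exact: smallest_sigma_algebra.
- move=> s t st; apply: sub_smallest2r; first exact: smallest_sigma_algebra.
  move=> E [[sE|sE]|sE]; last by right.
    left; left; case: sE => r [A [/andP[r0 rs] mA ->]]; exists r, A.
    by rewrite r0 (le_trans rs).
  left; right; case: sE => A [C [[mA As] mC ->]]; exists A, C; split=> //; split=> //.
  move=> z /As[/=]; rewrite !in_itv/= => /andP[z0 zs] ?; split=> //=.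
  by rewrite ?in_itv/= z0 (le_trans zs).
- move=> t; apply: smallest_sub; first exact: sigma_algebra_measurable.
  move=> E [[]|]; [exact: brownian_gen_measurable|exact: (prm_gen_measurable (@strip_upto_strip t))|].
  by move=> NE; exact: HP NE.
- by move=> t E NE; apply: sub_sigma_algebra; right.
Qed.

Let cF := wp_complete_filtration.

Lemma brownian_sub_all t : 0 <= t -> <<s brownian_gen B t >> `<=` sB_all.
Proof.
move=> t0; apply: sub_smallest2r; first exact: smallest_sigma_algebra.
by move=> E BE; exists t => //=; rewrite in_itv/= t0.
Qed.

Lemma prm_sub_all (D : set (set (R * R))) : D `<=` strip -> <<s prm_gen mu D >> `<=` smu_all.
Proof.
move=> Ds; apply: sub_smallest2r; first exact: smallest_sigma_algebra.
by move=> _ [A [C [DA mC ->]]]; exists A, C; split=> //; exact: Ds.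
Qed.

Lemma sB_all_measurable : sB_all `<=` @measurable _ T.
Proof.
apply: smallest_sub; first exact: sigma_algebra_measurable.
by move=> E [t _]; exact: brownian_gen_measurable.
Qed.

Lemma smu_all_measurable : smu_all `<=` @measurable _ T.
Proof.
apply: smallest_sub; first exact: sigma_algebra_measurable.
exact: (@prm_gen_measurable strip).
Qed.

(** The pi-system is made of the intersections of a Brownian and a jump event, together with the
    negligible sets, for which both sides are 0; it generates [F t]. *)
Lemma wp_independent t (H : set T) : 0 <= t -> measurable H ->
  (forall A1 A2, <<s brownian_gen B t >> A1 -> <<s prm_gen mu (strip_upto t) >> A2 ->
     P (A1 `&` A2 `&` H) = (P (A1 `&` A2) * P H)%E) ->
  forall A, F t A -> P (A `&` H) = (P A * P H)%E.
Proof.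
move=> t0 mH indep.
pose Pi : set (set T) := [set E | P.-negligible E \/
  exists A1 A2, [/\ <<s brownian_gen B t >> A1, <<s prm_gen mu (strip_upto t) >> A2 &
    E = A1 `&` A2]].
have m1 A1 : <<s brownian_gen B t >> A1 -> measurable A1.
  by move=> /(brownian_sub_all t0); exact: sB_all_measurable.
have m2 A2 : <<s prm_gen mu (strip_upto t) >> A2 -> measurable A2.
  by move=> /(prm_sub_all (@strip_upto_strip t)); exact: smu_all_measurable.
have s1 := smallest_sigma_algebra setT (brownian_gen B t).
have s2 := smallest_sigma_algebra setT (prm_gen mu (strip_upto t)).
have T1 := sigma_algebraT s1; have T2 := sigma_algebraT s2.
move=> A FA; apply: (@independent_pi_system _ _ _ P Pi) => //.
- move=> E E' [NE|[A1 [A2 [A1s A2s ->]]]] PE'.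
    by left; apply: negligibleS NE; exact: subIsetl.
  case: PE' => [NE|[A1' [A2' [A1s' A2s' ->]]]].
    by left; apply: negligibleS NE; exact: subIsetr.
  right; exists (A1 `&` A1'), (A2 `&` A2'); split; [exact: (sigma_algebraI s1)|exact: (sigma_algebraI s2)|].
  by rewrite setIACA.
- by right; exists setT, setT; rewrite setIT.
- move=> E [/HP//|[A1 [A2 [A1s A2s ->]]]].
  by apply: measurableI; [exact: m1|exact: m2].
- move=> E [NE|[A1 [A2 [A1s A2s ->]]]]; last exact: indep.
  have mE : measurable E by exact: HP.
  rewrite (measure_negligible mE NE) mul0e; apply: measure_negligible; first exact: measurableI.
  by apply: negligibleS NE; exact: subIsetl.
- move: FA; apply: sub_smallest2r; first exact: smallest_sigma_algebra.
  move=> E [[sE|sE]|sE]; last by left.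
    right; exists E, setT; split=> //; [exact: sub_sigma_algebra|by rewrite setIT].
  right; exists setT, E; split=> //; [exact: sub_sigma_algebra|by rewrite setTI].
Qed.

Lemma brownian_increment_sB s t (C : set R) : 0 <= s -> 0 <= t -> measurable C ->
  sB_all ((fun w => B t w - B s w) @^-1` C).
Proof.
move=> s0 t0 mC.
pose U := g_sigma_algebraType (\bigcup_(t in `[(0 : R), +oo[) brownian_gen B t).
have mB r : 0 <= r -> measurable_fun setT (B r : U -> R).
  move=> r0 _ D mD; rewrite setTI; apply: sub_sigma_algebra; exists r => /=.
    by rewrite in_itv/= r0.
  by exists r, D; rewrite r0 lexx.
have := measurable_funB (mB _ t0) (mB _ s0) measurableT mC.
by rewrite setTI.
Qed.

(** The increment is grouped with [A1] in the Brownian sigma-algebra, which splits off [A2];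
    independence of increments then separates it from [A1]. *)
Lemma brownian_increment_indep s t A (C : set R) : 0 <= s < t -> F s A -> measurable C ->
  P (A `&` (fun w => B t w - B s w) @^-1` C) =
  (P A * P ((fun w => (B t w - B s w)%R) @^-1` C))%E.
Proof.
move=> /andP[s0 st] FA mC; have t0 := le_trans s0 (ltW st).
set H := _ @^-1` C; have sH : sB_all H by exact: brownian_increment_sB.
apply: (wp_independent s0 (sB_all_measurable sH)) FA => A1 A2 sA1 sA2.
have sA2' := prm_sub_all (@strip_upto_strip s) sA2.
have sA1' := brownian_sub_all s0 sA1.
rewrite setIAC B_mu_indep//; last first.
  by apply: (sigma_algebraI (smallest_sigma_algebra _ _)).
rewrite (B_mu_indep sA1' sA2') (@brownian_indep _ _ _ _ _ bmB s t)//; last by exists C.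
  by rewrite -!muleA (muleC (P A2)).
by rewrite s0.
Qed.

(** Here the new event is grouped with the jump event [A2], and disjointness of the regions
    separates the two. *)
Lemma mu_increment_indep s A (D : set (R * R)) (C : set (\bar R)) : 0 <= s ->
  strip D -> D `&` (`[0, s] `*` [set x : R | x != 0]) = set0 -> F s A -> measurable C ->
  P (A `&` [set w | C (mu w D)]) = (P A * P [set w | C (mu w D)])%E.
Proof.
move=> s0 sD D0 FA mC.
have sH : smu_all [set w | C (mu w D)] by apply: sub_sigma_algebra; exists D, C.
apply: (wp_independent s0 (smu_all_measurable sH)) FA => A1 A2 sA1 sA2.
have sA2' := prm_sub_all (@strip_upto_strip s) sA2.
have sA1' := brownian_sub_all s0 sA1.
rewrite -setIA B_mu_indep//; last first.
  by apply: (sigma_algebraI (smallest_sigma_algebra _ _)).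
rewrite (B_mu_indep sA1' sA2') (mu_independent pmu (strip_upto_domain s) _ sD D0 mC sA2) ?muleA//.
Qed.

End wp_independence.

(** * Moments of the normal and Poisson distributions *)

Section normal_moments.
Context {R : realType}.
Local Notation leb := (@lebesgue_measure R).
Variable s : R.
Hypothesis s0 : 0 < s.

Let sn0 : s != 0. Proof. by rewrite gt_eqF. Qed.

Lemma normal_pdf_even : normal_pdf 0 s =1 normal_pdf 0 s \o -%R.
Proof. by move=> x; rewrite normal_pdfE// /normal_fun/= !subr0 sqrrN. Qed.

(** The Radon-Nikodym derivative of the normal law and [normal_pdf] have the same integral over
    every measurable set, hence agree almost everywhere. *)
Lemma ge0_integral_normal_prob (f : R -> R) : measurable_fun setT f -> (forall x, 0 <= f x) ->
  (\int[normal_prob 0 s]_x (f x)%:E = \int[leb]_x (f x * normal_pdf 0 s x)%:E)%E.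
Proof.
move=> mf f0; have dom := @normal_prob_dominates R 0 s.
rewrite -(Radon_Nikodym_SigmaFinite.change_of_variables dom)//=; last exact/measurable_EFinP.
have iRN := Radon_Nikodym_SigmaFinite.f_integrable dom.
apply: ae_eq_integral => //.
- by apply: emeasurable_funM; [exact/measurable_EFinP|exact: (measurable_int leb iRN)].
- by apply/measurable_EFinP; apply: measurable_funM => //; exact: measurable_normal_pdf.
under [X in ae_eq _ _ _ X]eq_fun do rewrite EFinM.
apply: ae_eqe_mul2l.
apply: integral_ae_eq => //=.
- by apply/measurable_EFinP; exact: measurable_normal_pdf.
- by move=> E _ mE; rewrite -Radon_Nikodym_SigmaFinite.f_integral.
Qed.

Lemma normal_prob_gt_sym c : normal_prob 0 s `]-oo, (- c)] = normal_prob 0 s `[c, +oo[.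
Proof.
rewrite /normal_prob ge0_integration_by_substitutionNy.
- by apply: eq_integral => x _; congr (_%:E); exact/esym/normal_pdf_even.
- by apply: continuous_subspaceT; exact: continuous_normal_pdf.
- by move=> x _; exact: normal_pdf_ge0.
Qed.

Lemma integral_normal_funE : (\int[leb]_x (normal_fun 0 s x)%:E = (normal_peak s)^-1%:E)%E.
Proof.
have p0 : normal_peak s != 0 by rewrite gt_eqF// normal_peak_gt0.
have := integral_normal_pdf 0 s; rewrite normal_pdfE//.
under eq_integral do rewrite EFinM.
rewrite ge0_integralZl//; last 3 first.
- by apply/measurable_EFinP; exact: measurable_normal_fun.
- by move=> x _; rewrite lee_fin normal_fun_ge0.
- by rewrite lee_fin normal_peak_ge0.
move=> /(congr1 (fun x => (normal_peak s)^-1%:E * x)%E).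
by rewrite muleA -EFinM mulVf// mul1e mule1.
Qed.

Lemma normal_peakV : (normal_peak s)^-1 = s * Num.sqrt (pi *+ 2).
Proof. by rewrite /normal_peak invrK -mulrnAr sqrtrM ?sqr_ge0// sqrtr_sqr gtr0_norm. Qed.

End normal_moments.

Section normal_second_moment.
Context {R : realType}.
Local Notation leb := (@lebesgue_measure R).

Let c : R := Num.sqrt (pi *+ 2).
Let c0 : 0 < c. Proof. by rewrite sqrtr_gt0 mulrn_wgt0// pi_gt0. Qed.

Definition normal_moment (k : nat) (s : R) : \bar R :=
  (\int[normal_prob 0 s]_x (x ^+ k)%:E)%E.

Lemma normal_moment_density k s : 0 < s ->
  (normal_moment k.*2 s = (s * c)^-1%:E * \int[leb]_x (x ^+ k.*2 * normal_fun 0 s x)%:E)%E.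
Proof.
move=> s0; rewrite /normal_moment ge0_integral_normal_prob//; last first.
  by move=> x; rewrite exprn_even_ge0// odd_double.
rewrite normal_pdfE ?gt_eqF// -(normal_peakV s0) invrK -ge0_integralZl//; first last.
- by rewrite lee_fin normal_peak_ge0.
- by move=> x _; rewrite lee_fin mulr_ge0 ?normal_fun_ge0// exprn_even_ge0// odd_double.
- apply/measurable_EFinP; apply: measurable_funM; first exact: measurable_funX.
  exact: measurable_normal_fun.
by apply: eq_integral => x _; rewrite -EFinM mulrCA.
Qed.

(* [x^4 / (2 (4 s^2)^2) <= expR (x^2 / (4 s^2))], and the product of the latter
   with [normal_fun 0 s] is [normal_fun 0 (sqrt 2 * s)]. *)
Lemma normal_moment4_le s : 0 < s -> (normal_moment 4 s <= (64 * s ^+ 4)%:E)%E.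
Proof.
move=> s0; rewrite (@normal_moment_density 2)//.
pose r := Num.sqrt 2 * s; have q0 : 0 < Num.sqrt (2 : R) by rewrite sqrtr_gt0.
have r0 : 0 < r by rewrite mulr_gt0.
have r2 : r ^+ 2 = 2 * s ^+ 2 by rewrite exprMn sqr_sqrtr.
apply: (@le_trans _ _ ((s * c)^-1%:E * \int[leb]_x (32 * s ^+ 4 * normal_fun 0 r x)%:E))%E.
  rewrite lee_pmul2l//; last by rewrite lte_fin invr_gt0 mulr_gt0.
  apply: ge0_le_integral => //.
  - by move=> x _; rewrite lee_fin mulr_ge0 ?normal_fun_ge0// exprn_even_ge0.
  - apply/measurable_EFinP; apply: measurable_funM; first exact: measurable_funX.
    exact: measurable_normal_fun.
  - by apply/measurable_EFinP; apply: measurable_funM => //; exact: measurable_normal_fun.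
  - move=> x _; rewrite lee_fin /normal_fun !subr0 r2.
    pose y := x ^+ 2 / (4 * s ^+ 2).
    have y0 : 0 <= y by rewrite divr_ge0 ?sqr_ge0// mulr_ge0// sqr_ge0.
    have -> : - x ^+ 2 / (s ^+ 2 *+ 2) = - (y + y).
      by rewrite /y -mulr_natl; field; rewrite gt_eqF.
    have -> : - x ^+ 2 / ((2 * s ^+ 2) *+ 2) = - y.
      by rewrite /y -mulr_natl; field; rewrite gt_eqF.
    have -> : x ^+ 2.*2 = 16 * s ^+ 4 * y ^+ 2.
      by rewrite /y /=; field; rewrite gt_eqF.
    rewrite opprD expRD mulrA ler_wpM2r ?expR_ge0//.
    rewrite expRN ler_pdivrMr ?expR_gt0//.
    have := expR_ge1Dxn 1 y0; rewrite (_ : 2`! = 2)%N//; have : 0 < s ^+ 4 by rewrite exprn_gt0.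
    move=> s4 h; have h' : y ^+ 2 <= 2 * expR y by lra.
    have := ler_wpM2l (ltW s4) h'; lra.
under eq_integral do rewrite EFinM.
rewrite ge0_integralZl//; first last.
- by rewrite lee_fin mulr_ge0// exprn_ge0// ltW.
- by move=> x _; rewrite lee_fin normal_fun_ge0.
- by apply/measurable_EFinP; exact: measurable_normal_fun.
rewrite (integral_normal_funE r0) normal_peakV// -!EFinM lee_fin -/c.
have -> : (s * c)^-1 * (32 * s ^+ 4 * (r * c)) = 32 * s ^+ 4 * Num.sqrt 2.
  by rewrite /r; field; rewrite !gt_eqF.
have q2 : Num.sqrt (2 : R) <= 2.
  by rewrite -(@ler_pXn2r _ 2) ?nnegrE ?(ltW q0)// sqr_sqrtr//; lra.
have s4 : 0 < s ^+ 4 by rewrite exprn_gt0.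
have := ler_wpM2l (ltW s4) q2; lra.
Qed.

Lemma normal_moment2_fin s : 0 < s -> normal_moment 2 s \is a fin_num.
Proof.
move=> s0; have ge0 : (0 <= normal_moment 2 s)%E.
  by apply: integral_ge0 => x _; rewrite lee_fin sqr_ge0.
rewrite ge0_fin_numE//.
apply: (@le_lt_trans _ _ (\int[normal_prob 0 s]_x ((cst 1 x)%:E + (x ^+ 4)%:E))%E).
  apply: ge0_le_integral => //.
  - by move=> x _; rewrite lee_fin sqr_ge0.
  - by apply/measurable_EFinP; exact: measurable_funX.
  - by apply: emeasurable_funD; apply/measurable_EFinP => //; exact: measurable_funX.
  - move=> x _; rewrite -EFinD lee_fin /=.
    have -> : x ^+ 4 = (x ^+ 2) ^+ 2 by rewrite -exprM.
    by have := sqr_ge0 (x ^+ 2 - 1); have := sqr_ge0 (x ^+ 2); lra.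
rewrite ge0_integralD//=; last 2 first.
- by move=> x _; rewrite lee_fin exprn_even_ge0.
- by apply/measurable_EFinP; exact: measurable_funX.
rewrite integral_cst//= [X in (_ * X)%E](@probability_setT _ _ _ (normal_prob 0 s)) mule1.
by apply: lte_add_pinfty; [exact: ltry|exact: le_lt_trans (normal_moment4_le s0) (ltry _)].
Qed.

Let exponent_diff (x a b : R) : a != 0 -> b != 0 ->
  (b ^+ 2 - a ^+ 2) / (2 * a ^+ 2 * b ^+ 2) * x ^+ 2 =
  - x ^+ 2 / (2 * b ^+ 2) - - x ^+ 2 / (2 * a ^+ 2).
Proof.
move=> a0 b0; have [a20 b20] : a ^+ 2 != 0 /\ b ^+ 2 != 0 by rewrite !expf_eq0.
move: (a ^+ 2) (b ^+ 2) (x ^+ 2) a20 b20 => A B X A0 B0.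
by field; rewrite A0 B0.
Qed.

(** With [u] and [v] the exponents for [b] and [a], [D * x ^+ 2 = u - v], and the bounds are
    [expR z >= 1 + z] at [u - v] and at [v - u]. [D] is half of [a ^- 2 - b ^- 2]. *)
Lemma normal_fun_sandwich (a b x : R) : 0 < a -> a < b ->
  let D := (b ^+ 2 - a ^+ 2) / (2 * a ^+ 2 * b ^+ 2) in
  normal_fun 0 a x + D * (x ^+ 2 * normal_fun 0 a x) <= normal_fun 0 b x /\
  normal_fun 0 b x <= normal_fun 0 a x + D * (x ^+ 2 * normal_fun 0 b x).
Proof.
move=> a0 ab D; have b0 := lt_trans a0 ab; rewrite /normal_fun !subr0.
set u := - x ^+ 2 / (b ^+ 2 *+ 2); set v := - x ^+ 2 / (a ^+ 2 *+ 2).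
have uv : D * x ^+ 2 = u - v.
  rewrite /D /u /v -[b ^+ 2 *+ 2]mulr_natl -[a ^+ 2 *+ 2]mulr_natl.
  by rewrite exponent_diff ?gt_eqF.
clearbody u v D.
have hv : expR u = expR v * expR (u - v) by rewrite -expRD addrC subrK.
have hu : expR v = expR u * expR (v - u) by rewrite -expRD addrC subrK.
have h z : D * (x ^+ 2 * z) = (u - v) * z by rewrite mulrA uv.
rewrite !h; split.
  have := ler_wpM2l (expR_ge0 v) (expR_ge1Dx (u - v)); rewrite -hv; lra.
have := ler_wpM2l (expR_ge0 u) (expR_ge1Dx (v - u)); rewrite -hu; lra.
Qed.

(** A finite difference form of differentiating the normalising constant in the standard deviation.
    Integrating the sandwich gives [a + D * a * V a <= b] and [b <= a + D * b * V b], that is, [V a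
    <= 2 * a * b ^+ 2 / (a + b) <= b ^+ 2] and [V b >= 2 * a ^+ 2 * b / (a + b) >= a ^+ 2]. *)
Lemma normal_moment2_bounds (a b : R) : 0 < a -> a < b ->
  (normal_moment 2 a <= (b ^+ 2)%:E)%E /\ ((a ^+ 2)%:E <= normal_moment 2 b)%E.
Proof.
move=> a0 ab; have b0 := lt_trans a0 ab.
pose D := (b ^+ 2 - a ^+ 2) / (2 * a ^+ 2 * b ^+ 2).
have D0 : 0 < D.
  rewrite divr_gt0 ?mulr_gt0 ?exprn_gt0// subr_gt0 ltr_pXn2r// nnegrE ltW//.
pose V s := fine (normal_moment 2 s).
have VE s : 0 < s -> normal_moment 2 s = (V s)%:E by move=> s0; rewrite fineK// normal_moment2_fin.
have mN (s : R) : measurable_fun setT (fun x => (normal_fun 0 s x)%:E).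
  by apply/measurable_EFinP; exact: measurable_normal_fun.
have mXN (s : R) : measurable_fun setT (fun x : R => (x ^+ 2 * normal_fun 0 s x)%:E).
  by apply/measurable_EFinP; apply: measurable_funM; [exact: measurable_funX|exact: measurable_normal_fun].
have nX (s x : R) : (0 <= (x ^+ 2 * normal_fun 0 s x)%:E)%E by rewrite lee_fin mulr_ge0 ?sqr_ge0 ?normal_fun_ge0.
have AE s : 0 < s -> (\int[leb]_x (x ^+ 2 * normal_fun 0 s x)%:E = (s * c * V s)%:E)%E.
  move=> s0; have := @normal_moment_density 1 s s0; rewrite VE//= => e.
  by rewrite [RHS]EFinM e muleA -EFinM mulfV ?mul1e// gt_eqF// mulr_gt0.
have NE s : 0 < s -> (\int[leb]_x (normal_fun 0 s x)%:E = (s * c)%:E)%E.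
  by move=> s0; rewrite integral_normal_funE// normal_peakV.
have sumE s r : 0 < s -> 0 < r ->
    (\int[leb]_x ((normal_fun 0 s x)%:E + D%:E * (x ^+ 2 * normal_fun 0 r x)%:E) =
     (s * c + D * (r * c * V r))%:E)%E.
  move=> s0 r0; rewrite ge0_integralD//.
  - rewrite ge0_integralZl// ?lee_fin ?(ltW D0)//; last exact: mXN.
    transitivity ((s * c)%:E + D%:E * (r * c * V r)%:E)%E; last by [].
    by congr (_ + _ * _)%E; [exact: NE|exact: AE].
  - by move=> x _; rewrite lee_fin normal_fun_ge0.
  - exact: mN.
  - by move=> x _; rewrite mule_ge0// lee_fin ltW.
  - by apply: emeasurable_funM => //; exact: mXN.
have I1 : a * c + D * (a * c * V a) <= b * c.
  rewrite -lee_fin -sumE// -NE//; apply: ge0_le_integral => //.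
  - move=> x _; apply: adde_ge0; first by rewrite lee_fin normal_fun_ge0.
    by rewrite mule_ge0// lee_fin ltW.
  - by apply: emeasurable_funD; [exact: mN|apply: emeasurable_funM => //; exact: mXN].
  - exact: mN.
  - by move=> x _; rewrite -EFinM -EFinD lee_fin; have [] := normal_fun_sandwich x a0 ab.
have I2 : b * c <= a * c + D * (b * c * V b).
  rewrite -lee_fin -sumE// -NE//; apply: ge0_le_integral => //.
  - by move=> x _; rewrite lee_fin normal_fun_ge0.
  - exact: mN.
  - by apply: emeasurable_funD; [exact: mN|apply: emeasurable_funM => //; exact: mXN].
  - by move=> x _; rewrite -EFinM -EFinD lee_fin; have [] := normal_fun_sandwich x a0 ab.
rewrite !VE// !lee_fin.
have DE : D * (2 * a ^+ 2 * b ^+ 2) = (b - a) * (b + a).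
  by rewrite /D mulfVK ?subr_sqr// gt_eqF// mulr_gt0 ?mulr_gt0 ?exprn_gt0.
clearbody D V.
have J1 : D * a * V a <= b - a.
  by rewrite -(ler_pM2r c0); lra.
have J2 : b - a <= D * b * V b.
  by rewrite -(ler_pM2r c0); lra.
have ab0 : 0 < b - a by rewrite subr_gt0.
split.
- rewrite -(ler_pM2l (mulr_gt0 D0 a0)); apply: (le_trans J1).
  have : 2 * (D * a * b ^+ 2) * a = (b - a) * (b + a) by rewrite -DE; ring.
  by rewrite -(ler_pM2r a0); have := sqr_ge0 (b - a); lra.
- rewrite -(ler_pM2l (mulr_gt0 D0 b0)); apply: le_trans J2.
  have : 2 * (D * b * a ^+ 2) * b = (b - a) * (b + a) by rewrite -DE; ring.
  by rewrite -(ler_pM2r b0); have := sqr_ge0 (b - a); lra.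
Qed.

(** Were the moment different from [s ^+ 2], comparison with the normal law whose variance is the
    midpoint of the two would contradict one of the bounds. *)
Lemma normal_moment2 s : 0 < s -> normal_moment 2 s = (s ^+ 2)%:E.
Proof.
move=> s0; pose v := fine (normal_moment 2 s).
have vE : normal_moment 2 s = v%:E by rewrite fineK// normal_moment2_fin.
have s2 : 0 < s ^+ 2 by rewrite exprn_gt0.
rewrite vE; congr (_%:E); apply/eqP; rewrite eq_le !leNgt; apply/andP; split; apply/negP => h.
- pose b := Num.sqrt ((v + s ^+ 2) / 2).
  have b2 : b ^+ 2 = (v + s ^+ 2) / 2 by rewrite sqr_sqrtr//; lra.
  have sb : s < b by rewrite -(@ltr_pXn2r _ 2) ?nnegrE ?sqrtr_ge0 ?(ltW s0)// b2; lra.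
  by have [+ _] := normal_moment2_bounds s0 sb; rewrite vE lee_fin b2; lra.
- have v0 : 0 <= v by apply: fine_ge0; apply: integral_ge0 => x _; rewrite lee_fin sqr_ge0.
  pose a := Num.sqrt ((v + s ^+ 2) / 2).
  have a2 : a ^+ 2 = (v + s ^+ 2) / 2 by rewrite sqr_sqrtr//; lra.
  have a0 : 0 < a by rewrite sqrtr_gt0; lra.
  have sa : a < s by rewrite -(@ltr_pXn2r _ 2) ?nnegrE ?(ltW a0) ?(ltW s0)// a2; lra.
  by have [_] := normal_moment2_bounds a0 sa; rewrite vE lee_fin a2; lra.
Qed.

End normal_second_moment.

(** * Moments of a normal random variable *)

Section normal_variable.
Context {d : measure_display} {T : measurableType d} {R : realType}.
Variable P : probability T R.
Variables (Y : T -> R) (s : R).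
Hypothesis mY : measurable_fun setT Y.
Hypothesis s0 : 0 < s.
Hypothesis lawY : forall A : set R, measurable A -> P (Y @^-1` A) = normal_prob 0 s A.
Local Notation leb := (@lebesgue_measure R).

Lemma integral_normal_variable (f : R -> R) : measurable_fun setT f -> (forall x, 0 <= f x) ->
  (\int[P]_w (f (Y w))%:E = \int[normal_prob 0 s]_x (f x)%:E)%E.
Proof.
move=> mf f0.
pose U := measurableTypeR R.
pose rY : {mfun T >-> U} := HB.pack (Y : T -> U) (isMeasurableFun.Build _ _ T U Y mY).
transitivity (\int[distribution P rY]_x (f x)%:E)%E.
  rewrite ge0_integral_distribution//; exact/measurable_EFinP.
by apply: (@eq_measure_integral _ _ _ setT (normal_prob 0 s) (distribution P rY)) => A mA _; exact: lawY.
Qed.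

Lemma normal_variable_L2 : L2 P Y /\ L2 P (fun w => Y w ^+ 2).
Proof.
have Y4 : L1 P (fun w => (Y w ^+ 2) ^+ 2).
  apply/integrableP; split.
    by apply/measurable_EFinP; do 2 apply: measurable_funX.
  rewrite (_ : (\int[P]_w _ = normal_moment 4 s)%E).
    exact: le_lt_trans (normal_moment4_le s0) (ltry _).
  rewrite /normal_moment -integral_normal_variable//.
    by apply: eq_integral => w _ /=; rewrite -exprM ger0_norm// exprn_even_ge0.
  by move=> x; rewrite exprn_even_ge0.
have Y2 : L2 P (fun w => Y w ^+ 2) by split=> //; exact: measurable_funX.
by split=> //; split=> //; exact: L2_L1.
Qed.

Lemma normal_variable_var : Ex P (fun w => Y w ^+ 2) = s ^+ 2.
Proof.
have [_ Y2] := normal_variable_L2.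
apply: EFin_inj; rewrite -ExE; last exact: L2_L1.
rewrite (@integral_normal_variable (fun x => x ^+ 2))//.
  exact: normal_moment2.
by move=> x; exact: sqr_ge0.
Qed.

Lemma normal_variable_moment4 : Ex P (fun w => (Y w ^+ 2) ^+ 2) <= 64 * s ^+ 4.
Proof.
have [_ Y2] := normal_variable_L2.
rewrite -lee_fin -ExE; last exact: L2_sqr.
rewrite (@integral_normal_variable (fun x => (x ^+ 2) ^+ 2))//.
- rewrite (_ : (\int[_]_x _ = normal_moment 4 s)%E); first exact: normal_moment4_le.
  by apply: eq_integral => x _; rewrite -exprM.
- by do 2 apply: measurable_funX.
- by move=> x; exact: sqr_ge0.
Qed.

(** By evenness of the density the mean of the absolute value is twice that of the positive part;
    being also the sum of the means of both parts, it shows these to be equal. *)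
Lemma normal_variable_mean : Ex P Y = 0.
Proof.
have [Y2 _] := normal_variable_L2; have Y1 := L2_L1 Y2.
pose pos x : R := Num.max x 0; pose neg x : R := Num.max (- x) 0.
have mpos : measurable_fun setT pos by exact: measurable_maxr.
have mneg : measurable_fun setT neg by apply: measurable_maxr => //; exact: measurableT_comp.
have pos0 x : 0 <= pos x by rewrite le_max lexx orbT.
have neg0 x : 0 <= neg x by rewrite le_max lexx orbT.
have posneg x : `|x| = pos x + neg x.
  rewrite /pos /neg; have [x0|] := boolP (0 <= x); last rewrite -ltNge => x0.
    by rewrite ger0_norm// max_l// max_r ?addr0// oppr_le0.
  by rewrite ltr0_norm// max_r ?(ltW x0)// max_l ?add0r// oppr_ge0 ltW.
have Yposneg w : Y w = pos (Y w) - neg (Y w).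
  rewrite /pos /neg; have [x0|] := boolP (0 <= Y w); last rewrite -ltNge => x0.
    by rewrite max_l// max_r ?subr0// oppr_le0.
  by rewrite max_r ?(ltW x0)// max_l ?sub0r ?opprK// oppr_ge0 ltW.
have Lpos : L1 P (fun w => pos (Y w)).
  apply: (L1_le _ _ (L1_norm Y1)); first exact: measurableT_comp.
  by move=> w; rewrite ger0_norm// posneg lerDl.
have Lneg : L1 P (fun w => neg (Y w)).
  apply: (L1_le _ _ (L1_norm Y1)); first exact: measurableT_comp.
  by move=> w; rewrite ger0_norm// posneg lerDr.
have sym : (\int[P]_w (`|Y w|)%:E = 2%:E * \int[P]_w (pos (Y w))%:E)%E.
  have mn : measurable_fun setT (fun x : R => `|x|) by exact: normr_measurable.
  rewrite (@integral_normal_variable (fun x => `|x|))// (@integral_normal_variable pos)//.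
  rewrite !ge0_integral_normal_prob//.
  rewrite ge0_symfun_integralT.
  - congr (_ * _)%E; rewrite integral_mkcond; apply: eq_integral => x _.
    rewrite patchE; case: ifPn; rewrite ?inE ?notin_setE/=.
      by move=> x0; rewrite posneg /neg (@max_r _ _ (- x)) ?addr0// oppr_le0.
    by move=> /negP; rewrite -ltNge => x0; rewrite /pos max_r ?mul0r// ltW.
  - by move=> x; rewrite mulr_ge0// normal_pdf_ge0.
  - move=> x; apply: cvgM; first exact: norm_continuous.
    by apply: continuous_normal_pdf; rewrite gt_eqF.
  - by move=> x /=; rewrite normrN (normal_pdf_even s0 x).
have : Ex P (fun w => `|Y w|) = 2 * Ex P (fun w => pos (Y w)).
  by apply: EFin_inj; rewrite EFinM -!ExE//; exact: L1_norm.
rewrite (eq_Ex _ (fun w => posneg (Y w))) ExD// => e.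
by rewrite (eq_Ex _ Yposneg) ExB//; lra.
Qed.

End normal_variable.

Lemma nneseries_shift (R : realType) (f : nat -> \bar R) : (forall k, (0 <= f k)%E) ->
  (\sum_(k <oo) f k = f 0%N + \sum_(k <oo) f k.+1)%E.
Proof.
move=> f0; rewrite (@nneseries_recl R xpredT f)//; congr (_ + _)%E.
rewrite -(@nneseries_addn R f 1)//.
by apply: eq_eseriesr => k _; rewrite addn1.
Qed.

(** * Moments of a Poisson random variable *)

Section poisson_moments.
Context {d : measure_display} {T : measurableType d} {R : realType}.
Variable P : probability T R.
Variables (N : T -> \bar R) (l : R).
Hypothesis mN : measurable_fun setT N.
Hypothesis l0 : 0 <= l.
Hypothesis lawN : forall k : nat, P [set w | N w = (k%:R)%:E] = poisson_prob l k [set k].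

Definition poisson_weight (k : nat) : R := l ^+ k / k`!%:R * expR (- l).

Lemma poisson_weight_ge0 k : 0 <= poisson_weight k.
Proof. by rewrite mulr_ge0 ?expR_ge0// divr_ge0// exprn_ge0. Qed.

Lemma poisson_weight0 : l = 0 -> forall k, poisson_weight k = (k == 0%N)%:R.
Proof.
move=> l00 [|k]; rewrite /poisson_weight l00 oppr0 expR0.
  by rewrite expr0 fact0 divr1 mulr1.
by rewrite expr0n/= !mul0r.
Qed.

Lemma poisson_weightS k : k.+1%:R * poisson_weight k.+1 = l * poisson_weight k.
Proof.
have k1 : k.+1%:R != 0 :> R by rewrite pnatr_eq0.
have kf : k`!%:R != 0 :> R by rewrite pnatr_eq0 -lt0n fact_gt0.
rewrite /poisson_weight exprS factS natrM.
move: k1 kf; move: (k.+1%:R : R) (k`!%:R : R) => a b a0 b0.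
by field; rewrite a0 b0.
Qed.

(** The case [l = 0] is separate because [poisson_prob] is then a Dirac mass at 0. *)
Lemma poisson_point k : P [set w | N w = (k%:R)%:E] = (poisson_weight k)%:E.
Proof.
rewrite lawN /poisson_prob; move: l0; rewrite le_eqVlt => /orP[/eqP l00|lp].
  rewrite -l00 ltxx poisson_weight0// diracE; congr ((nat_of_bool _)%:R%:E).
  by apply/idP/eqP => [|->]; rewrite inE.
by rewrite lp esum_set1 ?lee_fin ?poisson_pmf_ge0// /poisson_pmf lp.
Qed.

Lemma sum_poisson_weight : (\sum_(k <oo) (poisson_weight k)%:E = 1)%E.
Proof.
move: l0; rewrite le_eqVlt => /orP[/eqP l00|lp].
  rewrite nneseries_shift; last by move=> k; rewrite lee_fin poisson_weight_ge0.
  rewrite eseries0 ?adde0//; last by move=> k _ _; rewrite poisson_weight0.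
  by rewrite poisson_weight0.
transitivity (poisson_prob l 0%N setT); last exact: (@probability_setT _ _ _ (poisson_prob l 0%N)).
rewrite /poisson_prob lp -nneseries_esumT; last by move=> k; rewrite lee_fin poisson_pmf_ge0.
by apply: eq_eseriesr => k _; rewrite /poisson_pmf lp.
Qed.

Let A k := [set w | N w = (k%:R)%:E].

Let mA k : measurable (A k).
Proof.
rewrite (_ : A k = N @^-1` [set (k%:R)%:E]) //.
by rewrite -[X in measurable X]setTI; apply: mN => //; exact: emeasurable_set1.
Qed.

Let tA : trivIset setT A.
Proof.
apply/trivIsetP => i j _ _ ij; apply/seteqP; split=> // w [Ai Aj].
have : (i%:R)%:E = (j%:R)%:E :> \bar R by rewrite -[LHS]Ai -[RHS]Aj.
by move=> -[] /eqP; rewrite eqr_nat (negbTE ij).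
Qed.

(** Only the point masses at the integers are known; they sum to 1, so none is left elsewhere, in
    particular at [+oo]. *)
Lemma poisson_integer : {ae P, forall w, exists k : nat, N w = (k%:R)%:E}.
Proof.
exists (~` \bigcup_k A k); split.
- by apply: measurableC; exact: bigcup_measurable.
- rewrite probability_setC; last exact: bigcup_measurable.
  rewrite measure_bigcup//=.
  rewrite (@eq_eseriesl _ _ xpredT); last by move=> k; rewrite in_setT.
  rewrite (eq_eseriesr (fun k _ => poisson_point k)) sum_poisson_weight subee//.
- by move=> w H [k _ Ak]; apply: H; exists k.
Qed.

Local Notation Y := (fun w => fine (N w)).

Let mY : measurable_fun setT Y.
Proof. exact: measurableT_comp mN. Qed.

Lemma integral_poisson (g : R -> R) : measurable_fun setT g -> (forall x, 0 <= g x) ->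
  (\int[P]_w (g (Y w))%:E = \sum_(k <oo) (g k%:R * poisson_weight k)%:E)%E.
Proof.
move=> mg g0.
have mgY : measurable_fun setT (fun w => (g (Y w))%:E).
  by apply/measurable_EFinP; exact: measurableT_comp.
have mU : measurable (\bigcup_k A k) by exact: bigcup_measurable.
transitivity (\int[P]_(w in \bigcup_k A k) (g (Y w))%:E)%E.
  rewrite [RHS]integral_mkcond; apply: ae_eq_integral => //.
    by apply/(measurable_restrict _ mU measurableT); rewrite ?setTI //; exact: measurable_funTS.
  apply: filterS poisson_integer => w [k Nk] _.
  by rewrite patchE mem_set//; exists k.
rewrite ge0_integral_bigcup//; last 2 first.
- by apply: measurable_funTS; exact: mgY.
- by move=> w _; rewrite lee_fin.
apply: eq_eseriesr => k _.
rewrite (eq_integral (fun=> (g k%:R)%:E)); last first.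
  by move=> w; rewrite inE => Ak; rewrite Ak.
by rewrite integral_cst// [X in (_ * X)%E](poisson_point k) EFinM.
Qed.

Lemma sum_poisson_weight1 : (\sum_(k <oo) (k%:R * poisson_weight k)%:E = l%:E)%E.
Proof.
rewrite nneseries_shift; last by move=> k; rewrite lee_fin mulr_ge0// poisson_weight_ge0.
rewrite mul0r add0e.
rewrite (eq_eseriesr (fun k _ => congr1 EFin (poisson_weightS k))).
under eq_eseriesr do rewrite EFinM.
rewrite nneseriesZl; last by move=> k _; rewrite lee_fin poisson_weight_ge0.
by rewrite sum_poisson_weight mule1.
Qed.

Lemma sum_poisson_weight2 :
  (\sum_(k <oo) (k%:R * (k%:R - 1) * poisson_weight k)%:E = (l ^+ 2)%:E)%E.
Proof.
have ge0 (k : nat) : 0 <= (k%:R * (k%:R - 1)) * poisson_weight k.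
  rewrite mulr_ge0 ?poisson_weight_ge0//; case: k => [|k]; first by rewrite mul0r.
  by rewrite mulr_ge0// subr_ge0 ler1n.
rewrite nneseries_shift; last by move=> k; rewrite lee_fin.
rewrite !mul0r add0e.
rewrite (eq_eseriesr (g := fun k => (l%:E * (k%:R * poisson_weight k)%:E)%E)).
  rewrite nneseriesZl; last by move=> k _; rewrite lee_fin mulr_ge0// poisson_weight_ge0.
  by rewrite sum_poisson_weight1 -EFinM expr2.
move=> k _; rewrite -EFinM; congr EFin.
rewrite mulrAC poisson_weightS -natr1 addrK; ring.
Qed.

Lemma poisson_variable_norm : L1 P Y /\ Ex P (fun w => `|Y w|) = l.
Proof.
have E : (\int[P]_w (`|Y w|)%:E = l%:E)%E.
  rewrite (@integral_poisson (fun x => `|x|))//.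
  rewrite -sum_poisson_weight1; apply: eq_eseriesr => k _.
  by rewrite ger0_norm.
have Y1 : L1 P Y.
  by apply/integrableP; split; [exact/measurable_EFinP|rewrite E ltry].
by split=> //; apply: EFin_inj; rewrite -ExE//; exact: L1_norm.
Qed.

Lemma poisson_variable_factorial :
  L1 P (fun w => Y w * (Y w - 1)) /\ Ex P (fun w => `|Y w * (Y w - 1)|) = l ^+ 2.
Proof.
have mg : measurable_fun setT (fun x : R => x * (x - 1)).
  by apply: measurable_funM => //; exact: measurable_funB.
have E : (\int[P]_w (`|Y w * (Y w - 1)|)%:E = (l ^+ 2)%:E)%E.
  rewrite (@integral_poisson (fun x => `|x * (x - 1)|))//; last exact: measurableT_comp.
  rewrite -sum_poisson_weight2; apply: eq_eseriesr => k _; congr (_ * _)%:E.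
  case: k => [|k]; first by rewrite mul0r normr0.
  by rewrite ger0_norm// mulr_ge0// subr_ge0 ler1n.
have Y1 : L1 P (fun w => Y w * (Y w - 1)).
  apply/integrableP; split; last by rewrite E ltry.
  by apply/measurable_EFinP; exact: (measurableT_comp mg).
by split=> //; apply: EFin_inj; rewrite -ExE//; exact: L1_norm.
Qed.

Lemma poisson_variable_ge0 : {ae P, forall w, `|Y w| = Y w}.
Proof. by apply: filterS poisson_integer => w [k ->]/=; rewrite ger0_norm. Qed.

Lemma poisson_variable_mean : Ex P Y = l.
Proof.
have [Y1 <-] := poisson_variable_norm; apply: Ex_ae_eq => //.
- by apply: filterS poisson_variable_ge0 => w ->.
- exact: measurableT_comp.
Qed.

Lemma poisson_variable_L2 : L2 P Y.
Proof.
have [Y1 _] := poisson_variable_norm; have [Y2 _] := poisson_variable_factorial.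
split=> //; rewrite (_ : (fun w => _) = fun w => Y w * (Y w - 1) + Y w); first exact: L1D.
by apply/funext => w; ring.
Qed.

Lemma poisson_variable_factorial_mean : Ex P (fun w => Y w * (Y w - 1)) = l ^+ 2.
Proof.
have [Y2 <-] := poisson_variable_factorial; apply: Ex_ae_eq.
- apply: filterS poisson_integer => w [k ->]/=; case: k => [|k]; first by rewrite mul0r normr0.
  by rewrite ger0_norm// mulr_ge0// subr_ge0 ler1n.
- exact: (L1_measurable Y2).
- by apply: measurableT_comp => //; exact: (L1_measurable Y2).
Qed.

Lemma centered_poisson_L2 : L2 P (fun w => Y w - l).
Proof. by apply: L2B; [exact: poisson_variable_L2|exact: L2_cst]. Qed.

Lemma centered_poisson_mean : Ex P (fun w => Y w - l) = 0.
Proof.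
have [Y1 _] := poisson_variable_norm.
by rewrite ExB ?Ex_cst ?poisson_variable_mean ?subrr//; exact: L1_cst.
Qed.

Lemma centered_poisson_var : Ex P (fun w => (Y w - l) ^+ 2) = l.
Proof.
have [Y1 _] := poisson_variable_norm; have [Y2 _] := poisson_variable_factorial.
rewrite (@eq_Ex _ _ _ P _ (fun w => (Y w * (Y w - 1) + (1 - 2 * l) * Y w) + l ^+ 2)); last first.
  by move=> w; ring.
rewrite ExD; [|by apply: L1D => //; exact: L1Z|exact: L1_cst].
rewrite ExD//; last exact: L1Z.
by rewrite ExZ// Ex_cst poisson_variable_mean poisson_variable_factorial_mean; ring.
Qed.

(** The integrand is the absolute value of [Y * (Y - 1) - 2 * l * Y + l ^+ 2], whose parts
    contribute at most [l ^+ 2], [2 * l ^+ 2] and [l ^+ 2]. *)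
Lemma centered_poisson_defect :
  Ex P (fun w => `|(Y w - l) ^+ 2 - (Y w - l) - l|) <= 4 * l ^+ 2.
Proof.
have [Y1 e1] := poisson_variable_norm; have [Y2 e2] := poisson_variable_factorial.
have E : Ex P (fun w => (`|Y w * (Y w - 1)| + 2 * l * `|Y w|) + l ^+ 2) = 4 * l ^+ 2.
  rewrite ExD ?Ex_cst; [|by apply: L1D; [exact: L1_norm|apply: L1Z; exact: L1_norm]|exact: L1_cst].
  rewrite ExD; [|exact: L1_norm|by apply: L1Z; exact: L1_norm].
  by rewrite ExZ ?e1 ?e2; [ring|exact: L1_norm].
rewrite -E; apply: Ex_le.
- apply: L1_norm; apply: L1B; last exact: L1_cst.
  by apply: L1B; [apply: L2_sqr|apply: L2_L1]; exact: centered_poisson_L2.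
- by apply: L1D; [apply: L1D; [exact: L1_norm|apply: L1Z; exact: L1_norm]|exact: L1_cst].
- move=> w; rewrite (_ : _ - _ - l = Y w * (Y w - 1) - 2 * l * Y w + l ^+ 2); last by ring.
  rewrite (le_trans (ler_normD _ _))// [`|l ^+ 2|]ger0_norm ?sqr_ge0// lerD2r.
  by rewrite (le_trans (ler_normB _ _))// lerD2l normrM ger0_norm// mulr_ge0.
Qed.

End poisson_moments.

(** * The rate of jumps of size at least 1 *)

Section intensity_of_jumps.
Context {R : realType}.
Local Notation leb := (@lebesgue_measure R).

(** The antiderivative is [- x^-1]. Mass exactly 1 makes [t] both the compensator of the count and
    the angle bracket of the compensated process. *)
Lemma inverse_square_levy_ge1 : inverse_square_levy `[(1 : R), +oo[ = 1%E.
Proof.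
transitivity (\int[leb]_(x in `[1%R, +oo[) (x ^- 2)%:E)%E.
  apply: eq_integral => x; rewrite inE/= in_itv/= andbT => x1.
  by rewrite (lt_le_trans ltr01 x1) mulr1.
have pos (x : R) : 1 <= x -> x != 0 by move=> x1; rewrite gt_eqF// (lt_le_trans ltr01).
rewrite (@ge0_continuous_FTC2y _ _ (fun x => - x^-1) 1 0).
- by rewrite -EFinN -EFinD invr1 opprK add0r.
- by move=> x x1; rewrite invr_ge0 sqr_ge0.
- apply: continuous_in_subspaceT => x; rewrite inE/= in_itv/= andbT => x1.
  by apply: cvgV; [rewrite expf_neq0// pos|exact: exprn_continuous].
- rewrite -[X in _ --> X]oppr0; apply: cvgN.
  by apply/gtr0_cvgV0; [near=> x; near: x; exact: nbhs_pinfty_gt|exact: cvg_id].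
- by move=> x x1; apply: derivableN; apply: derivableV => //; apply: pos; exact: ltW.
- apply: cvg_at_right_filter; apply: cvgN; apply: cvgV; last exact: cvg_id.
  exact: pos.
- move=> x; rewrite in_itv/= andbT => x1.
  have xn := pos _ (ltW x1).
  rewrite derive1E deriveN; last exact: derivableV.
  by rewrite deriveV// derive_id /GRing.scale/= mulr1 opprK.
Unshelve. all: by end_near. Qed.

Lemma intensity_strip (J : set R) : measurable J -> J `<=` `[0, +oo[ ->
  intensity (@inverse_square_levy R) (J `*` `[1, +oo[) = leb J.
Proof.
move=> mJ J0; rewrite /intensity.
transitivity (\int[leb]_(t in `[0%R, +oo[) (\1_J t)%:E)%E.
  apply: eq_integral => t _; rewrite indicE; have [tJ|tJ] := boolP (t \in J).
    by rewrite in_xsectionX// inverse_square_levy_ge1.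
  by rewrite notin_xsectionX// /inverse_square_levy integral_set0.
by rewrite integral_indic// setIidl.
Qed.

End intensity_of_jumps.

(** * The Brownian motion and the compensated Poisson process *)

Section independent_increments.
Context {d : measure_display} {T : measurableType d} {R : realType}.
Variables (P : probability T R) (F : R -> set (set T)).
Hypothesis cF : complete_filtration P F.
Variables (M : R -> T -> R) (D : R -> R -> T -> R).
Hypothesis aM : adapted F M.
Hypothesis M0 : forall w, M 0 w = 0.
Hypothesis cM : forall w, cadlag (M ^~ w).
Hypothesis MD : forall s t, 0 <= s -> s < t -> {ae P, forall w, M t w - M s w = D s t w}.
Hypothesis D_indep : forall s t A (C : set R), 0 <= s -> s < t -> F s A -> measurable C ->
  P (A `&` D s t @^-1` C) = (P A * P (D s t @^-1` C))%E.
Hypothesis D_L2 : forall s t, 0 <= s -> s < t -> L2 P (D s t).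
Hypothesis D_mean : forall s t, 0 <= s -> s < t -> Ex P (D s t) = 0.
Hypothesis D_var : forall s t, 0 <= s -> s < t -> Ex P (fun w => D s t w ^+ 2) = t - s.

Let mM t : 0 <= t -> measurable_fun setT (M t).
Proof. exact: (adapted_measurable cF). Qed.

(** Independence of the past is known for [D], path properties for [M]; they agree almost surely at
    fixed times, which is enough under an expectation. *)
Lemma Ex_increment_independent (phi : R -> R) (G : T -> R) s t : 0 <= s -> s < t ->
  measurable_fun setT phi -> measurable_wrt (F s) G -> L2 P G ->
  L2 P (fun w => phi (D s t w)) ->
  Ex P (fun w => G w * phi (M t w - M s w)) = Ex P G * Ex P (fun w => phi (D s t w)).
Proof.
move=> s0 st mphi FG G2 pD2; have t0 := le_trans s0 (ltW st).
transitivity (Ex P (fun w => G w * phi (D s t w))).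
  apply: Ex_ae_eq.
  - by apply: filterS (MD s0 st) => w ->.
  - apply: measurable_funM; first exact: (L2_measurable G2).
    by apply: measurableT_comp => //; apply: measurable_funB; exact: mM.
  - by apply: measurable_funM; [exact: (L2_measurable G2)|exact: (L2_measurable pD2)].
apply: (@Ex_independent _ _ _ P (F s)) => //.
- exact: (cf_measurable cF).
- exact: (L2_measurable pD2).
- move=> A C FA mC; rewrite (_ : _ @^-1` C = D s t @^-1` (phi @^-1` C))//.
  by apply: D_indep => //; rewrite -[X in measurable X]setTI; exact: mphi.
- exact: L2_L1.
- exact: L2_L1.
- exact: L2M.
Qed.

Lemma increment_L2 s t : 0 <= s -> s <= t -> L2 P (fun w => M t w - M s w).
Proof.
move=> s0; rewrite le_eqVlt => /orP[/eqP <-|st].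
  by under [X in L2 _ X]eq_fun do rewrite subrr; exact: L2_cst.
have t0 := le_trans s0 (ltW st).
have mD : measurable_fun setT (fun w => M t w - M s w) by apply: measurable_funB; exact: mM.
split=> //; apply: (@L1_ae_eq _ _ _ _ (fun w => D s t w ^+ 2)).
- by apply: filterS (MD s0 st) => w ->.
- exact: measurable_funX.
- exact: L2_sqr (D_L2 s0 st).
Qed.

Lemma independent_increments_martingale : normal_martingale P F M.
Proof.
split=> //.
- move=> t t0; have := increment_L2 (lexx 0) t0.
  by under [X in L2 _ X -> _]eq_fun do rewrite M0 subr0.
- move=> s t G /andP[s0]; rewrite le_eqVlt => /orP[/eqP <-|st] FG G2.
    by rewrite -[RHS](Ex_cst P); apply: eq_Ex => w; rewrite subrr mulr0.
  rewrite (@Ex_increment_independent id)//; last exact: D_L2.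
  by rewrite D_mean// mulr0.
- move=> s t A /andP[s0 st] FA; have mA := cf_measurable cF FA.
  move: st; rewrite le_eqVlt => /orP[/eqP <-|st].
    by rewrite subrr mul0r -[RHS](Ex_cst P); apply: eq_Ex => w; rewrite subrr expr0n mulr0.
  have t0 := le_trans s0 (ltW st).
  transitivity (Ex P (fun w => \1_A w * D s t w ^+ 2)).
    apply: Ex_ae_eq.
    - by apply: filterS (MD s0 st) => w ->.
    - apply: measurable_funM => //; apply: measurable_funX.
      by apply: measurable_funB; exact: mM.
    - apply: measurable_funM => //; apply: measurable_funX.
      by apply: L2_measurable; exact: D_L2.
  rewrite (@Ex_independent _ _ _ P (F s) (\1_A) (fun w => D s t w ^+ 2)).
  + by rewrite D_var// Ex_indic// mulrC.
  + exact: (cf_measurable cF).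
  + by apply: measurable_wrt_indic => //; exact: (cf_sigma cF).
  + by apply: measurable_funX; apply: L2_measurable; exact: D_L2.
  + move=> C K FC mK; rewrite (_ : _ @^-1` K = D s t @^-1` ((fun x => x ^+ 2) @^-1` K))//.
    apply: D_indep => //; rewrite -[X in measurable X]setTI.
    by apply: (measurable_funX 2 (@measurable_id _ _ setT)).
  + exact: L1_indic.
  + exact: L2_sqr (D_L2 s0 st).
  + by apply: L1_bool => //; exact: L2_sqr (D_L2 s0 st).
Qed.

Section fourth_moment.
Hypothesis D2_L2 : forall s t, 0 <= s -> s < t -> L2 P (fun w => D s t w ^+ 2).
Variable C : R.
Hypothesis C0 : 0 <= C.
Hypothesis D4 : forall s t, 0 <= s -> s < t ->
  Ex P (fun w => (D s t w ^+ 2) ^+ 2) <= C * (t - s) ^+ 2.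

Lemma increment_sqr_L2 s t : 0 <= s -> s <= t -> L2 P (fun w => (M t w - M s w) ^+ 2).
Proof.
move=> s0; rewrite le_eqVlt => /orP[/eqP <-|st].
  by under [X in L2 _ X]eq_fun do rewrite subrr expr0n; exact: L2_cst.
have t0 := le_trans s0 (ltW st).
have mD : measurable_fun setT (fun w => M t w - M s w) by apply: measurable_funB; exact: mM.
split; first exact: measurable_funX.
apply: (@L1_ae_eq _ _ _ _ (fun w => (D s t w ^+ 2) ^+ 2)).
- by apply: filterS (MD s0 st) => w ->.
- by do 2 apply: measurable_funX.
- exact: L2_sqr (D2_L2 s0 st).
Qed.

(** Expanding the square leaves the fourth moment minus [(t - s) ^+ 2]. *)
Lemma increment_sqr_var s t : 0 <= s -> s <= t ->
  Ex P (fun w => ((M t w - M s w) ^+ 2 - (t - s)) ^+ 2) <= C * (t - s) ^+ 2.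
Proof.
move=> s0; rewrite le_eqVlt => /orP[/eqP <-|st].
  rewrite (@eq_Ex _ _ _ P _ (fun=> 0)) ?Ex_cst ?subrr ?expr0n ?mulr0//.
  by move=> w; rewrite !subrr !expr0n subrr expr0n.
have t0 := le_trans s0 (ltW st); have D2 := D2_L2 s0 st.
rewrite (@Ex_ae_eq _ _ _ P _ (fun w => (D s t w ^+ 2 - (t - s)) ^+ 2)); first last.
- by apply: measurable_funX; apply: measurable_funB => //; exact: (L2_measurable D2).
- apply: measurable_funX; apply: measurable_funB => //; apply: measurable_funX.
  by apply: measurable_funB; exact: mM.
- by apply: filterS (MD s0 st) => w ->.
rewrite (@eq_Ex _ _ _ P _ (fun w => ((D s t w ^+ 2) ^+ 2 + (- (2 * (t - s))) * D s t w ^+ 2)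
  + (t - s) ^+ 2)); last by move=> w; ring.
rewrite ExD ?Ex_cst; [|by apply: L1D; [exact: L2_sqr|apply: L1Z; exact: L2_L1]|exact: L1_cst].
rewrite ExD ?ExZ ?D_var//; [|exact: L2_L1|exact: L2_sqr|by apply: L1Z; exact: L2_L1].
by have := D4 s0 st; have := sqr_ge0 (t - s); lra.
Qed.

Lemma increment_sqr_mean s t (G : T -> R) : 0 <= s -> s <= t ->
  measurable_wrt (F s) G -> L2 P G ->
  Ex P (fun w => G w * ((M t w - M s w) ^+ 2 - (t - s))) = 0.
Proof.
move=> s0; rewrite le_eqVlt => /orP[/eqP <-|st] FG G2.
  by rewrite -[RHS](Ex_cst P); apply: eq_Ex => w; rewrite !subrr expr0n subrr mulr0.
have D2 := D2_L2 s0 st.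
rewrite (@Ex_increment_independent (fun x => x ^+ 2 - (t - s)))//.
- by rewrite ExB ?Ex_cst ?D_var ?subrr ?mulr0//; [exact: L2_L1|exact: L1_cst].
- by apply: measurable_funB => //; exact: measurable_funX.
- by apply: L2B => //; exact: L2_cst.
Qed.

End fourth_moment.
End independent_increments.

(** * Paths of the counting process *)

Section counting_paths.
Context {R : realType}.
Variable m : {measure set (R * R) -> \bar R}.

Definition jumps (t : R) : set (R * R) := `[0, t] `*` `[1, +oo[.
Definition jumps_in (s t : R) : set (R * R) := `]s, t] `*` `[1, +oo[.

Lemma jumps_measurable t : measurable (jumps t). Proof. exact: measurableX. Qed.
Lemma jumps_in_measurable s t : measurable (jumps_in s t). Proof. exact: measurableX. Qed.

Lemma jumps_le s t : s <= t -> jumps s `<=` jumps t.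
Proof.
move=> st [x y] [/=]; rewrite !in_itv/= => /andP[x0 xs] y1; split=> //=.
by rewrite in_itv/= x0 (le_trans xs).
Qed.

Hypothesis mfin : forall n : nat, (m (jumps n%:R) < +oo)%E.

Lemma jumps_fin t : (m (jumps t) < +oo)%E.
Proof.
apply: le_lt_trans (mfin (Num.truncn t).+1).
apply: le_measure; rewrite ?inE; [exact: jumps_measurable|exact: jumps_measurable|].
by apply: jumps_le; rewrite ltW// truncnS_gt.
Qed.

Lemma jumps_fin_num t : m (jumps t) \is a fin_num.
Proof. by rewrite ge0_fin_numE// jumps_fin. Qed.

Definition count (t : R) : R := fine (m (jumps t)).

Lemma jumps_split s t : 0 <= s -> s <= t -> m (jumps t) = (m (jumps s) + m (jumps_in s t))%E.
Proof.
move=> s0 st; rewrite -measureU.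
- congr (m _); apply/seteqP; split=> -[x y]; rewrite /jumps /jumps_in /=.
    rewrite !in_itv/= => -[/andP[x0 xt] y1].
    by have [xs|sx] := leP x s; [left|right]; rewrite ?x0 ?xs ?sx.
  rewrite !in_itv/= => -[[/andP[x0 xs] y1]|[/andP[sx xt] y1]]; split=> //.
    by rewrite x0 (le_trans xs).
  by rewrite xt (le_trans s0 (ltW sx)).
- exact: jumps_measurable.
- exact: jumps_in_measurable.
- apply/seteqP; split=> // -[x y] [[/= + _] [/= + _]].
  by rewrite !in_itv/= => /andP[_ xs] /andP[sx _]; move: sx; rewrite ltNge xs.
Qed.

Lemma jumps_in_fin s t : 0 <= s -> s <= t -> m (jumps_in s t) \is a fin_num.
Proof.
move=> s0 st; have := jumps_fin_num t; rewrite (jumps_split s0 st).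
by rewrite fin_numD => /andP[].
Qed.

Lemma count_diff s t : 0 <= s -> s <= t -> count t - count s = fine (m (jumps_in s t)).
Proof.
move=> s0 st; rewrite /count (jumps_split s0 st) fineD ?jumps_fin_num ?jumps_in_fin//.
by rewrite addrC addKr.
Qed.

Lemma count_nondecreasing s t : 0 <= s -> s <= t -> count s <= count t.
Proof. by move=> s0 st; rewrite -subr_ge0 count_diff// fine_ge0. Qed.

(** Right continuity is continuity from above of the finite measure along [t + 1 / n.+1], extended
    from this sequence to all times by monotonicity. Left limits exist because the count is monotone
    and bounded by its value at [t]. *)
Lemma count_cadlag : cadlag count.
Proof.
split=> t t0.
- have cv : m (jumps (t + n.+1%:R^-1)) @[n --> \oo] --> m (jumps t).
    have -> : jumps t = \bigcap_n jumps (t + n.+1%:R^-1).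
      apply/seteqP; split=> [z tz n _|[x y] H].
        by apply: jumps_le tz; rewrite lerDl invr_ge0.
      have [/=+ y1] := H 0%N Logic.I; rewrite in_itv/= => /andP[x0 _].
      split=> //=; rewrite in_itv/= x0/=; apply: (@le_inv_nat _ _ _ 1) => // n.
      by have [/=+ _] := H n Logic.I; rewrite in_itv/= mul1r => /andP[].
    apply: (@nonincreasing_cvg_mu _ _ _ m (fun n => jumps (t + n.+1%:R^-1))).
    + exact: jumps_fin.
    + by move=> n; exact: jumps_measurable.
    + by apply: bigcapT_measurable => n; exact: jumps_measurable.
    + move=> i j ij; apply/subsetPset; apply: jumps_le.
      by rewrite lerD2l lef_pV2 ?posrE// ler_nat.
  have {}cv : count (t + n.+1%:R^-1) @[n --> \oo] --> count t.
    by apply: fine_cvg; rewrite fineK ?jumps_fin_num.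
  apply/cvgrPdist_lt => e e0.
  have [n _ /(_ n (leqnn n)) nP] := (cvgrPdist_lt _ _).1 cv e e0.
  near=> x.
  have tx : t <= x by rewrite ltW//; near: x; exact: nbhs_right_gt.
  have xn : x <= t + n.+1%:R^-1.
    by rewrite ltW//; near: x; apply: nbhs_right_lt; rewrite ltrDl invr_gt0.
  have h1 := count_nondecreasing t0 tx.
  have h2 := count_nondecreasing (le_trans t0 tx) xn.
  by move: nP => /=; rewrite !ltr_norml => /andP[h3 h4]; apply/andP; split; lra.
- apply: nondecreasing_at_left_is_cvgr.
    near=> x; move=> y z; rewrite !in_itv/= => /andP[xy _] /andP[xz _] yz.
    apply: count_nondecreasing => //; apply: le_trans (ltW xy).
    by near: x; apply: nbhs_left_ge.
  near=> x; exists (count t) => _ [y + <-]; rewrite /= in_itv/= => /andP[xy yt].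
  apply: count_nondecreasing; last exact: ltW.
  apply: le_trans (ltW xy).
  by near: x; apply: nbhs_left_ge.
Unshelve. all: by end_near. Qed.

End counting_paths.

Section continuous_paths.
Context {R : realType}.

Lemma continuous_cadlag (f : R -> R) : {within `[0, +oo[, continuous f} -> cadlag f.
Proof.
move=> /continuous_within_itvcyP[fc f0]; split=> t.
  rewrite le_eqVlt => /orP[/eqP <-//|t0].
  by apply: cvg_at_right_filter; apply: fc; rewrite in_itv/= t0.
move=> t0; apply: (cvgP (f t)); apply: cvg_at_left_filter; apply: fc.
by rewrite in_itv/= t0.
Qed.

Lemma cadlag_scale (a : R) (f : R -> R) : cadlag f -> cadlag (fun t => a * f t).
Proof.
move=> [fr fl]; split=> t t0; first by apply: cvgM; [exact: cvg_cst|exact: fr].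
by apply: is_cvgM; [exact: is_cvg_cst|exact: fl].
Qed.

End continuous_paths.

(** * Regular versions of the Brownian motion and of the compensated Poisson process *)

Section wp_processes.
Context {d : measure_display} {T : measurableType d} {R : realType}.
Variable P : probability T R.
Variables (B : R -> T -> R) (mu : T -> {measure set (R * R) -> \bar R}).
Hypothesis HP : measure_is_complete P.
Hypothesis wp : wiener_poisson P B mu inverse_square_levy.

Local Notation F := (wp_filtration P B mu).
Let cF : complete_filtration P F := wp_complete_filtration HP wp.
Let bmB : brownian_motion P B. Proof. by case: wp. Qed.
Let pmu : poisson_random_measure P mu inverse_square_levy. Proof. by case: wp. Qed.

Lemma jumps_strip t : strip (@jumps R t).
Proof.
split; first exact: jumps_measurable.
move=> [x y] [/=]; rewrite !in_itv/= => /andP[x0 _]; rewrite andbT => y1.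
by split=> /=; rewrite ?in_itv/= ?x0// gt_eqF// (lt_le_trans ltr01).
Qed.

Lemma jumps_in_strip s t : 0 <= s -> strip (@jumps_in R s t).
Proof.
move=> s0; split; first exact: jumps_in_measurable.
move=> [x y] [/=]; rewrite !in_itv/= => /andP[sx _]; rewrite andbT => y1.
by split=> /=; rewrite ?in_itv/= ?(le_trans s0 (ltW sx))// gt_eqF// (lt_le_trans ltr01).
Qed.

Lemma intensity_jumps t : 0 <= t -> intensity (@inverse_square_levy R) (jumps t) = t%:E.
Proof.
move=> t0; rewrite intensity_strip//.
  rewrite lebesgue_measure_itv/= lte_fin.
  by move: t0; rewrite le_eqVlt => /orP[/eqP<-|->]; rewrite ?ltxx ?sube0.
by move=> x /=; rewrite !in_itv/= => /andP[->].
Qed.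

Lemma intensity_jumps_in s t : 0 <= s -> s <= t ->
  intensity (@inverse_square_levy R) (jumps_in s t) = (t - s)%:E.
Proof.
move=> s0 st; rewrite intensity_strip//.
  rewrite lebesgue_measure_itv/= lte_fin.
  by move: st; rewrite le_eqVlt => /orP[/eqP->|->//]; rewrite ltxx subrr.
by move=> x /=; rewrite !in_itv/= => /andP[sx _]; rewrite (le_trans s0 (ltW sx)).
Qed.

(** The conditions hold almost surely and carry all path arguments. Finiteness at integer times
    extends to all times by monotonicity, and the last condition makes the count start at 0, since
    [jumps 0] contains the jumps at time 0. *)
Definition good : set T := [set w | [/\ B 0 w = 0,
  {within `[0, +oo[, continuous (B ^~ w)},
  forall n : nat, (mu w (jumps n%:R) < +oo)%E & mu w (jumps 0) = 0%E]].

Let law_jumps t k : 0 <= t -> P [set w | mu w (jumps t) = (k%:R)%:E] = poisson_prob t k [set k].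
Proof.
move=> t0; rewrite (prm_poisson pmu); [|exact: jumps_strip|by rewrite intensity_jumps// ltry].
by rewrite intensity_jumps.
Qed.

Let mu_jumps_measurable t : measurable_fun setT (fun w => mu w (jumps t)).
Proof. by apply: (prm_measurable pmu); exact: jumps_strip. Qed.

Lemma ae_good : {ae P, forall w, good w}.
Proof.
have fin : {ae P, forall w, forall n : nat, (mu w (jumps n%:R) < +oo)%E}.
  apply: ae_foralln => n; have n0 : (0 : R) <= n%:R by [].
  apply: filterS (poisson_integer (mu_jumps_measurable n%:R) n0 (fun k => law_jumps k n0)).
  by move=> w [k ->]; rewrite ltry.
have jump0 : {ae P, forall w, mu w (jumps 0) = 0%E}.
  have m0 : measurable [set w | mu w (jumps 0) = 0%E].
    rewrite (_ : [set w | _] = (fun w => mu w (jumps 0)) @^-1` [set 0%E])//.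
    rewrite -[X in measurable X]setTI; apply: (mu_jumps_measurable 0 measurableT).
    exact: (@emeasurable_set1 R 0%E).
  exists (~` [set w | mu w (jumps 0) = 0%E]); split=> //; first exact: measurableC.
  rewrite probability_setC//.
  rewrite (poisson_point (lexx 0) (fun k => law_jumps k (lexx 0)) 0%N).
  by rewrite poisson_weight0// subee.
by apply: filterS2 (filterI (brownian_start bmB) (brownian_continuous bmB)) (filterI fin jump0)
  => w [? ?] [? ?]; split.
Qed.

(** Off [good] the Brownian motion and the count are replaced by 0, so that every path is cadlag and
    starts at 0. The sign [e] covers [B] and [- B] at once. *)
Definition good_brownian (e t : R) (w : T) : R := e * (\1_good w * B t w).
Definition good_poisson (t : R) (w : T) : R := \1_good w * count (mu w) t - t.

Lemma good_brownianE e t w : good w -> good_brownian e t w = e * B t w.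
Proof. by move=> gw; rewrite /good_brownian indicE mem_set// mul1r. Qed.

Lemma good_poissonE t w : good w -> good_poisson t w = count (mu w) t - t.
Proof. by move=> gw; rewrite /good_poisson indicE mem_set// mul1r. Qed.

Lemma brownian_adapted : adapted F B.
Proof.
move=> t t0 A mA; apply: sub_sigma_algebra; left; left.
by exists t, A; rewrite t0 lexx.
Qed.

Lemma good_brownian_adapted e : adapted F (good_brownian e).
Proof.
move=> t t0; have sF := cf_sigma cF t.
apply: (@measurable_wrt_ae_eq _ _ R _ sF P _ _ (fun w => e * B t w)).
- exact: (cf_negligible cF).
- by apply: filterS ae_good => w gw; rewrite good_brownianE.
- by apply: measurable_wrtM => //; [exact: measurable_wrt_cst|exact: brownian_adapted].
Qed.

Lemma count_adapted : adapted F (fun t w => count (mu w) t).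
Proof.
move=> t t0; have sF := cf_sigma cF t.
apply/(measurable_wrtP sF); apply: measurableT_comp; first exact: fine_measurable.
move=> _ A mA; rewrite setTI; apply: sub_sigma_algebra.
apply: sub_sigma_algebra; left; right; exists (jumps t), A; split=> //.
split; first exact: jumps_measurable.
move=> [x y] [/=]; rewrite !in_itv/= => /andP[x0 xt]; rewrite andbT => y1.
by split=> /=; rewrite ?in_itv/= ?x0 ?xt// gt_eqF// (lt_le_trans ltr01).
Qed.

Lemma good_poisson_adapted : adapted F good_poisson.
Proof.
move=> t t0; have sF := cf_sigma cF t.
apply: (@measurable_wrt_ae_eq _ _ R _ sF P _ _ (fun w => count (mu w) t - t)).
- exact: (cf_negligible cF).
- by apply: filterS ae_good => w gw; rewrite good_poissonE.
- by apply: measurable_wrtB => //; [exact: count_adapted|exact: measurable_wrt_cst].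
Qed.

Lemma good_brownian0 e w : good_brownian e 0 w = 0.
Proof.
rewrite /good_brownian indicE; have [|_] := boolP (w \in good); last by rewrite mul0r mulr0.
by rewrite inE => -[-> _ _]; rewrite !mulr0.
Qed.

Lemma good_poisson0 w : good_poisson 0 w = 0.
Proof.
rewrite /good_poisson subr0 indicE; have [|_] := boolP (w \in good); last by rewrite mul0r.
by rewrite inE => -[_ _ _]; rewrite /count => ->; rewrite mulr0.
Qed.

Lemma good_brownian_cadlag e w : cadlag (good_brownian e ^~ w).
Proof.
apply: cadlag_scale; rewrite indicE; have [|_] := boolP (w \in good).
  by rewrite inE => -[_ cB _ _]; apply: cadlag_scale; exact: continuous_cadlag.
rewrite (_ : (fun t => _) = cst 0); last by apply/funext => t; rewrite mul0r.
by split=> t _; [exact: cvg_cst|exact: is_cvg_cst].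
Qed.

Lemma good_poisson_cadlag w : cadlag (good_poisson ^~ w).
Proof.
apply: cadlagB; last exact: cadlag_id.
rewrite indicE; have [|_] := boolP (w \in good).
  by rewrite inE => -[_ _ mf _]; apply: cadlag_scale; exact: count_cadlag.
rewrite (_ : (fun t => _) = cst 0); last by apply/funext => t; rewrite mul0r.
by split=> t _; [exact: cvg_cst|exact: is_cvg_cst].
Qed.

Definition brownian_inc (e s t : R) (w : T) : R := e * (B t w - B s w).
Definition poisson_inc (s t : R) (w : T) : R := fine (mu w (jumps_in s t)) - (t - s).

Lemma good_brownian_inc e s t : {ae P, forall w,
  good_brownian e t w - good_brownian e s w = brownian_inc e s t w}.
Proof. by apply: filterS ae_good => w gw; rewrite !good_brownianE// /brownian_inc mulrBr. Qed.

Lemma good_poisson_inc s t : 0 <= s -> s < t -> {ae P, forall w,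
  good_poisson t w - good_poisson s w = poisson_inc s t w}.
Proof.
move=> s0 st; apply: filterS ae_good => w gw; rewrite !good_poissonE// /poisson_inc.
have [_ _ mf _] := gw; rewrite -(count_diff mf s0 (ltW st)); ring.
Qed.

Section brownian_part.
Variable e : R.
Hypothesis e2 : e ^+ 2 = 1.

Let Binc (s t : R) : 0 <= s -> s < t -> measurable_fun setT (fun w => B t w - B s w).
Proof.
by move=> s0 st; apply: measurable_funB; apply: (brownian_measurable bmB) => //; exact: le_trans (ltW st).
Qed.

Let sigma (s t : R) : s < t -> 0 < Num.sqrt (t - s).
Proof. by move=> st; rewrite sqrtr_gt0 subr_gt0. Qed.

Let Blaw (s t : R) : 0 <= s -> s < t -> forall A : set R, measurable A ->
  P ((fun w => B t w - B s w) @^-1` A) = normal_prob 0 (Num.sqrt (t - s)) A.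
Proof. by move=> s0 st A mA; apply: (brownian_normal bmB) => //; rewrite s0. Qed.

Let Bsqr s t w : brownian_inc e s t w ^+ 2 = (B t w - B s w) ^+ 2.
Proof. by rewrite exprMn e2 mul1r. Qed.

Lemma brownian_inc_indep s t A (C : set R) : 0 <= s -> s < t -> F s A -> measurable C ->
  P (A `&` brownian_inc e s t @^-1` C) = (P A * P (brownian_inc e s t @^-1` C))%E.
Proof.
move=> s0 st FA mC.
apply: (brownian_increment_indep HP wp _ FA (C := (fun x => e * x) @^-1` C)).
  by rewrite s0.
by rewrite -[X in measurable X]setTI; apply: measurable_funM.
Qed.

Lemma brownian_inc_L2 s t : 0 <= s -> s < t -> L2 P (brownian_inc e s t).
Proof.
move=> s0 st; apply: L2Z.
by have [] := normal_variable_L2 (Binc s0 st) (sigma st) (Blaw s0 st).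
Qed.

Lemma brownian_inc_mean s t : 0 <= s -> s < t -> Ex P (brownian_inc e s t) = 0.
Proof.
move=> s0 st; rewrite ExZ.
  by rewrite (normal_variable_mean (Binc s0 st) (sigma st) (Blaw s0 st)) mulr0.
by apply: L2_L1; have [] := normal_variable_L2 (Binc s0 st) (sigma st) (Blaw s0 st).
Qed.

Lemma brownian_inc_var s t : 0 <= s -> s < t -> Ex P (fun w => brownian_inc e s t w ^+ 2) = t - s.
Proof.
move=> s0 st; rewrite (@eq_Ex _ _ _ P _ _ (Bsqr s t)).
rewrite (normal_variable_var (Binc s0 st) (sigma st) (Blaw s0 st)) sqr_sqrtr//.
by rewrite subr_ge0 ltW.
Qed.

Lemma brownian_inc_sqr_L2 s t : 0 <= s -> s < t -> L2 P (fun w => brownian_inc e s t w ^+ 2).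
Proof.
move=> s0 st; rewrite (_ : (fun w => _) = (fun w => (B t w - B s w) ^+ 2)).
  by have [] := normal_variable_L2 (Binc s0 st) (sigma st) (Blaw s0 st).
by apply/funext => w; exact: Bsqr.
Qed.

Lemma brownian_inc_moment4 s t : 0 <= s -> s < t ->
  Ex P (fun w => (brownian_inc e s t w ^+ 2) ^+ 2) <= 64 * (t - s) ^+ 2.
Proof.
move=> s0 st; rewrite (@eq_Ex _ _ _ P _ (fun w => ((B t w - B s w) ^+ 2) ^+ 2)); last first.
  by move=> w; rewrite Bsqr.
apply: (le_trans (normal_variable_moment4 (Binc s0 st) (sigma st) (Blaw s0 st))).
by rewrite (exprM _ 2 2) sqr_sqrtr// subr_ge0 ltW.
Qed.

Lemma good_brownian_martingale : normal_martingale P F (good_brownian e).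
Proof.
apply: (@independent_increments_martingale _ _ _ _ _ cF _ (brownian_inc e)).
- exact: good_brownian_adapted.
- exact: good_brownian0.
- exact: good_brownian_cadlag.
- by move=> s t _ _; exact: good_brownian_inc.
- exact: brownian_inc_indep.
- exact: brownian_inc_L2.
- exact: brownian_inc_mean.
- exact: brownian_inc_var.
Qed.

End brownian_part.

Let Nlaw (s t : R) : 0 <= s -> s <= t -> forall k,
  P [set w | mu w (jumps_in s t) = (k%:R)%:E] = poisson_prob (t - s) k [set k].
Proof.
move=> s0 st k; rewrite (prm_poisson pmu); [|exact: jumps_in_strip|].
  by rewrite intensity_jumps_in.
by rewrite intensity_jumps_in// ltry.
Qed.

Let mN (s t : R) : 0 <= s -> measurable_fun setT (fun w => mu w (jumps_in s t)).
Proof. by move=> s0; apply: (prm_measurable pmu); exact: jumps_in_strip. Qed.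

Lemma poisson_inc_indep s t A (C : set R) : 0 <= s -> s < t -> F s A -> measurable C ->
  P (A `&` poisson_inc s t @^-1` C) = (P A * P (poisson_inc s t @^-1` C))%E.
Proof.
move=> s0 st FA mC.
have mC' : measurable ((fun x : \bar R => fine x - (t - s)) @^-1` C).
  rewrite -[X in measurable X]setTI.
  have mf : measurable_fun setT (fun x : \bar R => fine x - (t - s)).
    by apply: measurable_funB => //; exact: fine_measurable.
  exact: mf.
apply: (mu_increment_indep HP wp s0 (jumps_in_strip t s0) _ FA mC').
apply/seteqP; split=> // -[x y] [[/= + _] [/= + _]].
by rewrite !in_itv/= => /andP[sx _] /andP[_ xs]; move: sx; rewrite ltNge xs.
Qed.

Lemma good_poisson_martingale : normal_martingale P F good_poisson.
Proof.
have ts0 s t : s < t -> (0 : R) <= t - s by move=> st; rewrite subr_ge0 ltW.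
apply: (@independent_increments_martingale _ _ _ _ _ cF _ poisson_inc).
- exact: good_poisson_adapted.
- exact: good_poisson0.
- exact: good_poisson_cadlag.
- exact: good_poisson_inc.
- exact: poisson_inc_indep.
- by move=> s t s0 st; exact: (centered_poisson_L2 (mN t s0) (ts0 _ _ st) (Nlaw s0 (ltW st))).
- by move=> s t s0 st; exact: (centered_poisson_mean (mN t s0) (ts0 _ _ st) (Nlaw s0 (ltW st))).
- by move=> s t s0 st; exact: (centered_poisson_var (mN t s0) (ts0 _ _ st) (Nlaw s0 (ltW st))).
Qed.

Lemma good_poisson_increasing w s t : 0 <= s -> s <= t ->
  0 <= good_poisson t w - good_poisson s w + (t - s).
Proof.
move=> s0 st; rewrite /good_poisson indicE; have [|_] := boolP (w \in good); last by rewrite !mul0r; lra.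
rewrite inE !mul1r => -[_ _ mf _]; have := count_nondecreasing mf s0 st; rewrite /=; lra.
Qed.

Lemma good_poisson_defect s t : 0 <= s -> s <= t ->
  Ex P (fun w => `|(good_poisson t w - good_poisson s w) ^+ 2
    - (good_poisson t w - good_poisson s w) - (t - s)|) <= 4 * (t - s) ^+ 2.
Proof.
move=> s0; rewrite le_eqVlt => /orP[/eqP <-|st].
  rewrite subrr expr0n mulr0 -[leRHS](Ex_cst P) le_eqVlt; apply/orP; left; apply/eqP.
  by apply: eq_Ex => w; rewrite subrr expr0n /= !subrr normr0.
have t0 := le_trans s0 (ltW st); have ts : 0 <= t - s by rewrite subr_ge0 ltW.
apply: le_trans (centered_poisson_defect (mN t s0) ts (Nlaw s0 (ltW st))).
have mD : measurable_fun setT (fun w => good_poisson t w - good_poisson s w).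
  by apply: measurable_funB; apply: (adapted_measurable cF) => //; exact: good_poisson_adapted.
have mI : measurable_fun setT (poisson_inc s t).
  exact: (L2_measurable (centered_poisson_L2 (mN t s0) ts (Nlaw s0 (ltW st)))).
rewrite le_eqVlt; apply/orP; left; apply/eqP; apply: Ex_ae_eq.
- by apply: filterS (good_poisson_inc s0 st) => w ->.
- apply: measurableT_comp => //; apply: measurable_funB => //; apply: measurable_funB => //.
  exact: measurable_funX.
- apply: measurableT_comp => //; apply: measurable_funB => //; apply: measurable_funB => //.
  exact: measurable_funX.
Qed.

Lemma good_switched_solution (S : T -> \bar R) (e : R) : e ^+ 2 = 1 ->
  (forall w, (0 <= S w)%E) ->
  (forall t, 0 <= t -> F t [set w | (S w <= t%:E)%E]) ->
  predictable F (after_stop S) ->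
  structure_solution P F (after_stop S) (switched S (good_brownian e) good_poisson).
Proof.
move=> e2 S0 stopS pu.
(* 64 is the constant of the fourth moment bound for Brownian increments. *)
have C0 : (0 : R) <= 64 by [].
have MD s t : 0 <= s -> s < t -> {ae P, forall w,
    good_brownian e t w - good_brownian e s w = brownian_inc e s t w}.
  by move=> _ _; exact: good_brownian_inc.
apply: (switched_solution cF S0 stopS pu (good_brownian_martingale e2) good_poisson_martingale C0).
- exact: (increment_sqr_L2 cF (good_brownian_adapted e) MD (brownian_inc_sqr_L2 e2)).
- exact: (increment_sqr_var cF (good_brownian_adapted e) MD (brownian_inc_var e2)
    (brownian_inc_sqr_L2 e2) (brownian_inc_moment4 e2)).
- exact: (increment_sqr_mean cF (good_brownian_adapted e) MD (@brownian_inc_indep e)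
    (brownian_inc_var e2) (brownian_inc_sqr_L2 e2)).
- exact: good_poisson_increasing.
- exact: good_poisson_defect.
Qed.

End wp_processes.

(** * The hitting time of a level *)

Section hitting_path.
Context {R : realType}.

(** Enumerates the nonnegative rationals with repetition: the absolute value keeps the times in [0,
    oo[, and a code without a rational gives 0. *)
Definition rational_time (n : nat) : R := `|ratr (odflt 0 (unpickle n : option rat))|.

Lemma rational_time_ge0 n : 0 <= rational_time n.
Proof. exact: normr_ge0. Qed.

Lemma rational_time_dense (a b : R) : 0 <= a -> a < b -> exists n, a < rational_time n < b.
Proof.
move=> a0 ab; have [q] := rat_in_itvoo ab; rewrite in_itv/= => /andP[aq qb].
exists (pickle q); rewrite /rational_time pickleK/= ger0_norm ?aq//.
exact: le_trans a0 (ltW aq).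
Qed.

Variable b : R -> R.
Hypothesis b0 : b 0 = 0.
Hypothesis cb : {within `[0, +oo[, continuous b}.

Local Notation S := (ereal_inf (EFin @` [set t | 0 <= t /\ b t = 1])).

Lemma hitting_ge0 (f : R -> R) : (0 <= ereal_inf (EFin @` [set t : R | (0 <= t)%R /\ f t = 1%R]))%E.
Proof. by apply: le_ereal_inf_tmp => _ [t [t0 _] <-]; rewrite lee_fin. Qed.

Lemma hitting_le t : 0 <= t -> b t = 1 -> (S <= t%:E)%E.
Proof. by move=> t0 bt; apply: ereal_inf_lbound; exists t. Qed.

Lemma hitting_fin t : (S <= t%:E)%E -> S = (fine S)%:E.
Proof.
move=> St; rewrite fineK// fin_numElt (lt_le_trans _ (hitting_ge0 b))//=.
by rewrite (le_lt_trans St)// ltry.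
Qed.

Lemma path_near t e : 0 <= t -> 0 < e ->
  exists2 r, 0 < r & forall s, 0 <= s -> `|s - t| < r -> `|b s - b t| < e.
Proof.
move=> t0 e0; have := cb; rewrite subspace_continuousP => /(_ t).
have /[swap]/[apply] : `[0, +oo[%classic t by rewrite /= in_itv/= t0.
move=> /cvgrPdist_lt/(_ e e0); rewrite /within/= => /nbhs_ballP[r r0 rb].
exists r => // s s0 st; rewrite distrC; apply: (rb s).
  by rewrite /ball/= distrC.
by rewrite in_itv/= s0.
Qed.

Lemma path_within t : 0 <= t -> {within `[0, t], continuous b}.
Proof.
move=> t0; apply: continuous_subspaceW cb => s /=; rewrite !in_itv/= => /andP[->//].
Qed.

(** The infimum is attained: if the path differed from 1 at [S], it would do so on a right
    neighbourhood by continuity, yet there are hitting times arbitrarily close to [S]. *)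
Lemma hitting_value t : (S <= t%:E)%E -> b (fine S) = 1.
Proof.
move=> St; have Sf := hitting_fin St; set r := fine S in Sf *.
have r0 : 0 <= r by rewrite fine_ge0// hitting_ge0.
apply/eqP/negPn/negP => br.
have e0 : 0 < `|b r - 1| by rewrite normr_gt0 subr_eq0.
have [dl dl0 H] := path_near r0 e0.
have [_ [s [s0 bs] <-]] : exists2 y, (EFin @` [set t | 0 <= t /\ b t = 1]) y & (y < (r + dl)%:E)%E.
  by apply: ereal_inf_lt; rewrite Sf lte_fin ltrDl.
rewrite lte_fin => srd.
have rs : r <= s by rewrite -lee_fin -Sf; exact: hitting_le.
have := H s s0; rewrite bs ger0_norm ?subr_ge0// ltrBlDl => /(_ srd).
by rewrite distrC ltxx.
Qed.

Lemma hitting_gt0 : (0 < S)%E.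
Proof.
rewrite lt_neqAle hitting_ge0 andbT; apply/eqP => S0.
have := @hitting_value 0; rewrite -S0 lexx => /(_ isT)/=.
by rewrite b0 => /esym/eqP; rewrite oner_eq0.
Qed.

Lemma lt_before_hitting t : 0 <= t -> (t%:E < S)%E -> b t < 1.
Proof.
move=> t0 tS; rewrite ltNge; apply/negP => bt.
have [|s + bs] := @IVT _ b 0 t 1 t0 (path_within t0).
  by rewrite b0 ge_min ler01/= le_max bt orbT.
rewrite in_itv/= => /andP[s0 st].
have := lt_le_trans tS (hitting_le s0 bs); rewrite lte_fin ltNge st//.
Qed.

(** If rational times before [t] bring the path arbitrarily close to 1, its maximum over [0, t] is
    at least 1, so 1 is reached by the intermediate value theorem. The strict inequality
    [rational_time n < t] can be achieved because [S > 0]; it leads to left-open time intervals and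
    thereby to predictability. *)
Lemma hitting_leP t : 0 <= t -> (S <= t%:E)%E <->
  forall k : nat, exists n, rational_time n < t /\ 1 - k.+1%:R^-1 < b (rational_time n).
Proof.
move=> t0; split=> [St k|H].
  have Sf := hitting_fin St; have bS := hitting_value St.
  set r := fine S in Sf bS; have r0 : 0 < r by rewrite -lte_fin -Sf; exact: hitting_gt0.
  have k0 : (0 : R) < k.+1%:R^-1 by rewrite invr_gt0.
  have [dl dl0 H] := path_near (ltW r0) k0.
  have [n /andP[n1 n2]] : exists n, Num.max 0 (r - dl) < rational_time n < r.
    apply: rational_time_dense; first by rewrite le_max lexx.
    by rewrite gt_max r0/= ltrBlDr ltrDl.
  exists n; split; first by apply: lt_le_trans n2 _; rewrite -lee_fin -Sf.
  have := H (rational_time n) (rational_time_ge0 n).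
  move: n1; rewrite gt_max => /andP[_ n1].
  rewrite ltr0_norm ?subr_lt0// opprB => /(_ _)/wrap[]; first by lra.
  by rewrite bS ltr_norml => /andP[+ _]; rewrite ltrBrDr addrC.
rewrite leNgt; apply/negP => tS.
have [c + cmax] := EVT_max t0 (path_within t0); rewrite in_itv/= => /andP[c0 ct].
have bc : b c < 1.
  by apply: lt_before_hitting => //; apply: le_lt_trans tS; rewrite lee_fin.
suff : 1 <= b c by rewrite leNgt bc.
apply: (@le_inv_nat _ _ _ 1) => // k; have [n [nt nb]] := H k.
have := cmax (rational_time n); rewrite in_itv/= rational_time_ge0 ltW// => /(_ isT) bn.
by rewrite div1r -lerBlDr; exact: le_trans (ltW nb) bn.
Qed.

End hitting_path.

(** * Stopping time property and predictability of the hitting time *)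

Section hitting_time_predictable.
Context {d : measure_display} {T : measurableType d} {R : realType}.
Variables (P : probability T R) (F : R -> set (set T)).
Hypothesis cF : complete_filtration P F.
Variable B : R -> T -> R.
Hypothesis aB : adapted F B.
Variable G : set T.
Hypothesis aeG : {ae P, forall w, G w}.
Hypothesis B0 : forall w, G w -> B 0 w = 0.
Hypothesis cB : forall w, G w -> {within `[0, +oo[, continuous (B ^~ w)}.

Local Notation S := (hitting_time B 1).
Local Notation rt := (@rational_time R).
Local Notation predT := (g_sigma_algebraType (predictable_rect F)).

Let negF t A : A `<=` ~` G -> F t A.
Proof. by move=> AG; apply: (cf_negligible cF); exact: negligibleS AG aeG. Qed.

Let goodF t : F t G.
Proof. by rewrite -(setCK G); apply: (sigma_algebraC (cf_sigma cF t)); exact: negF. Qed.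

Let level (k n : nat) : set T := G `&` [set w | 1 - k.+1%:R^-1 < B (rt n) w].

Let levelF k n : F (rt n) (level k n).
Proof.
apply: (sigma_algebraI (cf_sigma cF _)); first exact: goodF.
rewrite (_ : [set w | _] = B (rt n) @^-1` `]1 - k.+1%:R^-1, +oo[).
  by apply: aB; [exact: rational_time_ge0|exact: measurable_itv].
by apply/seteqP; split=> w /=; rewrite in_itv/= andbT.
Qed.

(** On [G] the event is a countable combination of events at rational times before [t]; every part
    of it off [G] is negligible and belongs to [F t]. *)
Lemma hitting_time_stopping t : 0 <= t -> F t [set w | (S w <= t%:E)%E].
Proof.
move=> t0; have sF := cf_sigma cF t.
rewrite (_ : [set w | _] = (\bigcap_k \bigcup_n (if rt n < t then level k n else set0))
    `|` ([set w | (S w <= t%:E)%E] `&` ~` G)); last first.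
  apply/seteqP; split=> [w Sw|w].
    have [Gw|nGw] := pselect (G w); [left=> k _|by right].
    have /hitting_leP : (S w <= t%:E)%E by [].
    move=> /(_ (B0 Gw) (cB Gw) t0 k)[n [nt nb]]; exists n => //; rewrite nt.
    by split.
  move=> [H|[]//] /=.
  have Gw : G w by have [n _] := H 0%N I; case: ifP => // _ [].
  apply/hitting_leP => //; [exact: B0|exact: cB|] => k.
  have [n _] := H k I; case: ifPn => // nt [_ nb]; by exists n.
apply: (sigma_algebraU sF); last by apply: negF => w [].
rewrite -(setCK (\bigcap_k _)); apply: (sigma_algebraC sF); rewrite setC_bigcap.
apply: (sigma_algebra_bigcup sF) => k; apply: (sigma_algebraC sF).
apply: (sigma_algebra_bigcup sF) => n; case: ifPn => nt; last by case: sF.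
by apply: (cf_mono cF (ltW nt)); exact: levelF.
Qed.

Let rect0 A : F 0 A -> measurable ([set 0] `*` A : set predT).
Proof. by move=> FA; apply: sub_sigma_algebra; left; exists A. Qed.

Let rect_after q A : 0 <= q -> F q A -> measurable (`]q, +oo[ `*` A : set predT).
Proof.
move=> q0 FA; rewrite (_ : _ `*` _ = \bigcup_n (`]q, q + n%:R] `*` A) :> set predT).
  apply: bigcup_measurable => n _; apply: sub_sigma_algebra; right.
  by exists q, (q + n%:R), A; rewrite q0 lerDl ler0n.
apply/seteqP; split=> -[s w] /=; rewrite ?in_itv/= ?andbT.
  move=> [qs Aw]; exists (Num.truncn (s - q)).+1 => //=; split=> //=.
  by rewrite in_itv/= qs/= -lerBlDl ltW// truncnS_gt.
by move=> [n _ [/=]]; rewrite in_itv/= => /andP[].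
Qed.

(** On [G], [hitting_leP] describes the process by the left-open rectangles []rt n, +oo[] times
    [level k n]. Off [G] the values of [S] are arbitrary, but any base set is negligible and so
    admissible in a predictable rectangle. *)
Lemma hitting_time_predictable : predictable F (after_stop S).
Proof.
(* Off [G], a time [s] lies before [S] exactly when some rational time satisfies [s <= rt n < S];
   the union of these sets is removed. *)
pose bad (n : nat) : set predT := ([set 0] `|` `]0, rt n]) `*` (~` G `&` [set w | ((rt n)%:E < S w)%E]).
pose E : set predT := (\bigcap_k \bigcup_n (`]rt n, +oo[ `*` level k n))
   `|` ((([set 0] `*` ~` G) `|` (`]0, +oo[ `*` ~` G)) `\` \bigcup_n bad n).
have mE : measurable E.
  apply: measurableU.
    apply: bigcap_measurable => [|k _]; first by exists 0%N.
    apply: bigcup_measurable => n _.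
    by apply: rect_after; [exact: rational_time_ge0|exact: levelF].
  apply: measurableD.
    by apply: measurableU; [apply: rect0|apply: rect_after => //]; exact: negF.
  apply: bigcup_measurable => n _.
  rewrite (_ : bad n = ([set 0] `*` (~` G `&` [set w | ((rt n)%:E < S w)%E]))
     `|` (`]0, rt n] `*` (~` G `&` [set w | ((rt n)%:E < S w)%E])) :> set predT).
    apply: measurableU; first by apply: rect0; apply: negF => w [].
    apply: sub_sigma_algebra; right; exists 0, (rt n), (~` G `&` [set w | ((rt n)%:E < S w)%E]).
    by rewrite lexx rational_time_ge0; split=> //; apply: negF => w [].
  apply/seteqP; split=> -[s w] /= => [[[s0|sn] ?]|[[-> ?]|[sn ?]]]; [by left|by right| |].
    by split=> //; left.
  by split=> //; right.
have EP s w : 0 <= s -> E (s, w) <-> (S w <= s%:E)%E.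
  move=> s0; split.
    move=> [H|[H1 H2]].
      have Gw : G w by have [n _ [_ []]] := H 0%N I.
      apply/hitting_leP => //; [exact: B0|exact: cB|] => k.
      have [n _ [/= + [_ nb]]] := H k I; rewrite in_itv/= andbT => ns; by exists n.
    have nG : ~ G w by case: H1 => -[].
    rewrite leNgt; apply/negP => sS; apply: H2.
    have [n nn] : exists n, s < rt n /\ ((rt n)%:E < S w)%E.
      have [r sr rS] : exists2 r, s < r & (r%:E <= S w)%E.
        move: sS; case: (S w) => [r| |]//; last by exists (s + 1); rewrite ?ltrDl// leey.
        by rewrite lte_fin => sr; exists r.
      have [n /andP[n1 n2]] := rational_time_dense s0 sr.
      by exists n; split=> //; apply: lt_le_trans rS; rewrite lte_fin.
    exists n => //; split=> /=; last by case: nn.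
    have [->|sn0] := eqVneq s 0; [by left|right; rewrite in_itv/=].
    by rewrite lt_neqAle eq_sym sn0 s0 ltW//; case: nn.
  move=> Ss; have [Gw|nG] := pselect (G w).
    left=> k _; have := Ss; rewrite /hitting_time => /(hitting_leP (B0 Gw) (cB Gw) s0)/(_ k)[n [ns nb]].
    by exists n => //; split=> //=; rewrite in_itv/= ns.
  right; split.
    have [->|sn0] := eqVneq s 0; [by left|right; split=> //=].
    by rewrite in_itv/= lt_neqAle eq_sym sn0 s0.
  move=> [n _ [/= sn [_ nS]]].
  have : s <= rt n.
    by case: sn => [->|]; [exact: rational_time_ge0|rewrite in_itv/= => /andP[]].
  by rewrite leNgt -lte_fin (lt_le_trans nS Ss).
apply: (eq_measurable_fun (\1_E : predT -> R)).
  move=> -[s w]; rewrite inE => -[/=]; rewrite in_itv/= andbT => s0 _.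
  rewrite /after_stop indicE; congr (nat_of_bool _)%:R.
  by apply/idP/idP; rewrite inE => /EP; exact.
by apply: measurable_funTS; exact: measurable_indic.
Qed.

End hitting_time_predictable.

(** * Non-uniqueness *)

Section paley_zygmund.
Context {d : measure_display} {T : measurableType d} {R : realType}.
Variable P : probability T R.

(* With [z = Y^2 / (64 v)], the constants come from
   [z - z^2 / 4 - 1 / 256 <= 1_(z >= 1/256)]. *)
Lemma prob_large_ge (Y : T -> R) (c : R) : 0 < c -> L2 P Y -> L2 P (fun w => Y w ^+ 2) ->
  Ex P (fun w => Y w ^+ 2) = 4 * c ^+ 2 ->
  Ex P (fun w => (Y w ^+ 2) ^+ 2) <= 64 * (4 * c ^+ 2) ^+ 2 ->
  1 / 128 <= fine (P [set w | c <= `|Y w|]).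
Proof.
move=> c0 Y2 Y4 EY2 EY4; have mY := L2_measurable Y2.
set A := [set w | _]; have mA : measurable A.
  rewrite -[A]setTI; apply: measurable_fun_le => //; exact: measurableT_comp.
set v := 4 * c ^+ 2 in EY2 EY4.
have v0 : 0 < v by rewrite mulr_gt0// exprn_gt0.
pose k := (64 * v)^-1; have k0 : 0 < k by rewrite invr_gt0 mulr_gt0.
have vk : k * v = 1 / 64 by rewrite /k; field; rewrite gt_eqF.
have L1Y2 : L1 P (fun w => Y w ^+ 2) := L2_L1 Y4.
have L1Y4 : L1 P (fun w => (Y w ^+ 2) ^+ 2) := L2_sqr Y4.
have L : L1 P (fun w => k * Y w ^+ 2 - k ^+ 2 / 4 * (Y w ^+ 2) ^+ 2 - 1 / 256).
  by apply: L1B; [apply: L1B; exact: L1Z|exact: L1_cst].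
have : Ex P (fun w => k * Y w ^+ 2 - k ^+ 2 / 4 * (Y w ^+ 2) ^+ 2 - 1 / 256)
    <= Ex P (\1_A : T -> R).
  apply: Ex_le => //; first exact: L1_indic.
  move=> w; rewrite indicE; set z := k * Y w ^+ 2.
  rewrite (_ : _ - _ = z - z ^+ 2 / 4 - 1 / 256); last by rewrite /z; ring.
  have [wA|wA] := boolP (w \in A).
    by rewrite /=; have := sqr_ge0 (z / 2 - 1); lra.
  have zlt : z < 1 / 256.
    rewrite (_ : 1 / 256 = k * (v / 4)); last by rewrite mulrA vk; field.
    rewrite /z ltr_pM2l// /v mulrAC divff// mul1r.
    move: wA; rewrite notin_setE /A/= => /negP; rewrite -ltNge => Yc.
    by rewrite -(real_normK (num_real (Y w))) ltr_pXn2r ?nnegrE// ltW.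
  by have := sqr_ge0 z; rewrite /=; lra.
rewrite Ex_indic// ExB//; [|by apply: L1B; exact: L1Z|exact: L1_cst].
rewrite (ExB (L1Z _ L1Y2) (L1Z _ L1Y4)) Ex_cst !ExZ//.
rewrite EY2 vk; apply: le_trans.
have k4 : 0 < k ^+ 2 / 4 by rewrite divr_gt0// exprn_gt0.
have : k ^+ 2 / 4 * Ex P (fun w => (Y w ^+ 2) ^+ 2) <= 1 / 256.
  rewrite (_ : 1 / 256 = k ^+ 2 / 4 * (64 * v ^+ 2)); first by rewrite ler_pM2l.
  rewrite (_ : _ * (64 * _) = 16 * (k * v) ^+ 2); last by field.
  by rewrite vk; field.
lra.
Qed.

End paley_zygmund.

(** * Descent of the Brownian motion before the hitting time, and the two laws *)

Section descent.
Context {d : measure_display} {T : measurableType d} {R : realType}.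
Variable P : probability T R.
Variables (B : R -> T -> R) (mu : T -> {measure set (R * R) -> \bar R}).
Hypothesis HP : measure_is_complete P.
Hypothesis wp : wiener_poisson P B mu inverse_square_levy.

Local Notation F := (wp_filtration P B mu).
Local Notation S := (hitting_time B 1).
Local Notation G := (good B mu).
Local Notation W := (good_brownian B mu).
Local Notation Z := (good_poisson B mu).
Local Notation X := (fun e => switched S (W e) Z).

Let cF : complete_filtration P F := wp_complete_filtration HP wp.
Let aeG : {ae P, forall w, G w} := ae_good wp.
Let aB : adapted F B. Proof. exact: brownian_adapted. Qed.
Let G0 w : G w -> B 0 w = 0. Proof. by case. Qed.
Let Gc w : G w -> {within `[0, +oo[, continuous (B ^~ w)}. Proof. by case. Qed.
Let S0 w : (0 <= S w)%E. Proof. exact: (@hitting_ge0 R (B ^~ w)). Qed.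

Lemma hitting_time_stopS t : 0 <= t -> F t [set w | (S w <= t%:E)%E].
Proof. exact: (hitting_time_stopping cF aB aeG G0 Gc). Qed.

Lemma after_hitting_predictable : predictable F (after_stop S).
Proof. exact: (hitting_time_predictable cF aB aeG G0 Gc). Qed.

Lemma switched_hitting_solution e : e ^+ 2 = 1 -> structure_solution P F (after_stop S) (X e).
Proof.
move=> e2; apply: (good_switched_solution HP wp e2 S0).
- exact: hitting_time_stopS.
- exact: after_hitting_predictable.
Qed.

Let goodF t : F t G.
Proof.
rewrite -(setCK G); apply: (sigma_algebraC (cf_sigma cF t)).
exact: (cf_negligible cF).
Qed.

(** [prob_large_ge] with [c] half the standard deviation gives [1 / 128] for the absolute increment,
    and the symmetry of the normal law assigns at least half of it to the downward direction. *)
Lemma brownian_drop_ge s t : 0 <= s -> s < t ->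
  1 / 256 <= fine (P [set w | B t w - B s w <= - (Num.sqrt (t - s) / 2)]).
Proof.
move=> s0 st; set sg := Num.sqrt (t - s).
have [bmB _ _] := wp.
have ts : 0 < t - s by rewrite subr_gt0.
have sg0 : 0 < sg by rewrite sqrtr_gt0.
have c0 : 0 < sg / 2 by rewrite divr_gt0.
have v : 4 * (sg / 2) ^+ 2 = t - s by rewrite exprMn sqr_sqrtr ?ltW//; field.
have one : (1 : R) ^+ 2 = 1 by rewrite expr1n.
have := prob_large_ge c0 (brownian_inc_L2 wp 1 s0 st) (brownian_inc_sqr_L2 wp one s0 st).
rewrite v (brownian_inc_var wp one s0 st) => /(_ erefl (brownian_inc_moment4 wp one s0 st)).
have mD : measurable_fun setT (fun w => B t w - B s w).
  by apply: measurable_funB; apply: (brownian_measurable bmB) => //; exact: le_trans (ltW st).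
set lo := [set w | _ <= - _].
have mlo : measurable lo by rewrite -[lo]setTI; exact: measurable_fun_le.
pose hi := [set w | sg / 2 <= B t w - B s w].
have mhi : measurable hi by rewrite -[hi]setTI; exact: measurable_fun_le.
have hilo : P hi = P lo.
  have law := brownian_normal bmB (s := s) (t := t) _ _.
  rewrite (_ : hi = (fun w => B t w - B s w) @^-1` `[sg / 2, +oo[); last first.
    by apply/seteqP; split=> w /=; rewrite in_itv/= andbT.
  rewrite (_ : lo = (fun w => B t w - B s w) @^-1` `]-oo, - (sg / 2)]); last first.
    by apply/seteqP; split=> w /=; rewrite in_itv.
  by rewrite !law ?s0 ?normal_prob_gt_sym//; exact: measurable_itv.
have : (P [set w | (sg / 2 <= `|brownian_inc B 1 s t w|)%R] <= P lo + P hi)%E.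
  rewrite (_ : [set w | _] = lo `|` hi); first exact: measureU2.
  apply/seteqP; split=> w; rewrite /brownian_inc /lo /hi/= mul1r ler_normr lerNr.
    by move=> /orP[]; [right|left].
  by move=> [->|->]//; rewrite orbT.
rewrite hilo => /fine_le; rewrite fin_numD !fin_num_measure//.
- rewrite fineD ?fin_num_measure// => /(_ isT isT); lra.
- rewrite (_ : [set w | _] = lo `|` hi); first exact: measurableU.
  apply/seteqP; split=> w; rewrite /brownian_inc /lo /hi/= mul1r ler_normr lerNr.
    by move=> /orP[]; [right|left].
  by move=> [->|->]//; rewrite orbT.
Qed.

(** Up to [S] the process is [e * B], which equals [e] at [S]; afterwards [Z] can fall only through
    its drift, by at most [b - a]. *)
Lemma switched_hit_value e a b w : 0 <= a -> G w -> (a%:E < S w)%E -> (S w <= b%:E)%E ->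
  X e a w = e * B a w /\ e - (b - a) <= X e b w.
Proof.
move=> a0 Gw aS Sb; have Sf := stop_fin S0 Sb.
have BS : B (fine (S w)) w = 1 by exact: (hitting_value (Gc Gw) Sb).
have Sa : a < fine (S w) by rewrite -lte_fin -Sf.
have Sb' : fine (S w) <= b by rewrite -lee_fin -Sf.
rewrite /switched !min_timeE (leNgt (S w)) aS Sb/=; split; first by rewrite good_brownianE//; ring.
rewrite good_brownianE// BS mulr1.
have := @good_poisson_increasing _ _ _ B mu w (fine (S w)) b (ltW (le_lt_trans a0 Sa)) Sb'.
lra.
Qed.

(** Chebyshev's inequality with the conditional variance of the switched process. On the hitting
    event the process climbs from at most 0 to at least [1 - (b - a) >= 3 / 4], and
    [2 * (3 / 4) ^+ 2 >= 1] explains the factor 2. *)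
Lemma prob_hit_le a b A : 0 <= a -> a <= b -> b - a <= 1 / 4 -> F a A ->
  A `<=` [set w | [/\ G w, (a%:E < S w)%E & B a w <= 0]] ->
  fine (P (A `&` [set w | (S w <= b%:E)%E])) <= 2 * (b - a) * fine (P A).
Proof.
move=> a0 ab ba FA AG; have b0 := le_trans a0 ab.
have one : (1 : R) ^+ 2 = 1 by rewrite expr1n.
have nW := good_brownian_martingale HP wp one; have nZ := good_poisson_martingale HP wp.
have mA := cf_measurable cF FA.
have mS : measurable [set w | (S w <= b%:E)%E] by apply: (cf_measurable cF (hitting_time_stopS b0)).
have XL : L2 P (fun w => X 1 b w - X 1 a w).
  by apply: L2B; apply: (switched_L2 cF S0 hitting_time_stopS nW nZ).
have L : L1 P (fun w => \1_A w * (X 1 b w - X 1 a w) ^+ 2).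
  apply: L1_bool => //; exact: L2_sqr.
rewrite -mulrA -(switched_var cF S0 hitting_time_stopS nW nZ a0 ab FA) -ExZ//.
rewrite -Ex_indic; last exact: measurableI.
apply: Ex_le; [by apply: L1_indic; exact: measurableI|exact: L1Z|] => w.
rewrite indicE; have [|_] := boolP (w \in _ `&` _); last first.
  by rewrite mulr_ge0// mulr_ge0 ?sqr_ge0// indicE.
rewrite inE => -[Aw /= Sw]; have [Gw aS Ba] := AG _ Aw.
have [-> Xb] := switched_hit_value 1 a0 Gw aS Sw.
rewrite indicE mem_set// mul1r.
have h : 3 / 4 <= X 1 b w - 1 * B a w by lra.
have : (3 / 4 : R) ^+ 2 <= (X 1 b w - 1 * B a w) ^+ 2.
  by rewrite ler_pXn2r ?nnegrE//; lra.
rewrite /=; lra.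
Qed.

(* Brownian motion goes down by [h / 2] on each of [k] intervals of length [h ^ 2]
   without meeting the level [1]. *)
Definition descent (h : R) (k : nat) : set T := [set w | [/\ G w,
  ((k%:R * h ^+ 2)%:E < S w)%E & B (k%:R * h ^+ 2) w <= - (k%:R * (h / 2))]].

Lemma descentF h k : F (k%:R * h ^+ 2) (descent h k).
Proof.
have t0 : 0 <= k%:R * h ^+ 2 by rewrite mulr_ge0 ?sqr_ge0.
have sF := cf_sigma cF (k%:R * h ^+ 2).
rewrite (_ : descent h k = G `&` (~` [set w | (S w <= (k%:R * h ^+ 2)%:E)%E] `&`
   B (k%:R * h ^+ 2) @^-1` `]-oo, - (k%:R * (h / 2))])).
  apply: (sigma_algebraI sF) => //; apply: (sigma_algebraI sF).
    by apply: (sigma_algebraC sF); exact: hitting_time_stopS.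
  by apply: aB => //; exact: measurable_itv.
apply/seteqP; split=> w /=; rewrite in_itv/=.
  by move=> [? ? ?]; split=> //; split=> //; apply/negP; rewrite -ltNge.
by move=> [? [/negP + ?]]; rewrite -ltNge.
Qed.

(** One step multiplies the probability by at least [1 / 256 - 2 * h ^+ 2]: a drop independent of
    the past, minus the chance of meeting 1 meanwhile. This is positive for [h ^+ 2 < 1 / 512], and
    23 is the least integer whose square exceeds 512. *)
Lemma descent_gt0 h k : 0 < h -> h <= 1 / 23 -> 0 < fine (P (descent h k)).
Proof.
move=> h0 h23.
have hh : h ^+ 2 <= 1 / 529.
  rewrite (_ : 1 / 529 = (1 / 23) ^+ 2 :> R); last by field.
  by rewrite ler_pXn2r ?nnegrE// ?(ltW h0)// divr_ge0.
have hh0 : 0 < h ^+ 2 by rewrite exprn_gt0.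
elim: k => [|k IH].
  suff -> : P (descent h 0) = 1%E by [].
  have [||_ ->] := ae_eq_prob (A := setT) (C := descent h 0) cF; last by rewrite probability_setT.
    apply: filterS aeG => w Gw; split=> // _; rewrite /descent/= !mul0r oppr0 (G0 Gw).
    split=> //; exact: (hitting_gt0 (G0 Gw) (Gc Gw)).
  exact: measurableT.
set a : R := k%:R * h ^+ 2; set b : R := k.+1%:R * h ^+ 2.
have ba : b - a = h ^+ 2 by rewrite /a /b -natr1; ring.
have a0 : 0 <= a by rewrite mulr_ge0// ltW.
have ab : a < b by rewrite -subr_gt0 ba.
have sq : Num.sqrt (b - a) = h by rewrite ba sqrtr_sqr ger0_norm// ltW.
set D := [set w | B b w - B a w <= - (h / 2)].
have PD : 1 / 256 <= fine (P D) by have := brownian_drop_ge a0 ab; rewrite sq.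
have mA := cf_measurable cF (@descentF h k).
have mA' := cf_measurable cF (@descentF h k.+1).
have DE : D = brownian_inc B 1 a b @^-1` `]-oo, - (h / 2)].
  by apply/seteqP; split=> w; rewrite /D/= in_itv/= /brownian_inc mul1r.
have ind : P (descent h k `&` D) = (P (descent h k) * P D)%E.
  rewrite DE; apply: (brownian_inc_indep HP wp) => //; exact: descentF.
have [bmB _ _] := wp; have b0 := le_trans a0 (ltW ab).
have mD : measurable D.
  rewrite -[D]setTI; apply: measurable_fun_le => //; apply: measurable_funB;
    exact: (brownian_measurable bmB).
pose H := descent h k `&` [set w | (S w <= b%:E)%E].
have mH : measurable H by apply: measurableI => //; exact: (cf_measurable cF (hitting_time_stopS b0)).
have PH : fine (P H) <= 2 * h ^+ 2 * fine (P (descent h k)).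
  rewrite -ba; apply: prob_hit_le => //; [exact: ltW|by rewrite ba; lra|exact: descentF|].
  move=> w [Gw Sw Bw]; split=> //; apply: le_trans Bw _.
  by rewrite oppr_le0 mulr_ge0// divr_ge0// ltW.
have sub : descent h k `&` D `<=` descent h k.+1 `|` H.
  move=> w [[Gw aS Bw] Dw]; have [Sb|Sb] := leP (S w) b%:E; first by right.
  left; split=> //; rewrite -/b; move: Dw Bw; rewrite /D/= -[k.+1%:R]natr1 -/a mulrDl mul1r; lra.
have : (P (descent h k) * P D <= P (descent h k.+1) + P H)%E.
  rewrite -ind; apply: le_trans (measureU2 _ mA' mH).
  by apply: le_measure; rewrite ?inE//; [exact: measurableI|exact: measurableU].
move=> /fine_le; rewrite fin_numM ?fin_numD ?fin_num_measure//= => /(_ isT isT).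
rewrite fineM ?fineD ?fin_num_measure// => hle.
have le1 : fine (P (descent h k)) * (1 / 256) <= fine (P (descent h k)) * fine (P D).
  by rewrite ler_pM2l.
have le2 : h ^+ 2 * fine (P (descent h k)) <= 1 / 529 * fine (P (descent h k)).
  by rewrite ler_pM2r.
lra.
Qed.

Let mX e t : e ^+ 2 = 1 -> 0 <= t -> measurable_fun setT (X e t).
Proof.
move=> e2 t0; have [[aX _ _ _ _] _ _] := switched_hitting_solution e2.
exact: (adapted_measurable cF aX t0).
Qed.

Let mlt : measurable [set w | X 1 1 w < - 2].
Proof.
rewrite (_ : [set w | _] = X 1 1 @^-1` `]-oo, - 2[).
  by rewrite -[X in measurable X]setTI; apply: mX; rewrite ?expr1n.
by apply/seteqP; split=> w /=; rewrite in_itv.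
Qed.

Lemma switched_below_gt0 : (0 < P [set w | (X 1 1 w < - 2)%R])%E.
Proof.
have one : (1 : R) ^+ 2 = 1 by rewrite expr1n.
(* [23 * 23] steps of length [1 / 529] end exactly at time 1, with a total descent of [23 / 2], well
   below [- 2]. *)
pose h : R := 23^-1; pose n := (23 * 23)%N.
have h0 : 0 < h by rewrite invr_gt0.
have nh : n%:R * h ^+ 2 = 1 by rewrite /n /h natrM; field.
have nh2 : n%:R * (h / 2) = 23 / 2 by rewrite /n /h natrM; field.
have mD := cf_measurable cF (@descentF h n).
apply: (@lt_le_trans _ _ (P (descent h n))).
  rewrite -(fineK (fin_num_measure P _ mD)) lte_fin; apply: descent_gt0 => //.
  by rewrite /h div1r.
apply: le_measure; rewrite ?inE//.
move=> w [Gw]; rewrite nh nh2 => Sw Bw; rewrite /= /switched !min_timeE (leNgt (S w)) Sw/=.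
rewrite good_brownianE//; lra.
Qed.

(** If [S <= 1], the process is [- 1] at [S] and then loses at most 1; if [S > 1], it is [- B] at
    time 1, hence above [- 1]. *)
Lemma reflected_ge : {ae P, forall w, - 2 <= X (- 1) 1 w}.
Proof.
apply: filterS aeG => w Gw; have [S1|S1] := leP (S w) 1%:E.
  have [_] := switched_hit_value (- 1) (lexx 0) Gw (hitting_gt0 (G0 Gw) (Gc Gw)) S1.
  lra.
have := lt_before_hitting (G0 Gw) (Gc Gw) ler01 S1.
rewrite /switched !min_timeE (leNgt (S w)) S1/= good_brownianE//; lra.
Qed.

(** A single coordinate event, the value at time 1 being below [- 2], separates the laws and the
    paths. Indistinguishable versions are allowed because the processes of the theorem are not
    regularised. *)
Lemma switched_same_lawN (V V' : R -> T -> R) :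
  {ae P, forall w, forall t, X 1 t w = V t w} ->
  {ae P, forall w, forall t, X (- 1) t w = V' t w} ->
  ~ same_law P V V' /\ ~ {ae P, forall w, forall t : R, 0 <= t -> V t w = V' t w}.
Proof.
move=> XV XV'; have one : (1 : R) ^+ 2 = 1 by rewrite expr1n.
have mone : (- 1 : R) ^+ 2 = 1 by rewrite sqrrN expr1n.
have nZ := good_poisson_martingale HP wp.
split=> [sl|VV'].
  pose C : set (R -> R) := [set f | cadlag f /\ f 1 < - 2].
  have skC : skorokhod_sigma C.
    rewrite /skorokhod_sigma; apply: sub_sigma_algebra.
    by exists 1, `]-oo, - 2[%classic.
  have := sl C skC.
  have [|_ ->] := ae_eq_prob (A := [set w | X 1 1 w < - 2]) (C := [set w | C (V ^~ w)]) cF _ mlt.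
    apply: filterS XV => w XVw; rewrite /C/= -(XVw 1); split=> [lt2|[]//]; split=> //.
    rewrite (_ : V ^~ w = X 1 ^~ w); last by apply/funext => t; rewrite -XVw.
    exact: (switched_cadlag S0 (good_brownian_martingale HP wp one) nZ).
  have [|_ ->] := ae_eq_prob (A := set0) (C := [set w | C (V' ^~ w)]) cF _ measurable0.
    apply: filterS2 XV' reflected_ge => w XVw ge2; split=> // -[_].
    by rewrite -(XVw 1) ltNge ge2.
  by move=> P0; have := switched_below_gt0; rewrite P0 measure0 ltxx.
have [|_ P0] := ae_eq_prob (A := set0) (C := [set w | X 1 1 w < - 2]) cF _ measurable0.
  apply: filterS2 (filterI XV XV') (filterI reflected_ge VV') => w [XVw XVw'] [ge2 VVw].
  split=> //; by rewrite /= XVw VVw// -XVw' ltNge ge2.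
by have := switched_below_gt0; rewrite P0 measure0 ltxx.
Qed.

End descent.

Unset Implicit Arguments.
Set Strict Implicit.

Theorem mainTheorem3 (R : realType) (d : measure_display)
    (T : measurableType d) (P : probability T R)
    (B : R -> T -> R) (mu : T -> {measure set (R * R) -> \bar R})
    (HP : measure_is_complete P)
    (HBmu : wiener_poisson P B mu inverse_square_levy) :
  let F := wp_filtration P B mu in
  let S := hitting_time B 1 in
  let u := fun (s : R) (w : T) => ((S w <= s%:E)%E)%:R : R in
  let N := fun (t : R) (w : T) => fine (mu w (`[0, t] `*` `[1, +oo[)) in
  let Nt := fun (t : R) (w : T) => N t w - t in
  let X := fun (t : R) (w : T) =>
    B (min_time S t w) w + Nt t w - Nt (min_time S t w) w in
  let X' := fun (t : R) (w : T) =>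
    - B (min_time S t w) w + Nt t w - Nt (min_time S t w) w in
  [/\ predictable F u,
      structure_solution P F u X,
      structure_solution P F u X',
      ~ same_law P X X' &
      exists v : R -> T -> R,
        [/\ bounded_process v, predictable F v,
            ~ pathwise_unique P F v & ~ unique_in_law P F v]].
Proof.
move=> F S u N Nt X X'.
have aeG := ae_good HBmu.
(* On [good] the regular versions coincide with the original processes at all times at once, in
   particular at the random time [S /\ t]. *)
have XE : {ae P, forall w, forall t,
    switched S (good_brownian B mu 1) (good_poisson B mu) t w = X t w}.
  apply: filterS aeG => w Gw t.
  by rewrite /switched good_brownianE// mul1r !good_poissonE.
have X'E : {ae P, forall w, forall t,
    switched S (good_brownian B mu (- 1)) (good_poisson B mu) t w = X' t w}.
  apply: filterS aeG => w Gw t.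
  by rewrite /switched good_brownianE// mulN1r !good_poissonE.
have cF := wp_complete_filtration HP HBmu.
have pu : predictable F u := after_hitting_predictable HP HBmu.
have solX : structure_solution P F u X.
  apply: (indistinguishable_solution cF XE).
  by apply: (switched_hitting_solution HP HBmu); rewrite expr1n.
have solX' : structure_solution P F u X'.
  apply: (indistinguishable_solution cF X'E).
  by apply: (switched_hitting_solution HP HBmu); rewrite sqrrN expr1n.
have [lawN pathN] := switched_same_lawN HP HBmu XE X'E.
split=> //; exists u; split=> //.
- exists 1 => t w _; rewrite /u; case: (S w <= t%:E)%E; rewrite /= ?normr1 ?normr0//.
- by move=> /(_ X X' solX solX').
- by move=> /(_ X X' solX solX').
Qed.
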